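(* Let $X=\mathbb P(T_7)\subset\mathbb P^6$ be the Stanley-Reisner scheme over $\mathbb C$ of the $7$-vertex triangulation $T_7$ of the torus. The smoothing component $S$ of $\mathrm{Def}^a_X$ is the germ of a normal Gorenstein affine toric variety.
   Context: $T_7$ is the unique (equivelar) triangulation of the torus with $7$ vertices: $\mathrm{vert}\,T_7=\mathbb Z/7$, with principal translations $\tau_1=1$, $\tau_2=4$, $\tau_3=2$ in $\mathbb Z/7$, and the $14$ triangles $\{p,p+1,p+5\}$, $\{p,p+1,p+3\}$, $p\in\mathbb Z/7$. Every pair of vertices is an edge; each edge is uniquely of the form $\{p,p+\tau_k\}$. $X=\mathrm{Proj}\,\mathbb C[x_0,\dots,x_6]/I_{T_7}$, with $I_{T_7}$ generated by the squarefree monomials of non-faces. $\mathrm{Def}^a_X$ is the functor of deformations of $(X,\mathcal O_X(1))$, and also denotes its versal base space; by a known theorem this is the germ at $0\in\mathbb C^{21}$, with coordinates $t_{p,q}=t_{q,p}$ ($p\ne q\in\mathbb Z/7$), defined by the $2\times2$ minors of the seven matrices $$\begin{bmatrix}t_{p,p+1}&t_{p,p+4}&t_{p,p+2}\\t_{p,p-1}&t_{p,p-4}&t_{p,p-2}\end{bmatrix},\quad p\in\mathbb Z/7.$$ It has a unique smoothing component $S$ (component whose general fibre is smooth). Explicitly, $S$ is the germ at $0$ of $\mathrm{Spec}\,\mathbb C[\mathbb S]$, where $\mathbb S$ is the semigroup generated by the $21$ vectors $A_{p,p+\tau_k}=\epsilon_k+e_p+e_{p+\tau_k}-e_{p-\tau_i}-e_{p-\tau_j}\in\mathbb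 Z^3\oplus\mathbb Z^7$ (standard basis $\epsilon_1,\epsilon_2,\epsilon_3$, $e_p$; $\{i,j,k\}=\{1,2,3\}$), embedded by $t_{p,p+\tau_k}\mapsto A_{p,p+\tau_k}$. *)

(* Defs.v *)
From HB Require Import structures.
From mathcomp Require Import all_boot all_order all_algebra.
From mathcomp Require Import ring_quotient complex boolp reals.
From mathcomp Require Import mpoly monalg.

Set Implicit Arguments.
Unset Strict Implicit.
Unset Printing Implicit Defensive.

Import Order.TTheory GRing.Theory Num.Theory.

Local Open Scope ring_scope.

Section CommutativeAlgebra.

Implicit Types R A : comNzRingType.

Definition in_ideal_gen R (I : finType) (g : I -> R) (x : R) : Prop :=
  exists c : I -> R, x = \sum_i c i * g i.

Definition prime_ideal R (P : {pred R}) : Prop :=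
  idealr_closed P /\ prime_idealr_closed P.

Definition minimal_prime_over R (J : R -> Prop) (P : {pred R}) : Prop :=
  [/\ prime_ideal P,
      forall x, J x -> x \in P &
      forall Q : {pred R}, prime_ideal Q ->
        (forall x, J x -> x \in Q) -> {subset Q <= P} -> {subset P <= Q}].

(* [idealr_closed] only concerns proper ideals; the unit ideal is generated by
   [1], so leaving it out is harmless here. *)
Definition noetherian R : Prop :=
  forall I : {pred R}, idealr_closed I ->
    exists (n : nat) (g : 'I_n -> R), forall x, x \in I <-> in_ideal_gen g x.

(* [phi] exhibits [A] as the localization of [R] at the prime [P]; this
   determines [A] up to a unique isomorphism of [R]-algebras. *)
Definition is_localization_at R (P : {pred R}) A (phi : {rmorphism R -> A}) :
    Prop :=
  [/\ forall s, s \notin P -> exists b, phi s * b = 1,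
      forall a, exists r s, s \notin P /\ a * phi s = phi r &
      forall r, phi r = 0 -> exists2 s, s \notin P & s * r = 0].

Definition is_fraction_field R (K : fieldType) (phi : {rmorphism R -> K}) :
    Prop :=
  injective phi /\ forall u, exists r s, s != 0 /\ u = phi r / phi s.

(* The existence of a fraction field forces [R] to be an integral domain. *)
Definition normal_domain R : Prop :=
  exists (K : fieldType) (phi : {rmorphism R -> K}),
    is_fraction_field phi /\
    forall u : K, integralOver phi u -> exists r : R, u = phi r.

Definition injective_module R (E : lmodType R) : Prop :=
  forall (M N : lmodType R) (f : {linear M -> N}) (g : {linear M -> E}),
    injective f -> exists h : {linear N -> E}, forall x, h (f x) = g x.

(* [M] has an injective resolution 0 -> M -> E_0 -> ... -> E_n -> 0, cut into
   the short exact sequences 0 -> M -> E_0 -> M_1 -> 0, and so on. *)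
Fixpoint injective_dim_le R (n : nat) (M : lmodType R) : Prop :=
  if n is m.+1 then
    exists (E Q : lmodType R) (i : {linear M -> E}) (q : {linear E -> Q}),
      [/\ injective_module E,
          injective i,
          forall z, exists y, q y = z,
          forall y, q y = 0 <-> exists x, y = i x &
          injective_dim_le m Q]
  else injective_module M.

(* A Noetherian ring all of whose local rings have finite injective dimension
   as modules over themselves. *)
Definition gorenstein R : Prop :=
  noetherian R /\
  forall P : {pred R}, prime_ideal P ->
    exists (A : comNzRingType) (phi : {rmorphism R -> A}),
      is_localization_at P phi /\
      exists n : nat, injective_dim_le n (A^o : lmodType A).

End CommutativeAlgebra.

Definition in_submonoid_gen (L : zmodType) (I : finType) (g : I -> L) (u : L) :
    Prop :=
  exists c : I -> nat, u = \sum_i g i *+ c i.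

(* [A] is the algebra of a finitely generated submonoid M of some Z^n, that is
   [A] is the coordinate ring of an affine toric variety, not necessarily
   normal: [chi u], for u in M, are the characters, which form a basis of [A].
   The values of [chi] outside M are irrelevant. *)
Definition affine_toric (k : fieldType) (A : comAlgType k) : Prop :=
  exists (n m : nat) (g : 'I_m -> 'rV[int]_n) (chi : 'rV[int]_n -> A),
    let M := in_submonoid_gen g in
    [/\ chi 0 = 1,
        forall u v, M u -> M v -> chi (u + v) = chi u * chi v,
        forall (s : seq 'rV[int]_n) (c : 'rV[int]_n -> k),
          uniq s -> (forall u, u \in s -> M u) ->
          \sum_(u <- s) c u *: chi u = 0 -> forall u, u \in s -> c u = 0 &
        forall a : A, exists (s : seq 'rV[int]_n) (c : 'rV[int]_n -> k),
          (forall u, u \in s -> M u) /\ a = \sum_(u <- s) c u *: chi u].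

(* The translations tau_1 = 1, tau_2 = 4, tau_3 = 2 of the seven-vertex torus,
   indexed by 0, 1, 2. *)
Definition tau (k : 'I_3) : 'Z_7 := [:: 1; 4%:R; 2%:R]`_k.

(* The edge {p, p + tau_k} is encoded as (p, k); every edge is of this form for
   exactly one (p, k). *)
Definition edge : finType := ('Z_7 * 'I_3)%type.

Section Base.

Variable k : comNzRingType.

Definition edge_poly : comNzRingType := {mpoly k[#|edge|]}.

Definition tvar (p : 'Z_7) (j : 'I_3) : edge_poly :=
  mpolyX k U_(enum_rank ((p, j) : edge)).

(* Rows (t_{p, p + tau_j})_j and (t_{p, p - tau_j})_j; the edge {p, p - tau_j}
   is the one starting at p - tau_j in direction j. *)
Definition def_mx (p : 'Z_7) : 'M[edge_poly]_(2, 3) :=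
  \matrix_(i, j) if i == 0 then tvar p j else tvar (p - tau j) j.

(* The ideal of the base space Def^a_X in the affine space of the t's. A choice
   [pf.2] of two columns that is not strictly increasing contributes, up to
   sign, another minor or zero. *)
Definition base_ideal : edge_poly -> Prop :=
  in_ideal_gen (fun pf : 'Z_7 * {ffun 'I_2 -> 'I_3} =>
    \det (colsub pf.2 (def_mx pf.1))).

End Base.

(* Z^3 + Z^7, the second summand being indexed by 'Z_7 = 'I_7. *)
Definition lattice : zmodType := 'rV[int]_(3 + 7).

Definition eps (k : 'I_3) : lattice := delta_mx 0 (lshift 7 k).
Definition e_ (p : 'Z_7) : lattice := delta_mx 0 (rshift 3 (p : 'I_7)).

Definition Avec (pk : edge) : lattice :=
  let: (p, k) := pk in
  eps k + e_ p + e_ (p + tau k) - \sum_(i < 3 | i != k) e_ (p - tau i).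

Definition in_SS : pred lattice := fun u => `[< in_submonoid_gen Avec u >].

Record SS : predArgType := SSub { SSval :> lattice; SSvalP : in_SS SSval }.
HB.instance Definition _ := [isSub for SSval].
HB.instance Definition _ := [Choice of SS by <:].

Lemma in_SS0 : in_SS 0.
Proof.
by apply/asboolP; exists (fun=> 0%N); rewrite big1 // => i _; rewrite mulr0n.
Qed.

Lemma in_SSD (u v : lattice) : in_SS u -> in_SS v -> in_SS (u + v).
Proof.
move=> /asboolP[c ->] /asboolP[d ->]; apply/asboolP.
exists (fun i => (c i + d i)%N); rewrite -big_split /=.
by apply: eq_bigr => i _; rewrite mulrnDr.
Qed.

Lemma in_SS_Avec (pk : edge) : in_SS (Avec pk).
Proof.
apply/asboolP; exists (fun i => (i == pk) : nat).
rewrite (bigD1 pk) //= eqxx big1 ?addr0 // => i /negbTE ->.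
by rewrite mulr0n.
Qed.

(* The linear form that makes the semigroup graded, with generators of degree
   one; it shows that the semigroup has no nontrivial invertible elements. *)
Definition eps_deg (u : lattice) : int := \sum_(i < 3) u 0 (lshift 7 i).

Lemma eps_degD (u v : lattice) : eps_deg (u + v) = eps_deg u + eps_deg v.
Proof. by rewrite -big_split; apply: eq_bigr => i _; rewrite mxE. Qed.

Lemma eps_deg_e (p : 'Z_7) : eps_deg (e_ p) = 0.
Proof. by rewrite /eps_deg big1 // => i _; rewrite mxE eq_lrshift andbF. Qed.

Lemma eps_deg_eps (k : 'I_3) : eps_deg (eps k) = 1.
Proof.
rewrite /eps_deg (bigD1 k) //= big1 => [|i ik]; first by rewrite mxE !eqxx addr0.
by rewrite mxE (inj_eq (@lshift_inj _ _)) (negbTE ik) andbF.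
Qed.

Lemma eps_deg_Avec (pk : edge) : eps_deg (Avec pk) = 1.
Proof.
case: pk => p k; rewrite /Avec -sumrN !eps_degD eps_deg_eps !eps_deg_e !addr0.
have d0 : eps_deg 0 = 0 by rewrite /eps_deg big1 // => i _; rewrite mxE.
rewrite (big_morph _ eps_degD d0) big1 ?addr0 // => i _.
apply: (addrI (eps_deg (e_ (p - tau i)))).
by rewrite -eps_degD subrr addr0 eps_deg_e d0.
Qed.

Lemma eps_deg_sum (c : edge -> nat) :
  eps_deg (\sum_i Avec i *+ c i) = (\sum_i c i)%N%:Z.
Proof.
have d0 : eps_deg 0 = 0 by rewrite /eps_deg big1 // => i _; rewrite mxE.
rewrite (big_morph _ eps_degD d0) (big_morph _ PoszD (erefl : 0%N%:Z = 0)).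
apply: eq_bigr => i _; elim: (c i) => [|n IHn]; first by rewrite mulr0n.
by rewrite mulrS eps_degD IHn eps_deg_Avec -intS.
Qed.

Lemma in_SS_pointed (u v : lattice) :
  in_SS u -> in_SS v -> u + v = 0 -> u = 0 /\ v = 0.
Proof.
move=> /asboolP[c uE] /asboolP[d vE] /(congr1 eps_deg).
rewrite eps_degD uE vE !eps_deg_sum [RHS]big1 => [|i _]; last by rewrite mxE.
move=> /eqP; rewrite -PoszD eqz_nat addn_eq0 !sum_nat_eq0.
case/andP=> /forallP c0 /forallP d0.
by split; rewrite big1 // => i _; [move: (c0 i) | move: (d0 i)] => /eqP ->;
  rewrite mulr0n.
Qed.

(* The semigroup, written multiplicatively as required by [{malg _[_]}]. *)
Definition SSone : SS := SSub in_SS0.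
Definition SSmul (u v : SS) : SS := SSub (in_SSD (SSvalP u) (SSvalP v)).

Lemma SSmulA : associative SSmul.
Proof. by move=> u v w; apply: val_inj; rewrite /= addrA. Qed.
Lemma SSmul1 : left_id SSone SSmul.
Proof. by move=> u; apply: val_inj; rewrite /= add0r. Qed.
Lemma SSmulr1 : right_id SSone SSmul.
Proof. by move=> u; apply: val_inj; rewrite /= addr0. Qed.
Lemma SSmul_unit (u v : SS) : SSmul u v = SSone -> u = SSone /\ v = SSone.
Proof.
move=> /(congr1 SSval) /= /(in_SS_pointed (SSvalP u) (SSvalP v))[u0 v0].
by split; apply: val_inj.
Qed.
Lemma SSmulC : commutative SSmul.
Proof. by move=> u v; apply: val_inj; rewrite /= addrC. Qed.

HB.instance Definition _ :=
  Choice_isMonomialDef.Build SS SSmulA SSmul1 SSmulr1 SSmul_unit.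
HB.instance Definition _ := MonomialDef_isConomialDef.Build SS SSmulC.

Definition Agen (pk : edge) : SS := SSub (in_SS_Avec pk).

Section SmoothingComponent.

Variable k : comNzRingType.

(* k[SS], the coordinate ring of the smoothing component. *)
Definition smoothing_ring : comAlgType k := {malg k[SS]}.

(* t_{p, p + tau_j} |-> x^A_{p, p + tau_j}; this is the embedding of Spec k[SS]
   in the affine space of the t's. *)
Definition smoothing_embedding : edge_poly k -> smoothing_ring :=
  mpoly.mmap (in_alg smoothing_ring) (fun i => << Agen (enum_val i) >>).

Definition smoothing_ideal : {pred edge_poly k} :=
  [pred f | smoothing_embedding f == 0].

End SmoothingComponent.

Arguments base_ideal k _ : clear implicits.
Arguments smoothing_ideal k _ : clear implicits.

(* Main.v *)
(* The algebra A = C[S] is the coordinate ring of the cone over a lattice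
   polytope of dimension 8 with 21 vertices and 24 facets, on whose vertices every
   facet functional takes only the values 0 and 1.  A pulling triangulation of it
   consists of 239 unimodular cells; it comes with a shelling, with positive
   weights on the vertices, and with binomials g = g' that lower the weight, g
   running over the squarefree minimal nonfaces.  Hence the words supported on a
   cell form a basis of A.

   Component.  A prime Q between the ideal of the minors and the ideal of S
   contains no monomial, so the binomials of Q define a cancellative congruence
   on words.  Up to cancellation every g = g' is a nonnegative integral
   combination of the minors, so Q contains all of them, and Q is the ideal of S.

   Normality.  A embeds in a polynomial ring in 9 variables through 9 of the
   facets.  If a fraction is integral over A, its leading exponent mu satisfies
   e + m mu in S for a fixed e and all m.  By Dickson's lemma two of the
   corresponding standard words are comparable; their difference is a multiple of
   some (m - m') mu supported on a cell, and unimodularity puts mu in S.  One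
   subtracts the leading term and continues.

   Gorenstein.  Let d v be inversely proportional to the weight of the vertex v,
   and theta_l = sum_v t_v^l x_v^(d v) for l < 9 with distinct scalars t_v.  The
   shelling makes A free over P = C[theta], and the degrees of the basis are
   symmetric on average about half the top degree.  Let lambda be the coefficient
   of the top basis element.  The determinant of the matrix of lambda (b b') has
   degree 0, and it is nonzero because A is a domain; thus the pairing
   lambda (a b) is perfect, Hom_P (A, P) = A, and Ext^i_A (-, A) = Ext^i_P (-, P)
   vanishes for i > 9.  By Baer's criterion the localizations of A have finite
   injective dimension. *)

Require Import Defs.
From mathcomp Require Import all_boot all_order all_algebra.
From mathcomp Require Import complex reals mpoly.
From HB Require Import structures.
From mathcomp Require Import ring_quotient fraction boolp perm.
From mathcomp Require Import ring zify.
From mathcomp.multinomials Require Import ssrcomplements.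
From mathcomp Require classical_sets finmap monalg.
From mathcomp Require Import mpoly.

Set Implicit Arguments.
Unset Strict Implicit.
Unset Printing Implicit Defensive.

Import Order.TTheory GRing.Theory Num.Theory.

Local Open Scope ring_scope.

(** * Injective modules *)

(** The geometric source of the Gorenstein property is the point eps_1 + eps_2 + eps_3: the
    generators of each triple 3 p, 3 p + 1, 3 p + 2 add up to it, and every facet functional is 1 on
    it. The classical criterion built on such a point speaks of canonical modules; here finite
    injective dimension has to be produced, so duality is made explicit as a perfect pairing over a
    polynomial ring. Obstacle: passing to standard words lowers the weight, so the weight filters A
    without grading it. Linear parameters would mix vertices of different weights and the reduction
    could climb back; the powers x_v^(d v) all have the same weight. The entries of the pairing
    matrix are then only bounded in degree, but for the determinant to be constant the bounds need
    to cancel only in total. This is why a symmetry on average is enough. On the homological side, a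
    ring over a field k has enough injectives of the form Hom_k(R, M), and over a Noetherian ring
    ideals are resolved by matrices, so that duality and localization become statements about
    matrices. *)

Lemma linear_exists (R : pzRingType) (U V : lmodType R) (f : U -> V) :
  linear f -> exists g : {linear U -> V}, g =1 f.
Proof.
move=> lf; pose m := GRing.isLinear.Build R U V _ f lf.
pose g : {linear U -> V} := HB.pack f m.
by exists g.
Qed.

Section QuotientModule.

Variables (R : nzRingType) (M : lmodType R) (N : M -> Prop).
Hypothesis N0 : N 0.
Hypothesis N_lin : forall a x y, N x -> N y -> N (a *: x + y).

(** Congruent elements define extensionally equal predicates, on which [choose] agrees. So a
    submodule given by a mere [Prop] has canonical representatives, and the quotient is carried by
    the fixed points of [quot_rep]. *)
Definition quot_rep (x : M) : M := choose (fun y => `[< N (y - x) >]) x.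

Let N_add x y : N x -> N y -> N (x + y).
Proof. by move=> Nx Ny; rewrite -[x]scale1r; apply: N_lin. Qed.

Let N_scale a x : N x -> N (a *: x).
Proof. by move=> Nx; rewrite -[_ *: _]addr0; apply: N_lin. Qed.

Let N_opp x : N x -> N (- x).
Proof. by move=> Nx; rewrite -scaleN1r; apply: N_scale. Qed.

Lemma quot_repP x : N (quot_rep x - x).
Proof.
have : `[< N (x - x) >] by apply/asboolP; rewrite subrr.
by move=> /(@chooseP _ (fun y => `[< N (y - x) >])) /asboolP.
Qed.

Lemma quot_rep_eq x y : quot_rep x = quot_rep y <-> N (x - y).
Proof.
split=> [e | Nxy].
  rewrite -(subrKA (quot_rep x)) {2}e; apply: N_add (quot_repP y).
  by rewrite -opprB; apply/N_opp/quot_repP.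
rewrite /quot_rep; set P := fun z => _; set P' := fun z => _.
have eP : P =1 P'.
  move=> z; apply/asboolP/asboolP => Nz.
    by rewrite -(subrKA x); apply: N_add.
  by rewrite -(subrKA y); apply: N_add => //; rewrite -opprB; apply: N_opp.
rewrite (eq_choose eP); apply: choose_id; first exact/asboolP.
by apply/asboolP; rewrite subrr.
Qed.

Lemma quot_rep_id x : quot_rep (quot_rep x) == quot_rep x.
Proof. by apply/eqP/quot_rep_eq/quot_repP. Qed.

(** The submodule axioms are arguments of the type so that the structures declared on it below can
    refer to them. *)
Definition quotM of N 0 & (forall a x y, N x -> N y -> N (a *: x + y)) :=
  {x : M | quot_rep x == x}.
Let Q := quotM N0 N_lin.
HB.instance Definition _ := Choice.on Q.

Definition quot_pi (x : M) : Q := exist _ (quot_rep x) (quot_rep_id x).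
Definition quot_val (u : Q) : M := sval u.

Let pi_eq x y : N (x - y) -> quot_pi x = quot_pi y.
Proof. by move=> /quot_rep_eq e; apply: val_inj. Qed.

Let piK u : quot_pi (quot_val u) = u.
Proof. by apply: val_inj; apply/eqP/(valP u). Qed.

Let valK x : N (quot_val (quot_pi x) - x).
Proof. exact: quot_repP. Qed.

Let qadd (u v : Q) := quot_pi (quot_val u + quot_val v).
Let qopp (u : Q) := quot_pi (- quot_val u).
Let qscale (a : R) (u : Q) := quot_pi (a *: quot_val u).

Let piD x y : quot_pi (x + y) = qadd (quot_pi x) (quot_pi y).
Proof.
by apply: pi_eq; rewrite opprD addrACA; apply: N_add;
  rewrite -opprB; apply/N_opp/valK.
Qed.
Let piN x : quot_pi (- x) = qopp (quot_pi x).
Proof. by apply: pi_eq; rewrite -opprD; apply/N_opp; rewrite -opprB; apply/N_opp/valK. Qed.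
Let piZ a x : quot_pi (a *: x) = qscale a (quot_pi x).
Proof. by apply: pi_eq; rewrite -scalerBr; apply/N_scale; rewrite -opprB; apply/N_opp/valK. Qed.

Let qaddA : associative qadd.
Proof. by move=> u v w; rewrite -[u]piK -[v]piK -[w]piK -!piD addrA. Qed.
Let qaddC : commutative qadd.
Proof. by move=> u v; rewrite -[u]piK -[v]piK -!piD addrC. Qed.
Let qadd0 : left_id (quot_pi 0) qadd.
Proof. by move=> u; rewrite -[u]piK -!piD add0r. Qed.
Let qaddN : left_inverse (quot_pi 0) qopp qadd.
Proof. by move=> u; rewrite -[u]piK -!piN -piD addNr. Qed.

HB.instance Definition _ := GRing.isZmodule.Build Q qaddA qaddC qadd0 qaddN.

Let piA x y : quot_pi (x + y) = quot_pi x + quot_pi y.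
Proof. exact: piD. Qed.

Let qscaleA a b u : qscale a (qscale b u) = qscale (a * b) u.
Proof. by rewrite -[u]piK -!piZ scalerA. Qed.
Let qscale1 : left_id 1 qscale.
Proof. by move=> u; rewrite -[u]piK -!piZ scale1r. Qed.
Let qscaleDr : right_distributive qscale +%R.
Proof. by move=> a u v; rewrite -[u]piK -[v]piK -!(piA, piZ) scalerDr piA. Qed.
Let qscaleDl u : {morph qscale^~ u : a b / a + b}.
Proof. by move=> a b; rewrite -[u]piK -!piZ scalerDl piA. Qed.

HB.instance Definition _ :=
  GRing.Zmodule_isLmodule.Build R Q qscaleA qscale1 qscaleDr qscaleDl.

Lemma quotient_module :
  exists (Q : lmodType R) (q : {linear M -> Q}),
    (forall z, exists x, q x = z) /\ (forall x, q x = 0 <-> N x).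
Proof.
have lpi : linear quot_pi by move=> a x y; rewrite piA piZ.
have [q qE] := linear_exists lpi.
exists Q, q; split=> [z | x]; first by exists (quot_val z); rewrite qE piK.
rewrite qE; split=> [e | Nx]; last by apply: pi_eq; rewrite subr0.
by have /quot_rep_eq := congr1 val e; rewrite subr0.
Qed.

End QuotientModule.

Section InjectiveExtension.

Variables (R : comNzRingType) (E : lmodType R).

(** Injectivity of [E] extends maps along injections only, so [D] is first replaced by the embedding
    of F / ker D in [G] that it induces. *)
Lemma injective_module_factor (F G : lmodType R) (D : {linear F -> G})
    (e : {linear F -> E}) :
  injective_module E -> (forall x, D x = 0 -> e x = 0) ->
  exists h : {linear G -> E}, forall x, e x = h (D x).
Proof.
move=> injE De.
have [|Q [q [q_surj q0]]] := @quotient_module R F (fun x => D x = 0) (linear0 D).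
  by move=> a x y Dx Dy; rewrite linearP Dx Dy scaler0 addr0.
have qK x y : q x = q y <-> D x = D y.
  split=> e1.
    by apply/eqP; rewrite -subr_eq0 -linearB; apply/eqP/q0; rewrite linearB e1 subrr.
  by apply/eqP; rewrite -subr_eq0 -linearB; apply/eqP/q0; rewrite linearB e1 subrr.
have eK x y : D x = D y -> e x = e y.
  move=> e1; apply/eqP; rewrite -subr_eq0 -linearB; apply/eqP/De.
  by rewrite linearB e1 subrr.
pose s z := sval (cid (q_surj z)).
have sK z : q (s z) = z by exact: (svalP (cid (q_surj z))).
have lD : linear (D \o s).
  move=> a x y /=; rewrite -linearP; apply/qK; rewrite sK linearP !sK.
  by [].
have le : linear (e \o s).
  by move=> a x y /=; rewrite -linearP; apply: eK; rewrite linearP; exact: lD.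
have [D' D'E] := linear_exists lD; have [e' e'E] := linear_exists le.
have [|h hE] := injE _ _ D' e'.
  by move=> x y; rewrite !D'E /= => /qK; rewrite !sK.
exists h => x; have := hE (q x); rewrite D'E e'E /= => hE'.
have Dsx : D (s (q x)) = D x by apply/qK; rewrite sK.
by rewrite -Dsx hE'; apply: eK.
Qed.

(** A map out of the ideal [J] is represented by a function on all of [R] constrained on [J] alone,
    which avoids a type for the ideal. *)
Definition baer : Prop :=
  forall (J : R -> Prop) (g : R -> E),
    J 0 -> (forall a x y, J x -> J y -> J (a * x + y)) ->
    (forall a x y, J x -> J y -> g (a * x + y) = a *: g x + g y) ->
    exists q, forall x, J x -> g x = x *: q.

Section Extend.

Import classical_sets.

Variables (M N : lmodType R) (f : {linear M -> N}) (g : {linear M -> E}).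
Hypothesis f_inj : injective f.

(** Partial extensions of [g] along [f] are kept as graphs, submodules of [N * E] that are
    single-valued at 0: the upper bound of a nonempty chain is then its union. *)
Let partial_ext (G : set (N * E)) : Prop :=
  [/\ forall m, G (f m, g m),
      forall a u v, G u -> G v -> G (a *: u + v) &
      forall e, G (0, e) -> e = 0].

Let graph : set (N * E) := fun u => exists m, u = (f m, g m).

Let graph_ext : partial_ext graph.
Proof.
split=> [m | a _ _ [m ->] [m' ->] | e [m [/esym fm ->]]].
- by exists m.
- by exists (a *: m + m'); rewrite !linearP.
- by have -> : m = 0; [apply: f_inj; rewrite fm linear0 | rewrite linear0].
Qed.

Let ext_sub G a u v : partial_ext G -> G u -> G v -> G (v - a *: u).
Proof. by case=> _ Gl _ Gu Gv; rewrite addrC -scaleNr; apply: Gl. Qed.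

Let ext_inj G n e e' : partial_ext G -> G (n, e) -> G (n, e') -> e = e'.
Proof.
move=> extG Ge Ge'; apply/eqP; rewrite -subr_eq0; apply/eqP.
case: (extG) => _ _; apply; have := ext_sub 1 extG Ge' Ge.
by rewrite scale1r -[_ - _]/(n - n, e - e') subrr.
Qed.

Lemma baer_extension : baer -> exists h : {linear N -> E}, forall x, h (f x) = g x.
Proof.
move=> baerE.
have [F FP Ftot | A [PA Amax]] :=
    @Zorn_bigcup _ (fun G => G = set0 \/ partial_ext G).
  have [[X FX [u Xu]]|none] := pselect (exists2 X, F X & nonempty X); last first.
    left; apply/seteqP; split=> // u [X FX Xu].
    by case: none; exists X => //; exists u.
  have Fext Y v : F Y -> Y v -> partial_ext Y.
    by move=> FY Yv; case: (FP _ FY) => // Y0; move: Yv; rewrite Y0.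
  have extX := Fext _ _ FX Xu.
  right; split=> [m | a v w [Y FY Yv] [Z FZ Zw] | e [Y FY Ye]].
  - by exists X => //; case: extX.
  - have [extY extZ] := (Fext _ _ FY Yv, Fext _ _ FZ Zw).
    have [YZ|ZY] := Ftot _ _ FY FZ.
      by exists Z => //; case: extZ => _ + _; apply=> //; apply: YZ.
    by exists Y => //; case: extY => _ + _; apply=> //; apply: ZY.
  - by case: (Fext _ _ FY Ye) => _ _; apply.
have extA : partial_ext A.
  case: PA => // A0; case: (Amax graph); last by right.
  rewrite A0; split; first by move=> ?.
  by move=> sub0; case: (sub0 (f 0, g 0)); exists 0.
have A_total n : exists e, A (n, e).
  (* The scalars carrying [n] into the domain of [A] form an ideal. Baer's criterion yields a value
     [q] at [n] compatible with [A], and maximality puts [(n, q)] in [A]. *)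
  pose J a := exists e, A (a *: n, e).
  pose ga a := if pselect (J a) is left Ja then sval (cid Ja) else 0.
  have gaP a e : A (a *: n, e) -> ga a = e.
    rewrite /ga; case: pselect => [Ja|nJ] Ae; last by case: nJ; exists e.
    by case: cid => e' /= Ae'; apply: ext_inj Ae' Ae.
  have A00 : A (0, 0) by case: extA => /(_ 0); rewrite !linear0.
  have Alin a u v : A u -> A v -> A (a *: u + v) by case: extA => _ + _; apply.
  have [|a x y [e Ae] [e' Ae']|a x y [e Ae] [e' Ae']|q qP] := baerE J ga.
  - by exists 0; rewrite scale0r.
  - exists (a *: e + e'); rewrite scalerDl -scalerA.
    exact: (Alin a (_, e) (_, e')).
  - rewrite (gaP _ _ Ae) (gaP _ _ Ae'); apply: gaP; rewrite scalerDl -scalerA.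
    exact: (Alin a (_, e) (_, e')).
  pose B : set (N * E) := fun u => exists a v, A v /\ u = a *: (n, q) + v.
  have AB : subset A B by move=> u Au; exists 0, u; rewrite scale0r add0r.
  have extB : partial_ext B.
    split=> [m | a _ _ [b [u [Au ->]]] [c [v [Av ->]]] | e [a [[n' e'] [Au]]]].
    - by apply: AB; case: extA.
    - exists (a * b + c), (a *: u + v); split; first exact: Alin.
      by rewrite scalerDr scalerDl addrACA -!scalerA.
    - move=> [/esym /eqP]; rewrite addr_eq0 => /eqP an ->.
      have Au' : A (a *: n, - e').
        have := Alin (-1) _ _ Au A00; rewrite addr0 scaleN1r.
        by rewrite -[- (_, _)]/(- n', - e') -an.
      rewrite -(qP a) ?(gaP _ _ Au') ?addNr //.
      by exists (- e').
  have BA : subset B A.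
    have [//|nBA] := pselect (subset B A).
    by case: (Amax B) => //; right.
  exists q; apply: BA; exists 1, 0; split; first exact: A00.
  by rewrite scale1r addr0.
pose h n := sval (cid (A_total n)).
have hP n : A (n, h n) by rewrite /h; case: cid.
have [|h' h'E] := @linear_exists _ _ _ h.
  move=> a x y; apply: (ext_inj extA (hP _)).
  by case: extA => _ /(_ a (x, h x) (y, h y)) + _; apply.
exists h' => x; rewrite h'E; apply: (ext_inj extA (hP _)).
by case: extA.
Qed.

End Extend.

Lemma baer_injective : baer -> injective_module E.
Proof. by move=> baerE M N f g f_inj; apply: baer_extension. Qed.

End InjectiveExtension.

Lemma vector_space_injective (k : fieldType) (V : lmodType k) :
  injective_module V.
Proof.
apply: baer_injective => J g J0 Jl gl.
have g0 : g 0 = 0.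
  by have := gl (-1) 0 0 J0 J0; rewrite mulr0 addr0 scaleN1r addNr.
have [[a Ja a0]|J1] := pselect (exists2 a, J a & a != 0); last first.
  exists 0 => x Jx; rewrite scaler0; case: (eqVneq x 0) => [->//|x0].
  by case: J1; exists x.
exists (a^-1 *: g a) => x _; have := gl (x / a) a 0 Ja J0.
by rewrite g0 !addr0 mulfVK // scalerA.
Qed.

(** * Coinduced modules and vanishing of Ext *)

Section Restriction.

Variables (S R : comNzRingType) (f : {rmorphism S -> R}).

(** An alias of the carrier that remembers [f], to which the scalar action of [S] can be attached
    without disturbing that of [R]. *)
Definition restr of {rmorphism S -> R} : lmodType R -> Type := id.

Variable M : lmodType R.
Let rM := restr f M.
HB.instance Definition _ := GRing.Zmodule.on rM.
Definition restr_scale (a : S) (x : rM) : rM := f a *: (x : M).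

Let restr_scaleA a b u : restr_scale a (restr_scale b u) = restr_scale (a * b) u.
Proof. by rewrite /restr_scale scalerA rmorphM. Qed.
Let restr_scale1 : left_id 1 restr_scale.
Proof. by move=> u; rewrite /restr_scale rmorph1 scale1r. Qed.
Let restr_scaleDr : right_distributive restr_scale +%R.
Proof. by move=> a u v; rewrite /restr_scale -scalerDr. Qed.
Let restr_scaleDl u : {morph restr_scale^~ u : a b / a + b}.
Proof. by move=> a b; rewrite /restr_scale rmorphD scalerDl. Qed.
HB.instance Definition _ := GRing.Zmodule_isLmodule.Build S rM
  restr_scaleA restr_scale1 restr_scaleDr restr_scaleDl.

Lemma restr_scaleE a (x : rM) : a *: x = f a *: (x : M).
Proof. by []. Qed.

End Restriction.

Section Coinduced.

Variables (R : comNzRingType) (C : R -> Prop) (M : lmodType R).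

(* The additive maps from [R] to [M] that commute with the scalars in [C],
   as an [R]-module through the source. *)
Record coind := Coind {
  coind_fun :> R -> M;
  coindD : forall p q, coind_fun (p + q) = coind_fun p + coind_fun q;
  coindZ : forall c q, C c -> coind_fun (c * q) = c *: coind_fun q }.

Lemma coind_ext (f g : coind) : f =1 g -> f = g.
Proof.
case: f g => [f fD fZ] [g gD gZ] /= /funext efg; case: g / efg gD gZ => gD gZ.
by congr Coind; apply: Prop_irrelevance.
Qed.

HB.instance Definition _ := gen_eqMixin coind.
HB.instance Definition _ := gen_choiceMixin coind.

Definition coind_zero : coind.
Proof. by exists (fun=> 0) => [p q | c q _]; rewrite ?addr0 ?scaler0. Defined.
Definition coind_add (f g : coind) : coind.
Proof.
exists (fun p => f p + g p) => [p q | c q Cc]; first by rewrite !coindD addrACA.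
by rewrite !coindZ // scalerDr.
Defined.
Definition coind_opp (f : coind) : coind.
Proof.
exists (fun p => - f p) => [p q | c q Cc]; first by rewrite coindD opprD.
by rewrite coindZ // scalerN.
Defined.
Definition coind_scale (a : R) (f : coind) : coind.
Proof.
exists (fun p => f (p * a)) => [p q | c q Cc]; first by rewrite mulrDl coindD.
by rewrite -mulrA coindZ.
Defined.

Let coind_addA : associative coind_add.
Proof. by move=> f g h; apply: coind_ext => p /=; rewrite addrA. Qed.
Let coind_addC : commutative coind_add.
Proof. by move=> f g; apply: coind_ext => p /=; rewrite addrC. Qed.
Let coind_add0 : left_id coind_zero coind_add.
Proof. by move=> f; apply: coind_ext => p /=; rewrite add0r. Qed.
Let coind_addN : left_inverse coind_zero coind_opp coind_add.
Proof. by move=> f; apply: coind_ext => p /=; rewrite addNr. Qed.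
HB.instance Definition _ :=
  GRing.isZmodule.Build coind coind_addA coind_addC coind_add0 coind_addN.

Let coind_scaleA a b u : coind_scale a (coind_scale b u) = coind_scale (a * b) u.
Proof. by apply: coind_ext => p /=; rewrite -mulrA. Qed.
Let coind_scale1 : left_id 1 coind_scale.
Proof. by move=> f; apply: coind_ext => p /=; rewrite mulr1. Qed.
Let coind_scaleDr : right_distributive coind_scale +%R.
Proof. by move=> a f g; apply: coind_ext. Qed.
Let coind_scaleDl u : {morph coind_scale^~ u : a b / a + b}.
Proof. by move=> a b; apply: coind_ext => p /=; rewrite mulrDr coindD. Qed.
HB.instance Definition _ := GRing.Zmodule_isLmodule.Build R coind
  coind_scaleA coind_scale1 coind_scaleDr coind_scaleDl.

Lemma coind_addE (f g : coind) p : (f + g) p = f p + g p. Proof. by []. Qed.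
Lemma coind_scaleE a (f : coind) p : (a *: f) p = f (p * a). Proof. by []. Qed.
Lemma coind_embed : exists i : {linear M -> coind}, forall x p, i x p = p *: x.
Proof.
pose i x : coind := @Coind (fun p => p *: x) (fun p q => scalerDl x p q)
  (fun c q _ => esym (scalerA c q x)).
have [|j jE] := @linear_exists _ _ _ i; last by exists j => x p; rewrite jE.
move=> a x y; apply: coind_ext => p.
by rewrite coind_addE coind_scaleE /= scalerDr scalerA.
Qed.

End Coinduced.

(** Evaluation at 1 turns [R]-linear maps into the coinduced module into [k]-linear maps into [M],
    and these extend because every vector space is injective. *)
Lemma coind_injective (k : fieldType) (R : comNzRingType)
    (f : {rmorphism k -> R}) (M : lmodType R) :
  injective_module (coind (fun c => exists a, c = f a) M).
Proof.
move=> U V i g i_inj.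
have lin_res (X Y : lmodType R) (h : {linear X -> Y}) :
    linear (h : restr f X -> restr f Y).
  by move=> a x y; rewrite !restr_scaleE [LHS]linearP.
have [i' i'E] := linear_exists (lin_res _ _ i).
have lg1 : linear (fun x : restr f U => (g x 1 : restr f M)).
  move=> a x y; rewrite !restr_scaleE [g _]linearP coind_addE coind_scaleE mul1r.
  by rewrite -[f a]mulr1 coindZ ?mulr1 //; exists a.
have [g' g'E] := linear_exists lg1.
have [|h hE] := @vector_space_injective k (restr f M) _ _ i' g'.
  by move=> x y; rewrite !i'E => /i_inj.
have hD x y : h (x + y) = h x + h y := linearD h x y.
have hZ a (x : V) : h (f a *: x) = f a *: (h x : M) := linearZ_LR h a x.
have HD (y : V) (p q : R) : h ((p + q) *: y) = (h (p *: y) : M) + h (q *: y).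
  by rewrite scalerDl; exact: hD.
have HZ (y : V) (c q : R) : (exists a, c = f a) -> h ((c * q) *: y) = c *: (h (q *: y) : M).
  by move=> [a ->]; rewrite -scalerA hZ.
pose H y := @Coind R (fun c => exists a, c = f a) M (fun q => h (q *: y)) (HD y) (HZ y).
have lH : linear H.
  move=> a x y; apply: coind_ext => q.
  by rewrite coind_addE coind_scaleE /= scalerDr scalerA; exact: hD.
have [H' H'E] := linear_exists lH; exists H' => x; rewrite H'E.
apply: coind_ext => q /=; have := hE (q *: x); rewrite i'E g'E.
by rewrite [i _]linearZ [g _]linearZ coind_scaleE mul1r => ->.
Qed.

(** * Long exact sequences and dimension shifting *)

Section Chains.

Variable R : comNzRingType.

Definition projective (F : lmodType R) : Prop :=
  forall (M N : lmodType R) (q : {linear M -> N}) (f : {linear F -> N}),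
    (forall z, exists x, q x = z) -> exists h : {linear F -> M}, forall x, q (h x) = f x.

Definition exact_chain (F : nat -> lmodType R)
    (D : forall i, {linear F i.+1 -> F i}) : Prop :=
  forall i x, D i x = 0 <-> exists y, x = D i.+1 y.

(* [Hom(-, M)] applied to the chain has no cohomology in position [i + 1]. *)
Definition acyclic_at (F : nat -> lmodType R)
    (D : forall i, {linear F i.+1 -> F i}) (M : lmodType R) (i : nat) : Prop :=
  forall f : {linear F i.+1 -> M}, (forall x, f (D i.+1 x) = 0) ->
    exists h : {linear F i -> M}, forall x, f x = h (D i x).

Definition short_exact (L M N : lmodType R) (j : {linear L -> M})
    (q : {linear M -> N}) : Prop :=
  [/\ injective j, forall z, exists y, q y = z &
      forall y, q y = 0 <-> exists x, y = j x].

Lemma linear_comp_exists (L M N : lmodType R) (g : {linear M -> N})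
    (f : {linear L -> M}) : exists h : {linear L -> N}, forall x, h x = g (f x).
Proof. by exists (g \o f). Qed.

Lemma linear_sub_exists (L M : lmodType R) (f g : {linear L -> M}) :
  exists h : {linear L -> M}, forall x, h x = f x - g x.
Proof.
have [|h hE] := @linear_exists _ _ _ (fun x => f x - g x); last by exists h.
by move=> a x y; rewrite (linearP f) (linearP g) scalerBr opprD addrACA.
Qed.

Lemma linear_lift_inj (K L M : lmodType R) (j : {linear L -> M})
    (f : {linear K -> M}) : injective j -> (forall x, exists y, f x = j y) ->
  exists h : {linear K -> L}, forall x, j (h x) = f x.
Proof.
move=> j_inj fj; pose s x := sval (cid (fj x)).
have sE x : f x = j (s x) by rewrite /s; case: cid.
have [|h hE] := @linear_exists _ _ _ s.
  by move=> a x y; apply: j_inj; rewrite -sE !linearP -!sE.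
by exists h => x; rewrite hE -sE.
Qed.

Variables (F : nat -> lmodType R) (D : forall i, {linear F i.+1 -> F i}).
Hypothesis F_proj : forall i, projective (F i).
Hypothesis D_exact : exact_chain D.

Let DD i x : D i (D i.+1 x) = 0.
Proof. by apply/D_exact; exists x. Qed.

Lemma injective_acyclic (E : lmodType R) i : injective_module E -> acyclic_at D E i.
Proof.
move=> injE f fD; apply: injective_module_factor => // x /D_exact[y ->].
exact: fD.
Qed.

(** The stretch H(N) -> H(L) -> H(M) of the long exact sequence, with the connecting map first: a
    cocycle in [L] bounds some [h] in [M], and a lift of the bounding map of [q \o h] corrects [h]
    to land in [L]. *)
Lemma acyclic_sub (L M N : lmodType R) (j : {linear L -> M})
    (q : {linear M -> N}) i : short_exact j q ->
  acyclic_at D M i.+1 -> acyclic_at D N i -> acyclic_at D L i.+1.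
Proof.
move=> [j_inj q_surj qj] acM acN f fD.
have [jf jfE] := linear_comp_exists j f.
have [|h hE] := acM jf; first by move=> x; rewrite jfE fD linear0.
have [qh qhE] := linear_comp_exists q h.
have [|l lE] := acN qh.
  by move=> x; rewrite qhE -hE jfE; apply/qj; exists (f x).
have [l' l'E] := F_proj l q_surj.
have [l'D l'DE] := linear_comp_exists l' (D i).
have [t tE] := linear_sub_exists h l'D.
have [|t' t'E] := linear_lift_inj (f := t) j_inj.
  by move=> x; apply/qj; rewrite tE l'DE linearB l'E -lE qhE subrr.
exists t' => x; apply: j_inj; rewrite t'E tE l'DE DD linear0 subr0.
by rewrite -hE jfE.
Qed.

(** The stretch H(M) -> H(N) -> H(L): lift the cocycle to [M], measure in [L] its failure to be a
    cocycle, and correct the lift by a bounding map of that failure. *)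
Lemma acyclic_quot (L M N : lmodType R) (j : {linear L -> M})
    (q : {linear M -> N}) i : short_exact j q ->
  acyclic_at D M i -> acyclic_at D L i.+1 -> acyclic_at D N i.
Proof.
move=> [j_inj q_surj qj] acM acL f fD.
have [e eE] := F_proj f q_surj.
have [eD eDE] := linear_comp_exists e (D i.+1).
have [|m mE] := linear_lift_inj (f := eD) j_inj.
  by move=> x; apply/qj; rewrite eDE eE fD.
have [|n nE] := acL m.
  by move=> x; apply: j_inj; rewrite mE eDE DD !linear0.
have [jn jnE] := linear_comp_exists j n.
have [t tE] := linear_sub_exists e jn.
have [|h hE] := acM t.
  by move=> x; rewrite tE jnE -nE mE eDE subrr.
have [qh qhE] := linear_comp_exists q h.
exists qh => x; rewrite qhE -hE tE linearB eE jnE.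
by have -> : q (j (n x)) = 0; [apply/qj; exists (n x) | rewrite subr0].
Qed.

End Chains.

(* [n] bounds the injective dimension of [M], through vanishing of Ext. *)
Definition ext_bound (R : comNzRingType) (M : lmodType R) (n : nat) : Prop :=
  forall (F : nat -> lmodType R) (D : forall i, {linear F i.+1 -> F i}) i,
    (forall i, projective (F i)) -> exact_chain D -> (n <= i)%N ->
    acyclic_at D M i.

Lemma ext_bound_inj (R : comNzRingType) (E : lmodType R) :
  injective_module E -> ext_bound E 0.
Proof. by move=> injE F D i Fp De _; apply: injective_acyclic. Qed.

Lemma ext_bound_ses (R : comNzRingType) (L M N : lmodType R)
    (j : {linear L -> M}) (q : {linear M -> N}) n : short_exact j q ->
  ext_bound M n -> ext_bound N n -> ext_bound L n.+1.
Proof.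
move=> ses bM bN F D [//|i] Fp De ni.
by apply: (acyclic_sub Fp De ses); [apply: bM => //; apply: ltnW | apply: bN].
Qed.

(* [e] embeds [F 0] in [R] and maps the image of [D 0] onto [J]. *)
Definition resolves (R : comNzRingType) (J : R -> Prop)
    (F : nat -> lmodType R) (D : forall i, {linear F i.+1 -> F i}) : Prop :=
  [/\ forall i, projective (F i), exact_chain D &
      exists (e : {linear F 0 -> R^o}) (u : F 0),
        (forall x, e x *: u = x) /\
        forall a, J a <-> exists y, e (D 0 y) = a].

(** Dimension shifting along M -> E -> Q with E coinduced lowers the bound by one without changing
    the resolutions. At bound 0, vanishing in the first position for a resolution of R / J is Baer's
    criterion at [J]; hence only ideals have to be resolved. *)
Lemma injective_dim_le_ext (k : fieldType) (R : comNzRingType)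
    (f : {rmorphism k -> R}) (n : nat) (M : lmodType R) :
  (forall J : R -> Prop, J 0 -> (forall a x y, J x -> J y -> J (a * x + y)) ->
    exists (F : nat -> lmodType R) (D : forall i, {linear F i.+1 -> F i}), resolves J D /\
      forall i, (n <= i)%N -> acyclic_at D M i) ->
  injective_dim_le n M.
Proof.
elim: n M => [|n IHn] M res /=.
  apply: baer_injective => J g J0 Jl gl.
  have [F [D [[Fp De [e [u [eK Je]]]] acM]]] := res J J0 Jl.
  have Jy y : J (e (D 0 y)) by apply/Je; exists y.
  have [|g' g'E] := @linear_exists _ _ _ (fun y => g (e (D 0 y))).
    by move=> a x y; rewrite !linearP gl.
  have [|x|h hE] := acM 0 _ g' _ => //.
    rewrite g'E; have -> : D 0 (D 1 x) = 0 by apply/De; exists x.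
    by rewrite linear0; have := gl (-1) 0 0 J0 J0; rewrite mulr0 addr0 scaleN1r addNr.
  (* [u] generates [F 0], so the value of the extension at [u] is the multiplier required by Baer's
     criterion. *)
  exists (h u) => x /Je[y <-]; rewrite -linearZ eK.
  by rewrite -hE g'E.
pose E : lmodType R := coind (fun c => exists a, c = f a) M.
have [i iE] := coind_embed (fun c => exists a, c = f a) M.
have [|a _ _ [x ->] [y ->]|Q [q [q_surj q0]]] :=
    @quotient_module R E (fun y => exists x, y = i x).
- by exists 0; rewrite linear0.
- by exists (a *: x + y); rewrite linearP.
have injE : injective_module E by apply: coind_injective.
have i_inj : injective i.
  move=> x y /(congr1 (fun h : coind _ M => h 1)).
  by rewrite !iE !scale1r.
exists E, Q, i, q; split=> //; apply: IHn => J J0 Jl.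
have [F [D [resD acM]]] := res J J0 Jl; exists F, D; split=> // m nm.
case: (resD) => Fp De _.
apply: (acyclic_quot (j := i) (q := q) Fp De) => //.
  exact: injective_acyclic.
by apply: acM.
Qed.

(** * Polynomial rings over a field *)

Section PolynomialRing.

Variables (k : fieldType) (n : nat).
Local Notation P := {mpoly k[n]}.
Variable M : lmodType P.

Lemma mpoly_linear_ext (F : 'X_{1..n} -> M) :
  exists f : P -> M, [/\ forall p q, f (p + q) = f p + f q,
    forall c q, f (c%:MP * q) = c%:MP *: f q & forall m, f 'X_[m] = F m].
Proof.
pose f (p : P) := \sum_(m <- msupp p) (p@_m)%:MP *: F m.
have fE b p : (msize p <= b)%N -> f p = \sum_(m : 'X_{1..n < b}) (p@_m)%:MP *: F m.
  move=> pb; pose I : subFinType _ := 'X_{1..n < b}.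
  rewrite /f (big_mksub I) ?msupp_uniq //=; first last.
    by move=> x /msize_mdeg_lt /leq_trans; apply.
  rewrite big_rmcond //= => j /memN_msupp_eq0 ->.
  by rewrite mpolyC0 scale0r.
exists f; split=> [p q | c q | m]; last first.
- by rewrite /f msuppX big_seq1 mcoeffX eqxx mpolyC1 scale1r.
- have le_cq : (msize (c%:MP * q) <= msize q)%N by rewrite mul_mpolyC msizeZ_le.
  rewrite (fE _ _ le_cq) (fE _ _ (leqnn _)) scaler_sumr; apply: eq_bigr => m _.
  by rewrite mcoeffCM mpolyCM scalerA.
pose b := maxn (msize (p + q)) (maxn (msize p) (msize q)).
rewrite !(fE b) ?leq_max ?leqnn ?orbT // -big_split; apply: eq_bigr => m _.
by rewrite mcoeffD mpolyCD scalerDl.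
Qed.

Lemma mpoly_linear_ind (Q : P -> Prop) :
  (forall m, Q 'X_[m]) -> (forall p q, Q p -> Q q -> Q (p + q)) ->
  (forall c q, Q q -> Q (c%:MP * q)) -> forall p, Q p.
Proof.
move=> QX QD QC; elim/mpolyind => [|c m p _ _ Qp].
  by have := QC 0 _ (QX 0%MM); rewrite mpolyC0 mul0r.
by apply: QD => //; rewrite -mul_mpolyC; apply: QC.
Qed.

(** The scalars respected at stage [j] interpolate between two extremes: [coind (C 0) M] is Hom_k(P,
    M), which is injective, and [coind (C n) M] is [M] itself. Each new variable costs one
    dimension. *)
Let C (j : nat) (c : P) : Prop :=
  (exists a, c = a%:MP) \/ exists i : 'I_n, (i < j)%N /\ c = 'X_i.

Let C_const j a : C j a%:MP. Proof. by left; exists a. Qed.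
Let C_var j (i : 'I_n) : (i < j)%N -> C j 'X_i. Proof. by right; exists i. Qed.

(** The maps commuting with one more variable are the kernel of f |-> X_i f - f X_i. That operator
    is onto, because f(X_i p) = X_i f(p) - g(p) is solved by recursion on the exponent of X_i. *)
Lemma coind_vars_step (i : 'I_n) :
  exists (u : {linear coind (C i.+1) M -> coind (C i) M})
         (v : {linear coind (C i) M -> coind (C i) M}), short_exact u v.
Proof.
have CS c : C i c -> C i.+1 c.
  by case=> [[a ->]|[l [li ->]]]; [apply: C_const | apply/C_var/ltnW].
pose u (f : coind (C i.+1) M) : coind (C i) M :=
  @Coind _ (C i) M f (@coindD _ _ _ f) (fun c q Cc => @coindZ _ _ _ f c q (CS c Cc)).
have [|u' u'E] := @linear_exists _ _ _ u.
  move=> a f g; apply: coind_ext => p; transitivity (f (p * a) + g p).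
    transitivity ((a *: f + g) p); first by [].
    by rewrite coind_addE coind_scaleE.
  transitivity ((a *: u f) p + u g p); last by rewrite -coind_addE.
  by rewrite coind_scaleE.
pose vf (f : coind (C i) M) p := 'X_i *: f p - f ('X_i * p).
have vD f p q : vf f (p + q) = vf f p + vf f q.
  by rewrite /vf mulrDr !coindD scalerDr opprD addrACA.
have vZ f c q : C i c -> vf f (c * q) = c *: vf f q.
  move=> Cc; rewrite /vf mulrCA !(coindZ f _ Cc) scalerBr !scalerA.
  by rewrite [c * _]mulrC.
pose v f : coind (C i) M := Coind (vD f) (vZ f).
have [|v' v'E] := @linear_exists _ _ _ v.
  move=> a f g; apply: coind_ext => p.
  rewrite /= /vf !coind_addE !coind_scaleE scalerDr opprD addrACA /= /vf.
  by rewrite mulrA.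
have v'0 f : v' f = 0 <-> forall p, f ('X_i * p) = 'X_i *: f p.
  split=> [e p | e].
    apply/esym/eqP; rewrite -subr_eq0; apply/eqP.
    by have := congr1 (fun g : coind _ M => g p) e; rewrite v'E.
  by apply: coind_ext => p; rewrite v'E /= /vf e subrr.
exists u', v'; split.
- move=> f g; rewrite !u'E => /(congr1 (fun h : coind _ M => h : P -> M)) e.
  by apply: coind_ext => p; have := congr1 (fun h => h p) e.
- move=> g.
  (* [mt m t] resets the exponent of X_i in [m] to [t]; [F] is the closed form of the recursion
     started at 0 on monomials free of X_i. *)
  pose mt (m : 'X_{1..n}) t := [multinom if l == i then t else m l | l < n].
  pose F (m : 'X_{1..n}) : M :=
    - \sum_(t < m i) 'X_i ^+ (m i - t.+1) *: g 'X_[mt m t].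
  have [f [fD fC fX]] := mpoly_linear_ext F.
  have FS m : F (m + U_(i))%MM = 'X_i *: F m - g 'X_[m].
    rewrite /F mnmDE mnm1E eqxx addn1 big_ord_recr /= subnn expr0 scale1r opprD.
    congr (_ - g 'X_[_]); last first.
      apply/mnmP=> l; rewrite mnmE; case: (eqVneq l i) => [->|li] //.
      by rewrite mnmDE mnm1E eq_sym (negbTE li) addn0.
    rewrite scalerN scaler_sumr; congr (- _); apply: eq_bigr => t _.
    rewrite scalerA -exprS -subSn ?ltn_ord //; congr (_ *: g 'X_[_]).
    by apply/mnmP=> l; rewrite !mnmE; case: (eqVneq l i) => [|_] //; rewrite addn0.
  have fv (l : 'I_n) p : (l < i)%N -> f ('X_l * p) = 'X_l *: f p.
    move=> li; elim/mpoly_linear_ind: p => [m | p q ep eq | c q eq].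
    - rewrite -mpolyXD !fX /F mnmDE mnm1E.
      have /negbTE nli : l != i by rewrite -val_eqE ltn_eqF.
      rewrite nli add0n scalerN scaler_sumr; congr (- _); apply: eq_bigr => t _.
      rewrite scalerA mulrC -scalerA; congr (_ *: _).
      rewrite -coindZ; last exact: C_var.
      rewrite -mpolyXD; congr (g 'X_[_]); apply/mnmP=> a; rewrite !mnmE.
      by case: eqP => // ->; rewrite nli.
    - by rewrite mulrDr !fD ep eq scalerDr.
    - by rewrite mulrCA !fC eq !scalerA mulrC.
  have fZ c q : C i c -> f (c * q) = c *: f q.
    by case=> [[a ->]|[l [li ->]]]; [apply: fC | apply: fv].
  exists (Coind fD fZ); rewrite v'E; apply: coind_ext => p /=; rewrite /vf /=.
  elim/mpoly_linear_ind: p => [m | p q ep eq | c q eq].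
  - rewrite -mpolyXD addmC !fX FS opprB addrC subrK //.
  - by rewrite mulrDr !fD coindD -ep -eq scalerDr opprD addrACA.
  - rewrite mulrCA !fC coindZ // -eq scalerBr !scalerA; congr (_ *: _ - _).
    exact: mulrC.
- move=> f; rewrite v'0; split=> [fi | [g ->] p]; last first.
    rewrite u'E /= coindZ //; exact: C_var.
  have fZ c q : C i.+1 c -> f (c * q) = c *: f q.
    case=> [[a ->]|[l []]]; first by apply: coindZ.
    rewrite ltnS leq_eqVlt => /orP[/eqP /val_inj ->|li] -> //.
    by apply: coindZ; apply: C_var.
  exists (Coind (@coindD _ _ _ f) fZ); rewrite u'E; exact: coind_ext.
Qed.

Lemma ext_bound_iso (R : comNzRingType) (U V : lmodType R) (i : {linear U -> V}) d :
  injective i -> (forall y, exists x, y = i x) -> ext_bound V d -> ext_bound U d.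
Proof.
move=> i_inj i_surj bV F D j Fp De dj f fD.
have [g gE] := linear_comp_exists i f.
have [|h hE] := bV F D j Fp De dj g; first by move=> x; rewrite gE fD linear0.
have [|h' h'E] := linear_lift_inj (f := h) i_inj; first by move=> x; apply: i_surj.
by exists h' => x; apply: i_inj; rewrite h'E -hE gE.
Qed.

Lemma mpoly_ext_bound : ext_bound M n.
Proof.
have bC j : (j <= n)%N -> ext_bound (coind (C j) M) j.
  elim: j => [_ | j IHj jn].
    have -> : C 0 = (fun c => exists a, c = a%:MP).
      apply/funext => c; apply/propext; split=> [[//|[? []//]]|]; by left.
    exact/ext_bound_inj/(@coind_injective k P (@mpolyC n k)).
  have [u [v uv]] := coind_vars_step (Ordinal jn).
  by apply: ext_bound_ses uv (IHj (ltnW jn)) (IHj (ltnW jn)).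
have [i iE] := coind_embed (C n) M.
apply: (ext_bound_iso (i := i)) (bC n (leqnn n)).
  move=> x y /(congr1 (fun h : coind _ M => h 1)); by rewrite !iE !scale1r.
move=> f; exists (f 1); apply: coind_ext => p; rewrite iE.
elim/mpoly_linear_ind: p => [m | p q ep eq | c q eq]; last first.
- by rewrite coindZ // eq scalerA.
- by rewrite coindD ep eq scalerDl.
rewrite mpolyXE_id -[X in f X]mulr1.
elim: (index_enum _) => [|l s IHs]; first by rewrite !big_nil mul1r scale1r.
rewrite !big_cons -scalerA -IHs -mulrA.
elim: (m l) => [|e IHe]; first by rewrite expr0 mul1r scale1r.
by rewrite exprS -mulrA coindZ ?IHe ?scalerA //; apply: C_var.
Qed.

End PolynomialRing.

(** * Free resolutions over Noetherian rings *)

Section RowModules.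

Variable R : comNzRingType.

Lemma row_linear_ext m (M : lmodType R) (u : 'I_m -> M) :
  exists h : {linear 'rV[R]_m -> M}, forall x, h x = \sum_j x 0 j *: u j.
Proof.
apply: linear_exists => a x y; rewrite scaler_sumr -big_split.
by apply: eq_bigr => j _; rewrite !mxE scalerDl scalerA.
Qed.

Lemma row_linearE m (M : lmodType R) (f : {linear 'rV[R]_m -> M}) x :
  f x = \sum_j x 0 j *: f (delta_mx 0 j).
Proof. by rewrite {1}[x]row_sum_delta linear_sum; apply: eq_bigr => j _; rewrite linearZ. Qed.

Lemma row_projective m : projective ('rV[R]_m : lmodType R).
Proof.
move=> M N q f q_surj.
pose s z := sval (cid (q_surj z)); have sE z : q (s z) = z by rewrite /s; case: cid.
have [h hE] := row_linear_ext (fun j => s (f (delta_mx 0 j))).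
exists h => x; rewrite hE linear_sum [RHS]row_linearE.
by apply: eq_bigr => j _; rewrite linearZ /= sE.
Qed.

Lemma mulmx_linear m n (D : 'M[R]_(m, n)) :
  exists h : {linear 'rV[R]_m -> 'rV[R]_n}, forall x, h x = x *m D.
Proof. by exists (mulmxr D). Qed.

Definition mx_exact (m : nat -> nat) (D : forall i, 'M[R]_(m i.+1, m i)) : Prop :=
  forall i (x : 'rV[R]_(m i.+1)), x *m D i = 0 <-> exists y, x = y *m D i.+1.

(** Linear maps from rows to [R] are columns, so this is acyclicity of the complex dual to [D], in a
    form that can be localized entry by entry. *)
Definition mx_acyclic (m : nat -> nat) (D : forall i, 'M[R]_(m i.+1, m i)) i : Prop :=
  forall v : 'cV[R]_(m i.+1), D i.+1 *m v = 0 -> exists w : 'cV[R]_(m i), v = D i *m w.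

Lemma row_eq_mx m n (A B : 'M[R]_(m, n)) :
  (forall x : 'rV[R]_m, x *m A = x *m B) -> A = B.
Proof. by move=> e; apply/row_matrixP => i; rewrite !rowE e. Qed.

Hypothesis R_noeth : noetherian R.

Lemma noetherian_fg (J : R -> Prop) :
  J 0 -> (forall a x y, J x -> J y -> J (a * x + y)) ->
  exists (n : nat) (g : 'I_n -> R), forall x, J x <-> in_ideal_gen g x.
Proof.
move=> J0 Jl; have [J1|nJ1] := pselect (J 1).
  exists 1%N, (fun=> 1) => x; split=> [_|_].
    by exists (fun=> x); rewrite big_ord1 mulr1.
  by have := Jl x 1 0 J1 J0; rewrite mulr1 addr0.
have [|n [g gE]] := @R_noeth [pred x | `[< J x >]].
  split; [exact/asboolP | by apply/negP => /asboolP |].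
  by move=> a x y /asboolP Jx /asboolP Jy; apply/asboolP/Jl.
by exists n, g => x; split=> [Jx|/gE/asboolP //]; apply/gE/asboolP.
Qed.

(** Induction on the width: lifts of generators of the ideal of first entries, together with
    generators of the submodule of rows with first entry 0. *)
Lemma noetherian_rows m (S : 'rV[R]_m -> Prop) :
  S 0 -> (forall a x y, S x -> S y -> S (a *: x + y)) ->
  exists n (G : 'M[R]_(n, m)), forall x, S x <-> exists y, x = y *m G.
Proof.
elim: m S => [|m IHm] S S0 Sl.
  exists 0%N, 0 => x; split=> [_|_]; last by rewrite [x]thinmx0.
  by exists 0; rewrite [LHS]thinmx0 [RHS]thinmx0.
have Ssum (I : finType) (c : I -> R) (u : I -> 'rV[R]_m.+1) :
    (forall i, S (u i)) -> S (\sum_i c i *: u i).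
  move=> Su; elim/big_ind: _ => [//|x y Sx Sy|i _]; first by rewrite -[x]scale1r; apply: Sl.
  by rewrite -[_ *: _]addr0; apply: Sl.
have [|a x y [u Su <-] [v Sv <-]|n [g gE]] :=
    @noetherian_fg (fun a => exists2 x, S x & x 0 0 = a).
- by exists 0; rewrite ?mxE.
- by exists (a *: u + v); rewrite ?mxE //; apply: Sl.
have [|a x y Sx Sy|n' [G' G'E]] :=
    IHm (fun y => S (row_mx (0 : 'rV_1) y : 'rV_(1 + m))).
- by rewrite row_mx0.
- have -> : row_mx 0 (a *: x + y) = a *: row_mx 0 x + row_mx 0 y :> 'rV_(1 + m).
    by rewrite scale_row_mx add_row_mx scaler0 addr0.
  exact: Sl.
have gJ i : exists x : 'rV[R]_m.+1, S x /\ x 0 0 = g i.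
  have /gE[x Sx xi] : in_ideal_gen g (g i).
    exists (fun j => (j == i)%:R); rewrite (bigD1 i) //= eqxx mul1r big1 ?addr0 //.
    by move=> j /negbTE ->; rewrite mul0r.
  by exists x.
pose X i := sval (cid (gJ i)).
have [SX Xg] : (forall i, S (X i)) /\ (forall i, X i 0 0 = g i).
  by split=> i; rewrite /X; case: cid => ? [].
pose G : 'M[R]_(n + n', m.+1) :=
  col_mx (\matrix_i X i) (row_mx (0 : 'M_(n', 1)) G' : 'M_(n', 1 + m)).
have GE (y1 : 'rV_n) (y2 : 'rV_n') : row_mx y1 y2 *m G =
    \sum_i y1 0 i *: X i + row_mx (0 : 'rV_1) (y2 *m G').
  rewrite mul_row_col mulmx_sum_row; congr (_ + _).
    by apply: eq_bigr => i _; rewrite rowK.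
  by rewrite (mul_mx_row y2 (0 : 'M_(n', 1)) G') mulmx0.
exists (n + n')%N, G => x; split=> [Sx | [y ->]]; last first.
  rewrite -[y]hsubmxK GE -[X in S (X + _)]scale1r; apply: Sl; first exact: Ssum.
  by apply/G'E; eexists.
have /gE[c cE] : exists2 x', S x' & x' 0 0 = x 0 0 by exists x.
pose y1 : 'rV_n := \row_i c i.
pose z : 'rV_(1 + m) := x - \sum_i y1 0 i *: X i.
have Sz : S z by rewrite /z addrC -scaleN1r; apply: Sl => //; apply: Ssum.
have z0 : lsubmx z = 0 :> 'rV_1.
  apply/rowP => j; rewrite [j]ord1 !mxE.
  have -> : lshift m (0 : 'I_1) = 0 by apply: val_inj.
  rewrite cE summxE -sumrB big1 // => i _.
  by rewrite !mxE Xg subrr.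
move: Sz; rewrite -[z]hsubmxK z0 => /G'E[y2 y2E].
exists (row_mx y1 y2); rewrite GE -y2E -z0 hsubmxK /z addrC subrK //.
Qed.

Lemma noetherian_resolution (J : R -> Prop) :
  J 0 -> (forall a x y, J x -> J y -> J (a * x + y)) ->
  exists (m : nat -> nat) (D : forall i, 'M[R]_(m i.+1, m i)),
    mx_exact D /\ exists i0 : 'I_(m 0%N), (forall j, j = i0) /\
    forall a, J a <-> exists y : 'rV[R]_(m 1%N), (y *m D 0%N) 0 i0 = a.
Proof.
move=> J0 Jl.
have [|a x y Jx Jy|r [G GE]] := @noetherian_rows 1 (fun x => J (x 0 0)).
- by rewrite mxE.
- by rewrite !mxE; apply: Jl.
pose T := {ab : nat * nat & 'M[R]_(ab.2, ab.1)}.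
have next (t : T) : exists n (G' : 'M[R]_(n, (tag t).2)),
    forall x : 'rV[R]_(tag t).2, x *m tagged t = 0 <-> exists y, x = y *m G'.
  apply: noetherian_rows => [|a x y e1 e2]; first by rewrite mul0mx.
  by rewrite mulmxDl -scalemxAl e1 e2 scaler0 addr0.
pose nx t := sval (cid (next t)).
have nxP t : exists (G' : 'M[R]_(nx t, (tag t).2)),
    forall x : 'rV[R]_(tag t).2, x *m tagged t = 0 <-> exists y, x = y *m G'.
  by rewrite /nx; case: cid.
(* The new first size is the old second size by conversion, so consecutive syzygy matrices compose
   without casts. *)
pose step (t : T) : T := existT (fun ab : nat * nat => 'M[R]_(ab.2, ab.1))
  ((tag t).2, nx t) (sval (cid (nxP t))).
pose t0 : T := existT (fun ab : nat * nat => 'M[R]_(ab.2, ab.1)) (1%N, r) G.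
pose t i := iter i step t0.
pose m i := (tag (t i)).1.
have mS i : (tag (t i)).2 = m i.+1 by [].
exists m, (fun i => tagged (t i)); split.
  move=> i x; rewrite {2}/t /=; case: cid => G' /= G'E; exact: G'E.
exists (0 : 'I_1); split=> [j|a]; first exact: ord1.
have -> : J a <-> J ((a%:M : 'rV[R]_1) 0 0) by rewrite mxE mulr1n.
rewrite GE; split=> [[y e]|[y e]]; exists y; last first.
  by apply/rowP => j; rewrite [j]ord1 mxE mulr1n -e.
by rewrite -[LHS]/((y *m G) 0 0) -e mxE mulr1n.
Qed.

End RowModules.

(** * Frobenius extensions and localization *)

Section Frobenius.

Variables (P A : comNzRingType) (psi : {rmorphism P -> A}).

Let plin (h : A -> P) := forall p a b, h (psi p * a + b) = p * h a + h b.

(* [A] is a finite projective [P]-module and [(a, b) |-> lambda (a * b)] is a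
   perfect pairing. *)
Definition frobenius : Prop :=
  exists (I : finType) (b : I -> A) (co : I -> A -> P) (lambda : A -> P),
    [/\ forall i, plin (co i),
        forall a, a = \sum_i psi (co i a) * b i,
        plin lambda,
        forall h, plin h -> exists c, forall a, h a = lambda (a * c) &
        forall x, (forall a, lambda (a * x) = 0) -> x = 0].

Hypothesis A_frob : frobenius.

Lemma restr_rows_projective m : projective (restr psi 'rV[A]_m).
Proof.
have [I [b [co [_ [co_lin bE _ _ _]]]]] := A_frob.
move=> M N q f q_surj.
pose s z := sval (cid (q_surj z)); have sE z : q (s z) = z by rewrite /s; case: cid.
pose e i j : restr psi 'rV[A]_m := b i *: (delta_mx 0 j : 'rV[A]_m).
have [|h hE] := @linear_exists _ (restr psi 'rV[A]_m) M
    (fun x => \sum_j \sum_i co i ((x : 'rV[A]_m) 0 j) *: s (f (e i j))).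
  move=> a x y; rewrite scaler_sumr -big_split; apply: eq_bigr => j _.
  rewrite scaler_sumr -big_split; apply: eq_bigr => i _.
  by rewrite restr_scaleE !mxE co_lin scalerDl scalerA.
have xE x : x = \sum_j \sum_i co i ((x : 'rV[A]_m) 0 j) *: e i j.
  rewrite {1}[x]row_sum_delta; apply: eq_bigr => j _.
  rewrite {1}[(x : 'rV[A]_m) 0 j]bE scaler_suml; apply: eq_bigr => i _.
  by rewrite restr_scaleE scalerA.
exists h => x; rewrite hE [in RHS](xE x) !linear_sum; apply: eq_bigr => j _.
by rewrite !linear_sum; apply: eq_bigr => i _; rewrite !linearZ /= sE.
Qed.

(** Composition with [lambda] identifies Hom_A(-, A) with Hom_P(-, P). A cocycle over [A] thus
    becomes one over [P] and is bounded there; the bounding map is represented by a column over [A],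
    and nondegeneracy lifts the equality back. *)
Lemma frobenius_acyclic n m (D : forall i, 'M[A]_(m i.+1, m i)) i :
  ext_bound (P^o : lmodType P) n -> mx_exact D -> (n <= i)%N -> mx_acyclic D i.
Proof.
have [I [b [co [la [_ _ la_lin la_rep la_nondeg]]]]] := A_frob.
move=> bP De ni v Dv.
have lD j : linear (fun x : restr psi 'rV[A]_(m j.+1) =>
    ((x : 'rV[A]_(m j.+1)) *m D j : restr psi 'rV[A]_(m j))).
  by move=> a x y; rewrite !restr_scaleE mulmxDl -scalemxAl.
pose Dl j := sval (cid (linear_exists (lD j))).
have DlE j x : Dl j x = (x : 'rV[A]_(m j.+1)) *m D j by rewrite /Dl; case: cid => f ->.
have [|al alE] := @linear_exists P (restr psi 'rV[A]_(m i.+1)) (P^o : lmodType P)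
    (fun x => la (((x : 'rV[A]_(m i.+1)) *m v) 0 0)).
  move=> a x y; rewrite restr_scaleE mulmxDl -scalemxAl !mxE.
  by rewrite la_lin.
have [||x|be beE] := bP _ Dl i _ _ ni al => //.
- by move=> j; apply: restr_rows_projective.
- by move=> j x; rewrite DlE De; split=> -[y yE]; exists y; rewrite yE DlE.
- rewrite alE DlE -mulmxA Dv mulmx0 mxE.
  by have := la_lin (-1) 0 0; rewrite rmorphN rmorph1 mulr0 addr0 mulN1r addNr.
pose h j (a : A) : P := be (a *: (delta_mx 0 j : 'rV[A]_(m i))).
have h_lin j : plin (h j).
  move=> p x y; rewrite /h scalerDl -scalerA.
  exact: (linearP be p (x *: (delta_mx 0 j : 'rV[A]_(m i)) : restr psi _)).
pose c j := sval (cid (la_rep _ (h_lin j))).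
have cE j a : h j a = la (a * c j) by rewrite /c; case: cid.
have laB x y : la (x - y) = la x - la y.
  by have := la_lin (-1) y x; rewrite rmorphN rmorph1 !mulN1r ![- _ + _]addrC.
have laD : {morph la : x y / x + y}.
  by move=> x y; have := la_lin 1 x y; rewrite rmorph1 !mul1r.
have la0 : la 0 = 0 by have := laB 0 0; rewrite !subrr.
exists (\col_j c j); apply/matrixP => r z; rewrite [z]ord1 {z}.
apply/eqP; rewrite -subr_eq0; apply/eqP/la_nondeg => a.
rewrite mulrBr laB; apply/eqP; rewrite subr_eq0; apply/eqP.
have := beE (a *: (delta_mx 0 r : 'rV[A]_(m i.+1))).
rewrite alE DlE -!scalemxAl -!rowE !mxE => ->.
rewrite [row r (D i)]row_sum_delta scaler_sumr mulr_sumr (big_morph la laD la0).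
have beD : {morph (be : 'rV[A]_(m i) -> P) : x y / x + y} by exact: (linearD be).
have be0 : be 0 = 0 by exact: (linear0 be).
rewrite (big_morph be beD be0); apply: eq_bigr => j _.
by rewrite scalerA !mxE mulrA -cE.
Qed.

End Frobenius.

(** * Localization of complexes of matrices by clearing denominators *)

Section LocalizedMatrices.

Variables (A B : comNzRingType) (P : {pred A}) (phi : {rmorphism A -> B}).
Hypothesis P_prime : prime_ideal P.
Hypothesis phi_loc : is_localization_at P phi.

Let P1 : 1 \notin P.
Proof. by case: P_prime => -[]. Qed.
Let PM s t : s \notin P -> t \notin P -> s * t \notin P.
Proof.
by case: P_prime => _ PP sP tP; apply/negP => /PP /orP[]; apply/negP.
Qed.

Lemma loc_unit s : s \notin P -> exists b, phi s * b = 1.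
Proof. by case: phi_loc => + _ _; apply. Qed.

Lemma loc_common (I : finType) (x : I -> B) :
  exists s (y : I -> A), s \notin P /\ forall i, phi s * x i = phi (y i).
Proof.
have frac i : exists rs : A * A, rs.2 \notin P /\ x i * phi rs.2 = phi rs.1.
  by case: phi_loc => _ /(_ (x i))[r [s [sP e]]] _; exists (r, s).
pose f i := sval (cid (frac i)).
have [fP fE] : (forall i, (f i).2 \notin P) /\ (forall i, x i * phi (f i).2 = phi (f i).1).
  by split=> i; rewrite /f; case: cid => ? [].
exists (\prod_i (f i).2), (fun i => (f i).1 * \prod_(j | j != i) (f j).2); split.
  by elim/big_ind: _ => // s t; apply: PM.
move=> i; rewrite (bigD1 i) //= !rmorphM mulrC mulrA fE //.
Qed.

Lemma loc_kill (I : finType) (y : I -> A) :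
  (forall i, phi (y i) = 0) -> exists s, s \notin P /\ forall i, s * y i = 0.
Proof.
move=> y0.
have kill i : exists s, s \notin P /\ s * y i = 0.
  by case: phi_loc => _ _ /(_ _ (y0 i))[s sP e]; exists s.
pose f i := sval (cid (kill i)).
have [fP fE] : (forall i, f i \notin P) /\ (forall i, f i * y i = 0).
  by split=> i; rewrite /f; case: cid => ? [].
exists (\prod_i f i); split; first by elim/big_ind: _ => // s t; apply: PM.
by move=> i; rewrite (bigD1 i) //= mulrAC fE mul0r.
Qed.

Local Notation "M ^phi" := (map_mx phi M) (at level 2, format "M ^phi").

Lemma loc_mx_common m n (x : 'M[B]_(m, n)) :
  exists s (y : 'M[A]_(m, n)), s \notin P /\ phi s *: x = y^phi.
Proof.
have [s [y [sP e]]] := loc_common (fun ij : 'I_m * 'I_n => x ij.1 ij.2).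
exists s, (\matrix_(i, j) y (i, j)); split=> //.
by apply/matrixP => i j; rewrite !mxE -e.
Qed.

Lemma loc_mx_kill m n (y : 'M[A]_(m, n)) :
  y^phi = 0 -> exists2 s, s \notin P & s *: y = 0.
Proof.
move=> /matrixP y0.
have [|s [sP e]] := @loc_kill _ (fun ij : 'I_m * 'I_n => y ij.1 ij.2).
  by move=> [i j]; have := y0 i j; rewrite !mxE.
by exists s => //; apply/matrixP => i j; rewrite !mxE (e (i, j)).
Qed.

Lemma loc_mx_cancel m n s (x y : 'M[B]_(m, n)) :
  s \notin P -> phi s *: x = phi s *: y -> x = y.
Proof.
move=> /loc_unit[b sb] e; rewrite -[x]scale1r -[y]scale1r -sb mulrC -!scalerA.
by rewrite e.
Qed.

Lemma loc_mx_div m n s (x : 'M[B]_(m, n)) :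
  s \notin P -> exists y, x = phi s *: y.
Proof.
by move=> /loc_unit[b sb]; exists (b *: x); rewrite scalerA sb scale1r.
Qed.

Variables (m : nat -> nat) (D : forall i, 'M[A]_(m i.+1, m i)).

Lemma loc_mx_exact : mx_exact D -> mx_exact (fun i => (D i)^phi).
Proof.
move=> De i x; split=> [xD | [y ->]]; last first.
  have D2 : D i.+1 *m D i = 0.
    by apply: row_eq_mx => z; rewrite mulmx0 mulmxA; apply/De; exists z.
  by rewrite -mulmxA -map_mxM D2 map_mx0 mulmx0.
have [s [y [sP e]]] := loc_mx_common x.
have /loc_mx_kill[t tP yD] : (y *m D i)^phi = 0.
  by rewrite map_mxM -e -scalemxAl xD scaler0.
have /De[z zE] : (t *: y) *m D i = 0 by rewrite -scalemxAl.
have [w wE] := loc_mx_div z^phi (PM tP sP).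
exists w; apply: (loc_mx_cancel (PM tP sP)).
by rewrite scalemxAl -wE -map_mxM -zE rmorphM -scalerA e map_mxZ.
Qed.

Lemma loc_mx_acyclic i : mx_acyclic D i -> mx_acyclic (fun i => (D i)^phi) i.
Proof.
move=> Da v Dv; have [s [y [sP e]]] := loc_mx_common v.
have /loc_mx_kill[t tP yD] : (D i.+1 *m y)^phi = 0.
  by rewrite map_mxM -e -scalemxAr Dv scaler0.
have /Da[z zE] : D i.+1 *m (t *: y) = 0 by rewrite -scalemxAr.
have [w wE] := loc_mx_div z^phi (PM tP sP).
exists w; apply: (loc_mx_cancel (PM tP sP)).
by rewrite scalemxAr -wE -map_mxM -zE rmorphM -scalerA e map_mxZ.
Qed.

End LocalizedMatrices.

(** Every ideal [J] of the localization is extended from its preimage in [A], so a resolution of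
    that preimage by matrices localizes to one of [J], and the vanishing known over [A] localizes
    with it. *)
Lemma gorenstein_local (k : fieldType) (A B : comNzRingType)
    (f : {rmorphism k -> B}) (P : {pred A}) (phi : {rmorphism A -> B}) (n : nat) :
  noetherian A -> prime_ideal P -> is_localization_at P phi ->
  (forall m (D : forall i, 'M[A]_(m i.+1, m i)) i,
     mx_exact D -> (n <= i)%N -> mx_acyclic D i) ->
  injective_dim_le n (B^o : lmodType B).
Proof.
move=> A_noeth P_prime phi_loc acA; apply: (injective_dim_le_ext f) => J J0 Jl.
have JM a x : J x -> J (a * x) by move=> Jx; rewrite -[_ * _]addr0; apply: Jl.
have [||m [D [De [i0 [i0E IE]]]]] := @noetherian_resolution A A_noeth (fun a => J (phi a)).
- by rewrite rmorph0.
- by move=> a x y Jx Jy; rewrite rmorphD rmorphM; apply: Jl.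
have De' := loc_mx_exact P_prime phi_loc De.
pose Dl i := sval (cid (mulmx_linear (map_mx phi (D i)))).
have DlE i x : Dl i x = x *m map_mx phi (D i) by rewrite /Dl; case: cid.
have evl : linear (fun x : 'rV[B]_(m 0%N) => (x 0 i0 : B^o)).
  by move=> a x y; rewrite !mxE.
have [ev evE] := linear_exists evl.
exists (fun i => 'rV[B]_(m i)), Dl; split; last first.
  move=> i ni g gD.
  pose v : 'cV[B]_(m i.+1) := \col_j g (delta_mx 0 j).
  have gE x : g x = (x *m v) 0 0.
    by rewrite row_linearE mxE; apply: eq_bigr => j _; rewrite mxE.
  have [|w wE] := loc_mx_acyclic P_prime phi_loc (acA m D i De ni) (v := v).
    apply/row_eq_mx => x; rewrite mulmx0 mulmxA; apply/rowP => j.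
    by rewrite [j]ord1 -gE -DlE gD mxE.
  have [h hE] := row_linear_ext (fun j => w j 0 : B^o).
  exists h => x; rewrite gE wE mulmxA -DlE mxE hE.
  by apply: eq_bigr.
split.
- by move=> i; apply: row_projective.
- by move=> i x; rewrite DlE De'; split=> -[y yE]; exists y; rewrite yE DlE.
exists ev, (delta_mx 0 i0); split.
  move=> x; apply/rowP => j; by rewrite evE !mxE eqxx (i0E j) eqxx mulr1.
move=> b; have [_ /(_ b)[r [s [sP e]]] _] := phi_loc.
have [c sc] := loc_unit phi_loc sP; split=> [Jb | [y <-]].
  have /IE[y yE] : J (phi r) by rewrite -e mulrC; apply: JM.
  exists (c *: map_mx phi y); rewrite evE DlE -scalemxAl -map_mxM mxE [map_mx _ _ _ _]mxE yE -e.
  by rewrite mulrCA [c * _]mulrC sc mulr1.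
have [t [z [tP te]]] := loc_mx_common P_prime phi_loc y.
have [d td] := loc_unit phi_loc tP.
have Jz : J (phi ((z *m D 0%N) 0 i0)) by apply/IE; exists z.
suff -> : ev (Dl 0%N y) = d * phi ((z *m D 0%N) 0 i0) by apply: JM.
have -> : phi ((z *m D 0%N) 0 i0) = (map_mx phi (z *m D 0%N)) 0 i0 by rewrite [RHS]mxE.
by rewrite map_mxM -te -scalemxAl mxE mulrA [d * _]mulrC td mul1r evE DlE.
Qed.

Section LocalizationOfDomain.

Variables (A : comNzRingType) (K : fieldType) (phi : {rmorphism A -> K}).
Hypothesis phi_inj : injective phi.
Variable P : {pred A}.
Hypothesis P_prime : prime_ideal P.

Let P1 : 1 \notin P.
Proof. by case: P_prime => -[]. Qed.
Let PM s t : s \notin P -> t \notin P -> s * t \notin P.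
Proof.
by case: P_prime => _ PP sP tP; apply/negP => /PP /orP[]; apply/negP.
Qed.
Let P_neq0 s : s \notin P -> phi s != 0.
Proof.
move=> sP; apply: contraNneq sP => s0.
by have -> : s = 0; [apply: phi_inj; rewrite rmorph0 | case: P_prime => -[]].
Qed.

(** The localization of a domain is realised as a subring of a field that contains the domain. *)
Definition locP : {pred K} :=
  fun x => `[< exists r s, s \notin P /\ x = phi r / phi s >].

Lemma locP_subring : subring_closed locP.
Proof.
split=> [|_ _ /asboolP[r [s [sP ->]]] /asboolP[r' [s' [sP' ->]]]
         |_ _ /asboolP[r [s [sP ->]]] /asboolP[r' [s' [sP' ->]]]]; apply/asboolP.
- by exists 1, 1; rewrite rmorph1 divr1.
- exists (r * s' - r' * s), (s * s'); split; first exact: PM.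
  rewrite rmorphB !rmorphM -[- (_ / _)]mulNr addf_div ?P_neq0 //.
  by rewrite mulNr.
- by exists (r * r'), (s * s'); split; [exact: PM | rewrite !rmorphM mulf_div].
Qed.

HB.instance Definition _ := GRing.isSubringClosed.Build K locP locP_subring.

Definition locT := {x : K | locP x}.
HB.instance Definition _ := SubChoice.on locT.
HB.instance Definition _ := [SubChoice_isSubComNzRing of locT by <:].

Lemma locP_image a : locP (phi a).
Proof. by apply/asboolP; exists a, 1; rewrite rmorph1 divr1. Qed.

Definition loc_map (a : A) : locT := exist _ (phi a) (locP_image a).

Lemma loc_map_additive : additive loc_map.
Proof. by move=> a b; apply: val_inj; rewrite /= rmorphB. Qed.

Lemma loc_map_multiplicative : multiplicative loc_map.
Proof. by split=> [a b|]; apply: val_inj; rewrite /= ?rmorphM ?rmorph1. Qed.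

HB.instance Definition _ := GRing.isAdditive.Build A locT loc_map loc_map_additive.
HB.instance Definition _ :=
  GRing.isMultiplicative.Build A locT loc_map loc_map_multiplicative.

Lemma domain_localization :
  exists (B : comNzRingType) (f : {rmorphism A -> B}), is_localization_at P f.
Proof.
exists locT, loc_map; split.
- move=> s sP; have sl : locP (phi s)^-1.
    by apply/asboolP; exists 1, s; rewrite rmorph1 mul1r.
  by exists (Sub (phi s)^-1 sl : locT); apply: val_inj; rewrite /= divff ?P_neq0.
- move=> [x xl]; have /asboolP[r [s [sP e]]] := xl.
  exists r, s; split=> //; apply: val_inj; rewrite /= e divfK ?P_neq0 //.
- move=> r /(congr1 val) /= r0; exists 1 => //; rewrite mul1r.
  by apply: phi_inj; rewrite rmorph0.
Qed.

End LocalizationOfDomain.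

Theorem frobenius_gorenstein (k : fieldType) (A P : comNzRingType) (K : fieldType)
    (f : {rmorphism k -> A}) (psi : {rmorphism P -> A}) (phi : {rmorphism A -> K}) n :
  injective phi -> noetherian A -> ext_bound (P^o : lmodType P) n ->
  frobenius psi -> gorenstein A.
Proof.
move=> phi_inj A_noeth bP A_frob; split=> // p p_prime.
have [B [g gl]] := domain_localization phi_inj p_prime.
exists B, g; split=> //; exists n.
apply: (gorenstein_local (g \o f) A_noeth p_prime gl) => m D i De ni.
exact: (frobenius_acyclic A_frob bP De ni).
Qed.

(** * Bases indexed by the cells of a shelling *)

Lemma mmap1D n (S : comNzRingType) (h : 'I_n -> S) m1 m2 :
  mmap1 h (m1 + m2) = mmap1 h m1 * mmap1 h m2.
Proof. by apply: commr_mmap1_M => i y; apply: mulrC. Qed.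

Lemma mmap1Mn n (S : comNzRingType) (h : 'I_n -> S) m e :
  mmap1 h (m *+ e) = mmap1 h m ^+ e.
Proof.
elim: e => [|e IHe]; first by rewrite mulm0n mmap11 expr0.
by rewrite mulmS mmap1D IHe exprS.
Qed.

Lemma div_mod_inj d p q y z : (p < d)%N -> (q < d)%N ->
  (p + d * y = q + d * z)%N -> p = q /\ y = z.
Proof.
move=> pd qd e; have yz : y = z.
  have d0 : (0 < d)%N by apply: leq_ltn_trans pd.
  have := congr1 (divn^~ d) e; rewrite ![(_ + d * _)%N]addnC ![(d * _)%N]mulnC.
  by rewrite !divnMDl // (divn_small pd) (divn_small qd) !addn0.
by move: e; rewrite yz => /addIn.
Qed.

Section Weight.

Variables (n : nat) (om : 'I_n -> nat).

Definition weight (m : 'X_{1..n}) : nat := \sum_v m v * om v.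

Lemma wtD m1 m2 : weight (m1 + m2) = (weight m1 + weight m2)%N.
Proof. by rewrite -big_split; apply: eq_bigr => v _; rewrite mnmDE mulnDl. Qed.

Lemma wtU v : weight U_(v) = om v.
Proof.
rewrite /weight (bigD1 v) //= mnm1E eqxx mul1n big1 ?addn0 // => u uv.
by rewrite mnm1E eq_sym (negbTE uv).
Qed.

Lemma wtMn m e : weight (m *+ e) = (weight m * e)%N.
Proof. by rewrite big_distrl; apply: eq_bigr => v _; rewrite mulmnE mulnAC. Qed.

End Weight.

(** Two families over the same finite index set span each other. Freeness of [Y] gives M N = 1, and
    for square matrices then N M = 1, which carries freeness over to [X]. *)
Lemma free_of_square (k : fieldType) (A : lmodType k) (T : finType) (X Y : T -> A)
    (M N : T -> T -> k) :
  (forall i, Y i = \sum_j M i j *: X j) -> (forall i, X i = \sum_j N i j *: Y j) ->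
  (forall a : T -> k, \sum_i a i *: Y i = 0 -> forall i, a i = 0) ->
  forall a : T -> k, \sum_i a i *: X i = 0 -> forall i, a i = 0.
Proof.
move=> YX XY Y_free a aX.
have comb (f : T -> k) (L : T -> T -> k) (Z : T -> A) :
    \sum_i f i *: (\sum_j L i j *: Z j) = \sum_j (\sum_i f i * L i j) *: Z j.
  transitivity (\sum_i \sum_j (f i * L i j) *: Z j).
    by apply: eq_bigr => i _; rewrite scaler_sumr; apply: eq_bigr => j _; rewrite scalerA.
  by rewrite exchange_big; apply: eq_bigr => j _; rewrite -scaler_suml.
have MN i j : \sum_l M i l * N l j = (i == j)%:R.
  apply/eqP; rewrite -subr_eq0; apply/eqP.
  apply: (Y_free (fun j => \sum_l M i l * N l j - (i == j)%:R)).
  under eq_bigr do rewrite scalerBl; rewrite sumrB -comb.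
  under eq_bigr do rewrite -XY; rewrite -YX [X in _ - X](bigD1 i) //= eqxx scale1r.
  by rewrite big1 ?addr0 ?subrr // => l /negbTE; rewrite eq_sym => ->; rewrite scale0r.
pose mx (L : T -> T -> k) : 'M_#|T| := \matrix_(i, j) L (enum_val i) (enum_val j).
have : mx M *m mx N = 1%:M.
  apply/matrixP => i j; rewrite !mxE -(inj_eq enum_val_inj) -MN.
  by rewrite [RHS](reindex _ (onW_bij _ (enum_val_bij T))); apply: eq_bigr => l _; rewrite !mxE.
move=> /mulmx1C/matrixP NM.
have aN j : \sum_i a i * N i j = 0.
  apply: (Y_free (fun j => \sum_i a i * N i j)); rewrite -comb -[RHS]aX.
  by apply: eq_bigr => i _; rewrite -XY.
move=> i; transitivity (\sum_j (\sum_l a l * N l j) * M j i); last first.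
  by rewrite big1 // => j _; rewrite aN mul0r.
transitivity (\sum_l a l * (l == i)%:R).
  rewrite (bigD1 i) //= eqxx mulr1 big1 ?addr0 // => l /negbTE ->.
  by rewrite mulr0.
under [RHS]eq_bigr do rewrite mulr_suml; rewrite exchange_big; apply: eq_bigr => l _.
have := NM (enum_rank l) (enum_rank i); rewrite !mxE (inj_eq enum_rank_inj) => <-.
rewrite mulr_sumr [RHS](reindex _ (onW_bij _ (enum_val_bij T))).
by apply: eq_bigr => j _; rewrite !mxE !enum_rankK mulrA.
Qed.

Section CellBasis.

Variables (k : fieldType) (A : comAlgType k) (n D M : nat).
Variables (x : 'I_n -> A) (t : 'I_n -> k) (om d : 'I_n -> nat) (C : nat).
(* [sg i] is the [i]-th cell and [r i] its restriction set. *)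
Variables r sg : 'I_M -> {set 'I_n}.

Local Notation P := {mpoly k[D]}.
Local Notation wt := (weight om).
Local Notation mon := (mmap1 x).

Hypothesis t_inj : injective t.
Hypothesis C_gt0 : (0 < C)%N.
Hypothesis dC : forall v, (d v * om v = C)%N.

(** The support of [c] lies in the interval from [r i] to [sg i]. In a shelling these intervals
    partition the faces, so a word has at most one cell; see [in_cell_inj]. *)
Definition in_cell (i : 'I_M) (c : 'X_{1..n}) : bool :=
  [forall v, ((v \in r i) ==> (0 < c v)%N) && ((0 < c v)%N ==> (v \in sg i))].

Hypothesis cell_or_rewrite : forall c, (exists i, in_cell i c) \/
  exists c', (wt c' < wt c)%N /\ mon c' = mon c.
Hypothesis cell_order : forall i j (c : 'X_{1..n}),
  (forall v, v \in r i -> (0 < c v)%N) -> in_cell j c -> (i <= j)%N.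
Hypothesis r_sg : forall i, r i \subset sg i.
Hypothesis sg_card : forall i, #|sg i| = D.

(** By [dC] all powers [x v ^+ d v] have weight [C], so trading one for another preserves the
    weight; the induction of [mon_spanned] depends on this. *)
Definition theta (l : 'I_D) : A := \sum_v t v ^+ l *: x v ^+ d v.
Definition theta_map : P -> A := mmap (in_alg A) theta.
Local Notation psi := theta_map.
HB.instance Definition _ := GRing.RMorphism.copy psi (mmap (in_alg A) theta).

Let d_gt0 v : (0 < d v)%N.
Proof. by case: (posnP (d v)) C_gt0 => // d0; rewrite -(dC v) d0. Qed.

(** One copy of each vertex of the restriction set is mandatory; beyond it exponents count modulo
    [d], as the powers [x v ^+ d v] are absorbed by [theta]. *)
Definition reduced (i : 'I_M) (c : 'X_{1..n}) : bool :=
  in_cell i c && [forall v, c v < (v \in r i) + d v]%N.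

Definition basis_bound : nat := (\sum_v (d v).+1)%N.+1.

Definition cell_basis : finType :=
  {b : 'X_{1..n < basis_bound} | [exists i, reduced i b]}.
Local Notation B := cell_basis.
Definition bw (b : B) : 'X_{1..n} := val b.

Lemma in_cellP i (c : 'X_{1..n}) : reflect
  ((forall v, v \in r i -> (0 < c v)%N) /\ (forall v, (0 < c v)%N -> v \in sg i))
  (in_cell i c).
Proof.
apply: (iffP forallP) => [h | [h1 h2] v].
  by split=> v cv; have /andP[/implyP h1 /implyP h2] := h v; [apply: h1 | apply: h2].
by apply/andP; split; apply/implyP; [apply: h1 | apply: h2].
Qed.

Lemma in_cell_inj i j (c : 'X_{1..n}) : in_cell i c -> in_cell j c -> i = j.
Proof.
move=> /[dup] ci /in_cellP[ri _] /[dup] cj /in_cellP[rj _].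
by apply: val_inj; apply/eqP; rewrite eqn_leq (cell_order ri cj) (cell_order rj ci).
Qed.

Lemma reduced_basis i (c : 'X_{1..n}) : reduced i c -> exists b : B, bw b = c.
Proof.
move=> red; have /andP[_ /forallP cd] := red.
have cK : (mdeg c < basis_bound)%N.
  rewrite ltnS mdegE; apply: leq_sum => v _.
  by have := cd v; case: (v \in r i) => /=; lia.
have ex : [exists i, reduced i (BMultinom cK)] by apply/existsP; exists i.
by exists (Sub (BMultinom cK) ex).
Qed.

Lemma basis_reduced (b : B) : exists i, reduced i (bw b).
Proof. by have /existsP := valP b. Qed.

(** Step [W] of the weight filtration, each parameter counting for [C]. The bound on the
    coefficients is what later controls the degree of the pairing determinant. *)
Definition spanned (W : nat) (a : A) : Prop :=
  exists p : B -> P, a = \sum_b psi (p b) * mon (bw b) /\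
    forall b m, m \in msupp (p b) -> (C * mdeg m + wt (bw b) <= W)%N.

Lemma spanned_mono W W' a : (W <= W')%N -> spanned W a -> spanned W' a.
Proof.
by move=> WW [p [-> pW]]; exists p; split=> // b m /pW /leq_trans; apply.
Qed.

Lemma spannedD W a b : spanned W a -> spanned W b -> spanned W (a + b).
Proof.
move=> [p [-> pW]] [q [-> qW]]; exists (fun b => p b + q b); split.
  by rewrite -big_split; apply: eq_bigr => c _; rewrite rmorphD mulrDl.
by move=> c m /msuppD_le; rewrite mem_cat => /orP[/pW|/qW].
Qed.

Lemma spanned0 W : spanned W 0.
Proof.
exists (fun=> 0); split; first by rewrite big1 // => b _; rewrite rmorph0 mul0r.
by move=> b m; rewrite msupp0.
Qed.

Lemma psiC c : psi c%:MP = c%:A.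
Proof. exact: mmapC. Qed.

Lemma psiX l : psi 'X_l = theta l.
Proof. by rewrite /psi mmapX mmap1U. Qed.

Lemma spannedZ W c a : spanned W a -> spanned W (c *: a).
Proof.
move=> [p [-> pW]]; exists (fun b => c *: p b); split.
  rewrite scaler_sumr; apply: eq_bigr => b _.
  by rewrite -mul_mpolyC rmorphM /= psiC mulr_algl scalerAl.
by move=> b m /msuppZ_le /pW.
Qed.

Lemma spanned_theta W l a : spanned W a -> spanned (W + C) (theta l * a).
Proof.
move=> [p [-> pW]]; exists (fun b => p b * 'X_l); split.
  rewrite mulr_sumr; apply: eq_bigr => b _.
  by rewrite rmorphM /= psiX mulrA [theta l * _]mulrC.
move=> b m; rewrite (perm_mem (msuppMX _ _)) => /mapP[m' /pW m'W ->].
by rewrite mdegD mdeg1; lia.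
Qed.

Lemma spanned_sum (I : Type) (s : seq I) W (F : I -> A) :
  (forall i, spanned W (F i)) -> spanned W (\sum_(i <- s) F i).
Proof.
move=> FW; elim: s => [|i s IHs]; first by rewrite big_nil; apply: spanned0.
by rewrite big_cons; apply: spannedD.
Qed.

(* Lagrange interpolation on the nodes of a cell gives a combination of the
   [theta]'s in which [x v ^+ d v] is the only term supported on the cell. *)
Lemma theta_lagrange (i : 'I_M) v : v \in sg i -> exists (f : 'I_D -> k) (g : 'I_n -> k),
  x v ^+ d v = \sum_l f l *: theta l + \sum_(u | u \notin sg i) g u *: x u ^+ d u.
Proof.
move=> vi; pose q := \prod_(u in sg i :\ v) ('X - (t u)%:P).
have qu u : u \in sg i -> u != v -> q.[t u] = 0.
  move=> ui uv; rewrite horner_prod (bigD1 u) ?inE ?uv //=.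
  by rewrite !hornerE subrr mul0r.
have qv : q.[t v] != 0.
  rewrite horner_prod prodf_seq_neq0; apply/allP => u _; apply/implyP.
  by rewrite !inE => /andP[uv _]; rewrite !hornerE subr_eq0 (inj_eq t_inj) eq_sym.
have q_size : size q = D.
  by rewrite /q -big_enum size_prod_XsubC -(sg_card i) (cardsD1 v) vi -cardE.
pose c u := q.[t u] / q.[t v].
exists (fun l => q`_l / q.[t v]), (fun u => - c u).
have -> : \sum_(l < D) (q`_l / q.[t v]) *: theta l = \sum_u c u *: x u ^+ d u.
  transitivity (\sum_(l < D) \sum_u (q`_l / q.[t v] * t u ^+ l) *: x u ^+ d u).
    apply: eq_bigr => l _; rewrite scaler_sumr; apply: eq_bigr => u _.
    by rewrite scalerA.
  rewrite exchange_big; apply: eq_bigr => u _; rewrite -scaler_suml; congr (_ *: _).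
  rewrite /c (horner_coef q (t u)) q_size mulr_suml; apply: eq_bigr => l _.
  by rewrite mulrAC.
rewrite (bigID (mem (sg i))) /= (bigD1 v) //= {1}/c divff // scale1r.
rewrite big1 => [|u /andP[ui uv]]; last by rewrite /c qu // mul0r scale0r.
rewrite addr0 -addrA -big_split big1 ?addr0 //= => u _.
by rewrite scaleNr subrr.
Qed.

(** Induction on the weight, and for equal weight on the number of later cells. A word that is not
    reduced contains some [x v ^+ d v]. Lagrange interpolation trades it for parameters, whose
    cofactor is lighter, and for powers of vertices off the cell, which move the word to a strictly
    later cell or make it rewritable to a lighter one. *)
Lemma mon_spanned c : spanned (wt c) (mon c).
Proof.
have [W] := ubnP (wt c); elim: W c => // W IHW c; rewrite ltnS => cW.
have red_case c1 : (wt c1 <= wt c)%N -> (forall i, in_cell i c1 -> spanned (wt c) (mon c1)) ->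
    spanned (wt c) (mon c1).
  move=> c1c cells; case: (cell_or_rewrite c1) => [[i ci]|[c' [lt_c' <-]]].
    exact: cells ci.
  apply: spanned_mono (IHW c' _); first exact: leq_trans (ltnW lt_c') c1c.
  by apply: leq_trans lt_c' _; apply: leq_trans c1c _.
suff main N (i : 'I_M) (c1 : 'X_{1..n}) : (M - i < N)%N -> wt c1 = wt c -> in_cell i c1 ->
    spanned (wt c) (mon c1).
  by apply: red_case => // i; apply: (main (M - i).+1).
elim: N i c1 => // N IHN i c1; rewrite ltnS => iN wc1 ci.
have /in_cellP[ri si] := ci.
have [/forallP c1d|] := boolP [forall v, c1 v < (v \in r i) + d v]%N.
  have [|b bE] := @reduced_basis i c1; first by rewrite /reduced ci; apply/forallP.
  exists (fun b' => (b' == b)%:R); split.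
    rewrite (bigD1 b) //= eqxx rmorph1 mul1r bE big1 ?addr0 // => b' /negbTE ->.
    by rewrite rmorph0 mul0r.
  move=> b' m; case: eqP => [->|_]; last by rewrite msupp0.
  by rewrite msupp1 inE => /eqP ->; rewrite mdeg0 muln0 bE wc1.
rewrite negb_forall => /existsP[v]; rewrite -leqNgt => vd.
have v_sg : v \in sg i.
  by apply: si; apply: leq_trans vd; rewrite addn_gt0 d_gt0 orbT.
pose c2 := [multinom (c1 u - (u == v) * d v)%N | u < n].
have c1E : c1 = (c2 + U_(v) *+ d v)%MM.
  apply/mnmP => u; rewrite mnmDE mulmnE mnmE mnm1E eq_sym.
  case: (eqVneq u v) => [->|_]; last by rewrite !mul0n addn0 subn0.
  by rewrite !mul1n subnK //; apply: leq_trans vd; apply: leq_addl.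
(* The exponent of [v] exceeds the mandatory copy by at least [d v], so the restriction set survives
   the removal and [cell_order] excludes earlier cells. *)
have c2r u : u \in r i -> (0 < c2 u)%N.
  move=> ur; rewrite mnmE; case: (eqVneq u v) => [uv|_].
    by rewrite uv mul1n subn_gt0; move: vd; rewrite -uv ur; lia.
  by rewrite mul0n subn0 ri.
have wc2 : (wt c2 + C = wt c)%N by rewrite -wc1 c1E wtD wtMn wtU mulnC dC.
have [f [g fgE]] := theta_lagrange v_sg.
have -> : mon c1 = \sum_l f l *: (theta l * mon c2)
    + \sum_(u | u \notin sg i) g u *: mon (c2 + U_(u) *+ d u).
  rewrite c1E mmap1D mulrC mmap1Mn mmap1U fgE mulrDl !mulr_suml; congr (_ + _).
    by apply: eq_bigr => l _; rewrite scalerAl.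
  by apply: eq_bigr => u _; rewrite -scalerAl mmap1D mmap1Mn mmap1U mulrC.
apply: spannedD.
  apply: spanned_sum => l; apply: spannedZ; rewrite -wc2; apply: spanned_theta.
  by apply: IHW; lia.
rewrite big_mkcond; apply: spanned_sum => u.
case: ifPn => [u_sg|_]; last exact: spanned0.
apply: spannedZ; set c3 := (c2 + _)%MM.
have wc3 : wt c3 = wt c by rewrite wtD wtMn wtU mulnC dC.
apply: red_case; first by rewrite wc3.
move=> j cj; apply: (IHN j) => //.
have c3r w : w \in r i -> (0 < c3 w)%N.
  by move=> /c2r; rewrite mnmDE; lia.
have le_ij := cell_order c3r cj.
have ne_ij : (i : nat) <> j.
  move=> /val_inj ij; case/negP: u_sg; rewrite ij.
  have /in_cellP[_] := cj; apply.
  by rewrite mnmDE mulmnE mnm1E eqxx; have := d_gt0 u; lia.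
by have := ltn_ord j; lia.
Qed.

Hypothesis std_free : forall (J : finType) (c : J -> 'X_{1..n}) (a : J -> k),
  injective c -> (forall j, exists i, in_cell i (c j)) ->
  \sum_j a j *: mon (c j) = 0 -> forall j, a j = 0.

Definition cell_of (b : B) : 'I_M := sval (cid (basis_reduced b)).

Lemma cell_ofP b : reduced (cell_of b) (bw b).
Proof. by rewrite /cell_of; case: cid. Qed.

Definition node (i : 'I_M) (l : 'I_D) : 'I_n := enum_val (cast_ord (esym (sg_card i)) l).

Lemma node_in i l : node i l \in sg i. Proof. exact: enum_valP. Qed.

Lemma node_inj i : injective (node i).
Proof. by move=> l l' /enum_val_inj /cast_ord_inj. Qed.

Lemma node_surj i u : u \in sg i -> exists l, node i l = u.
Proof.
move=> ui; exists (cast_ord (sg_card i) (enum_rank_in ui u)).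
by rewrite /node cast_ordK enum_rankK_in.
Qed.

Definition lift_word (i : 'I_M) (al : 'X_{1..D}) (u : 'I_n) : nat :=
  \sum_l (node i l == u) * al l.

Lemma lift_word_node i al l : lift_word i al (node i l) = al l.
Proof.
rewrite /lift_word (bigD1 l) //= eqxx mul1n big1 ?addn0 // => l' l'l.
by rewrite (inj_eq (@node_inj i)) (negbTE l'l).
Qed.

Lemma lift_word_out i al u : u \notin sg i -> lift_word i al u = 0%N.
Proof.
move=> ui; rewrite /lift_word big1 // => l _; case: eqP => // lu.
by case/negP: ui; rewrite -lu node_in.
Qed.

(** Replacing the parameter number [l] by the power of the [l]-th vertex of the cell matches the
    pairs [(b, al)] bijectively with the standard words, by division with remainder by [d], and
    preserves the weight. *)
Definition full_word (b : B) (al : 'X_{1..D}) : 'X_{1..n} :=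
  [multinom bw b u + d u * lift_word (cell_of b) al u | u < n].

Lemma full_word_cell b al : in_cell (cell_of b) (full_word b al).
Proof.
have /andP[/in_cellP[rb sb] _] := cell_ofP b.
apply/in_cellP; split=> v; rewrite mnmE; first by move=> /rb; lia.
rewrite addn_gt0 => /orP[/sb //|].
by apply: contraLR => /lift_word_out ->; rewrite muln0.
Qed.

Lemma wt_full_word b al : wt (full_word b al) = (wt (bw b) + C * mdeg al)%N.
Proof.
rewrite /weight; under eq_bigr do rewrite mnmE mulnDl.
rewrite big_split /=; congr (_ + _)%N.
transitivity (\sum_u \sum_l (node (cell_of b) l == u) * (al l * C))%N.
  apply: eq_bigr => u _; rewrite -mulnA mulnC -mulnA [(_ * d u)%N]mulnC dC big_distrl /=.
  by apply: eq_bigr => l _; rewrite mulnA.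
rewrite exchange_big mdegE big_distrr; apply: eq_bigr => l _.
rewrite (bigD1 (node (cell_of b) l)) //= eqxx mul1n big1 ?addn0 1?mulnC // => u.
by rewrite eq_sym => /negbTE ->.
Qed.

Lemma full_word_inj b al b' al' :
  full_word b al = full_word b' al' -> b = b' /\ al = al'.
Proof.
move=> e; have ii : cell_of b = cell_of b'.
  by apply: in_cell_inj (full_word_cell b al) _; rewrite e full_word_cell.
have /andP[/in_cellP[rb sb] /forallP bd] := cell_ofP b.
have /andP[/in_cellP[rb' sb'] /forallP bd'] := cell_ofP b'.
have eu u : bw b u = bw b' u /\ lift_word (cell_of b) al u = lift_word (cell_of b) al' u.
  have := congr1 (fun m : 'X_{1..n} => m u) e; rewrite !mnmE -ii.
  have := bd u; have := bd' u; rewrite -ii.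
  have := rb u; have := rb' u; rewrite -ii; case: (u \in r _) => /=.
    move=> /(_ isT) b1 /(_ isT) b2 bd1 bd2 euu.
    have [|||e1 e2] := @div_mod_inj (d u) (bw b u).-1 (bw b' u).-1
      (lift_word (cell_of b) al u) (lift_word (cell_of b) al' u); try lia.
  move=> _ _ bd1 bd2 euu; exact: div_mod_inj euu.
split; first by apply/val_inj/val_inj/mnmP => u; case: (eu u).
apply/mnmP => l; rewrite -(lift_word_node (cell_of b)) -(lift_word_node (cell_of b) al').
by case: (eu (node (cell_of b) l)).
Qed.

Lemma full_word_surj i c : in_cell i c -> exists b al, c = full_word b al.
Proof.
move=> ci; have /in_cellP[rc sc] := ci.
pose e u := (u \in r i : nat).
pose b0 := [multinom e u + (c u - e u) %% d u | u < n].
have red : reduced i b0.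
  apply/andP; split; last first.
    by apply/forallP => u; rewrite mnmE ltn_add2l ltn_mod d_gt0.
  apply/in_cellP; split=> u; rewrite mnmE /e; first by move=> ->.
  case: (boolP (u \in r i)) => [/(subsetP (r_sg i)) //|_] /=.
  rewrite add0n subn0 => cu; apply: sc; case: (c u) cu => //.
  by rewrite mod0n.
have [b bE] := reduced_basis red.
have ib : cell_of b = i.
  have /andP[cb _] := cell_ofP b; have /andP[cb0 _] := red.
  by apply: in_cell_inj cb _; rewrite bE.
exists b, [multinom ((c (node i l) - e (node i l)) %/ d (node i l))%N | l < D].
apply/mnmP => u; rewrite mnmE bE ib mnmE.
have [/node_surj[l <-]|ui] := boolP (u \in sg i).
  rewrite lift_word_node mnmE mulnC -addnA [(_ %% _ + _)%N]addnC -divn_eq subnKC //.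
  rewrite /e; case: (boolP (_ \in r i)) => // /rc //.
have cu : c u = 0%N by apply/eqP; rewrite -leqn0 leqNgt; apply: contraNN ui => /sc.
rewrite lift_word_out // muln0 addn0 cu mod0n addn0 /e.
by case: (boolP (_ \in _)) => // /rc; rewrite cu.
Qed.

Section Filtered.

Variable W : nat.

(** In weight at most [W] the products [X] and the standard words [Y] share this finite index set
    and span each other; freeness passes from [Y] to [X] by [free_of_square]. *)
Definition index_pred (ba : B * 'X_{1..D < W.+1}) : bool :=
  (C * mdeg ba.2 + wt (bw ba.1) <= W)%N.
Definition index_type : finType := {ba | index_pred ba}.
Local Notation T := index_type.

Let X (i : T) : A := psi 'X_[(val i).2] * mon (bw (val i).1).
Let Y (i : T) : A := mon (full_word (val i).1 (val i).2).

Lemma index_exists b (al : 'X_{1..D}) : (C * mdeg al + wt (bw b) <= W)%N ->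
  exists i : T, (val i).1 = b /\ (val i).2 = al :> 'X_{1..D}.
Proof.
move=> le_W; have alW : (mdeg al < W.+1)%N.
  by rewrite ltnS; apply: leq_trans le_W; apply: leq_trans (leq_addr _ _); apply: leq_pmull.
have ip : index_pred (b, BMultinom alW) by [].
by exists (Sub (b, BMultinom alW) ip).
Qed.

Lemma index_expand (p : B -> P) :
  (forall b m, m \in msupp (p b) -> (C * mdeg m + wt (bw b) <= W)%N) ->
  \sum_b psi (p b) * mon (bw b) = \sum_(i : T) (p (val i).1)@_((val i).2) *: X i.
Proof.
move=> pW.
transitivity (\sum_(ba : B * 'X_{1..D < W.+1})
    (p ba.1)@_ba.2 *: (psi 'X_[ba.2] * mon (bw ba.1))).
  rewrite -(pair_bigA _ (fun (b : B) (al : 'X_{1..D < W.+1}) =>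
    (p b)@_al *: (psi 'X_[al] * mon (bw b)))).
  apply: eq_bigr => b _; rewrite {1}(@mpolywE _ _ W.+1 (p b)); last first.
    apply/bigmax_leqP_seq => m mp _; rewrite ltnS; apply: leq_trans (pW b m mp).
    by apply: leq_trans (leq_addr _ _); apply: leq_pmull.
  rewrite rmorph_sum mulr_suml; apply: eq_bigr => al _.
  by rewrite -mul_mpolyC rmorphM /= psiC mulr_algl scalerAl.
rewrite (bigID index_pred) /= [X in _ + X]big1 ?addr0; last first.
  move=> [b al] /=; rewrite /index_pred /= => nW.
  case: (boolP (val al \in msupp (p b))) => [/pW|/memN_msupp_eq0 ->]; last by rewrite scale0r.
  by move=> h; rewrite h in nW.
exact: (big_sub index_pred
  (fun ba => (p ba.1)@_(ba.2) *: (psi 'X_[ba.2] * mon (bw ba.1)))).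
Qed.

Lemma spanned_index a : spanned W a -> exists f : T -> k, a = \sum_i f i *: X i.
Proof.
by move=> [p [-> pW]]; eexists; apply: index_expand.
Qed.

Let comb (a : A) := exists f : T -> k, a = \sum_i f i *: Y i.

Let combD a b : comb a -> comb b -> comb (a + b).
Proof.
move=> [f ->] [g ->]; exists (fun i => f i + g i).
by rewrite -big_split; apply: eq_bigr => i _; rewrite scalerDl.
Qed.

Let combZ c a : comb a -> comb (c *: a).
Proof.
move=> [f ->]; exists (fun i => c * f i).
by rewrite scaler_sumr; apply: eq_bigr => i _; rewrite scalerA.
Qed.

Let comb0 : comb 0.
Proof. by exists (fun=> 0); rewrite big1 // => i _; rewrite scale0r. Qed.

Let comb_sum (I : Type) (s : seq I) (F : I -> A) :
  (forall i, comb (F i)) -> comb (\sum_(i <- s) F i).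
Proof.
move=> FW; elim: s => [|i s IHs]; first by rewrite big_nil.
by rewrite big_cons; apply: combD.
Qed.

Let comb_mon c : (wt c <= W)%N -> comb (mon c).
Proof.
have [N] := ubnP (wt c); elim: N c => // N IHN c cN cW.
case: (cell_or_rewrite c) => [[i ci]|[c' [lt_c' <-]]]; last by apply: IHN; lia.
have [b [al cE]] := full_word_surj ci.
have [|j [jb jal]] := @index_exists b al; first by rewrite addnC -wt_full_word -cE.
exists (fun i => (i == j)%:R); rewrite (bigD1 j) //= eqxx scale1r big1 => [|l /negbTE ->].
  by rewrite addr0 /Y jb jal cE.
by rewrite scale0r.
Qed.

Let comb_theta (al : 'X_{1..D}) c :
  (C * mdeg al + wt c <= W)%N -> comb (psi 'X_[al] * mon c).
Proof.
have [N] := ubnP (mdeg al); elim: N al c => // N IHN al c alN alW.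
have [/eqP|] := posnP (mdeg al).
  by rewrite mdeg_eq0 => /eqP al0; rewrite al0 mpolyX0 rmorph1 mul1r; apply: comb_mon; lia.
rewrite lt0n mdegE sum_nat_eq0 negb_forall => /existsP[l]; rewrite implyTb => l0.
have alE : al = (al - U_(l) + U_(l))%MM by rewrite submK // lep1mP.
have mE : (mdeg al = (mdeg (al - U_(l))).+1)%N by rewrite {1}alE mdegD mdeg1 addn1.
have thE : theta l * mon c = \sum_v (t v ^+ l *: x v ^+ d v) * mon c by rewrite mulr_suml.
rewrite alE mpolyXD rmorphM /= psiX -mulrA thE mulr_sumr.
apply: comb_sum => v; rewrite -scalerAl -scalerAr; apply: combZ.
have -> : x v ^+ d v = mon (U_(v) *+ d v)%MM by rewrite mmap1Mn mmap1U.
rewrite -mmap1D; apply: IHN; first by lia.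
by rewrite wtD wtMn wtU [(om v * _)%N]mulnC dC; move: alW; rewrite mE mulnS; lia.
Qed.

Lemma index_free (a : T -> k) : \sum_i a i *: X i = 0 -> forall i, a i = 0.
Proof.
have YX (i : T) : exists f : T -> k, Y i = \sum_j f j *: X j.
  apply: spanned_index; apply: spanned_mono (mon_spanned _).
  by rewrite wt_full_word addnC; apply: (valP i).
have XY (i : T) : comb (X i) by apply: comb_theta; apply: (valP i).
apply: (free_of_square (Y := Y) (M := fun i => sval (cid (YX i)))
  (N := fun i => sval (cid (XY i)))).
- by move=> i; case: cid.
- by move=> i; case: cid.
move=> f; apply: std_free => [i j|i].
  case: i => -[b al] ip; case: j => -[b' al'] jp /= /full_word_inj[e1 e2].
  by apply: val_inj => /=; rewrite e1; congr pair; apply: val_inj.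
by exists (cell_of (val i).1); apply: full_word_cell.
Qed.

End Filtered.

Lemma basis_free (p : B -> P) :
  \sum_b psi (p b) * mon (bw b) = 0 -> forall b, p b = 0.
Proof.
pose W := (\sum_b (C * msize (p b) + wt (bw b)))%N.
have pW b m : m \in msupp (p b) -> (C * mdeg m + wt (bw b) <= W)%N.
  move=> /msize_mdeg_lt mp; rewrite /W (bigD1 b) //=.
  by apply: leq_trans (leq_addr _ _); rewrite leq_add2r leq_mul2l (ltnW mp) orbT.
move=> p0 b; apply/mpolyP => m; rewrite mcoeff0.
case: (boolP (m \in msupp (p b))) => [mp|/memN_msupp_eq0 //].
have [i [ib im]] := index_exists (pW b m mp).
rewrite -ib -im; apply: (@index_free W (fun i => (p (val i).1)@_((val i).2))).
by rewrite -index_expand.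
Qed.

Let wsum (X : {set 'I_n}) : nat := \sum_(v in X) om v.

Let om_gt0 v : (0 < om v)%N.
Proof. by case: (posnP (om v)) C_gt0 => // d0; rewrite -(dC v) d0 muln0. Qed.

Let wt_cell i (c : 'X_{1..n}) (e : 'I_n -> nat) :
  (forall v, c v = if v \in sg i then (v \in r i) + e v else 0)%N ->
  wt c = (wsum (r i) + \sum_(v in sg i) e v * om v)%N.
Proof.
move=> cE; transitivity (\sum_(v in sg i) ((v \in r i) + e v) * om v)%N.
  rewrite /weight [RHS]big_mkcond; apply: eq_bigr => v _.
  by rewrite cE; case: ifP.
under eq_bigr do rewrite mulnDl.
rewrite big_split /=; congr (_ + _)%N; rewrite /wsum [RHS]big_mkcond [LHS]big_mkcond.
apply: eq_bigr => v _; case: (boolP (v \in r i)) => [vr|_]; last by case: ifP.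
by rewrite (fintype.subsetP (r_sg i) _ vr) mul1n.
Qed.

Let reduced_fill i (e : 'I_n -> nat) : (forall v, v \in sg i -> e v < d v)%N ->
  reduced i [multinom if v \in sg i then (v \in r i) + e v else 0 | v < n]%N.
Proof.
move=> ed; apply/andP; split.
  apply/in_cellP; split=> v; rewrite mnmE; last by case: ifP.
  by move=> vr; rewrite (fintype.subsetP (r_sg i) _ vr) vr.
by apply/forallP => v; rewrite mnmE; case: ifP => [/ed|_]; have := d_gt0 v; lia.
Qed.

Let excess (b : B) (v : 'I_n) : nat := (bw b v - (v \in r (cell_of b)))%N.

Let bw_excess b v :
  bw b v = if v \in sg (cell_of b) then ((v \in r (cell_of b)) + excess b v)%N else 0%N.
Proof.
have /andP[/in_cellP[rb sb] _] := cell_ofP b.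
case: ifPn => [_|vs]; last first.
  by apply/eqP; rewrite -leqn0 leqNgt; apply: contra vs; apply: sb.
by rewrite /excess; case: (boolP (v \in r _)) => [/rb|_]; lia.
Qed.

Let excess_lt b v : v \in sg (cell_of b) -> (excess b v < d v)%N.
Proof.
move=> vs; have /andP[_ /forallP/(_ v)] := cell_ofP b.
by rewrite bw_excess vs; lia.
Qed.

(** Complementing the excess to [d v - 1] is an involution inside each cell. Averaging over [b] and
    its mirror leaves a weight that depends only on the cell. *)
Let mirror_exists b : exists b', cell_of b' = cell_of b /\
  forall v, v \in sg (cell_of b) -> (excess b v + excess b' v + 1 = d v)%N.
Proof.
pose e v := ((d v).-1 - excess b v)%N.
have red : reduced (cell_of b) [multinom if v \in sg (cell_of b) then
    (v \in r (cell_of b)) + e v else 0 | v < n]%N.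
  by apply: reduced_fill => v _; rewrite /e; have := d_gt0 v; lia.
have [b' b'E] := reduced_basis red; exists b'.
have ib : cell_of b' = cell_of b.
  have /andP[cb' _] := cell_ofP b'; have /andP[cb _] := red.
  by apply: in_cell_inj cb' _; rewrite b'E.
split=> // v vs; rewrite {2}/excess b'E mnmE vs ib /e.
by have := excess_lt vs; lia.
Qed.

Let basis_ext b b' : cell_of b = cell_of b' ->
  (forall v, v \in sg (cell_of b) -> excess b v = excess b' v) -> b = b'.
Proof.
move=> ib eb; apply/val_inj/val_inj/mnmP => v.
rewrite -[LHS]/(bw b v) -[RHS]/(bw b' v) !bw_excess -ib.
by case: ifP => // /eb ->; rewrite /excess ib.
Qed.

Let mirror b := sval (cid (mirror_exists b)).

Let mirrorP b : cell_of (mirror b) = cell_of b /\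
  forall v, v \in sg (cell_of b) -> (excess b v + excess (mirror b) v + 1 = d v)%N.
Proof. by rewrite /mirror; case: cid. Qed.

Let mirrorK : involutive mirror.
Proof.
move=> b; have [i1 e1] := mirrorP b; have [i2 e2] := mirrorP (mirror b).
apply: basis_ext => [|v]; first by rewrite i2.
by rewrite i2 i1 => vs; have := e1 v vs; have := e2 v; rewrite i1 => /(_ vs); lia.
Qed.

Let wt_bw b : wt (bw b) = (wsum (r (cell_of b)) + \sum_(v in sg (cell_of b)) excess b v * om v)%N.
Proof. exact: wt_cell (bw_excess b). Qed.

Let sum_d i : (\sum_(v in sg i) d v * om v = D * C)%N.
Proof. by under eq_bigr do rewrite dC; rewrite sum_nat_const sg_card. Qed.

Let wt_mirror b : (wt (bw b) + wt (bw (mirror b)) + wsum (sg (cell_of b)) =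
  2 * wsum (r (cell_of b)) + D * C)%N.
Proof.
have [i1 e1] := mirrorP b; rewrite !wt_bw i1 -(sum_d (cell_of b)).
have -> : (\sum_(v in sg (cell_of b)) d v * om v = \sum_(v in sg (cell_of b)) excess b v * om v
    + \sum_(v in sg (cell_of b)) excess (mirror b) v * om v + wsum (sg (cell_of b)))%N.
  rewrite -!big_split; apply: eq_bigr => v /e1 <-.
  by rewrite !mulnDl mul1n.
by lia.
Qed.

(** The excesses vary independently below [d], which gives a product of the [d v]; the weights turn
    each factor into [C]. *)
Let cell_basis_card i : (#|[set b : B | cell_of b == i]| * \prod_(v in sg i) om v = C ^ D)%N.
Proof.
have -> : #|[set b : B | cell_of b == i]| = (\prod_(v in sg i) d v)%N; last first.
  by rewrite -big_split /=; under eq_bigr do rewrite dC; rewrite prod_nat_const sg_card.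
pose F v := [pred y : 'I_basis_bound | if v \in sg i then (y < d v)%N else (y == 0%N :> nat)].
pose h (b : B) : {ffun 'I_n -> 'I_basis_bound} := [ffun v => inord (excess b v)].
have d_bound v : (d v < basis_bound)%N.
  by rewrite /basis_bound (bigD1 v) //=; lia.
have ex_bound b v : (excess b v < basis_bound)%N.
  have [/excess_lt ed|vs] := boolP (v \in sg (cell_of b)).
    exact: ltn_trans ed (d_bound v).
  by have := bw_excess b v; rewrite (negbTE vs) /excess => ->; rewrite sub0n.
have -> : #|[set b : B | cell_of b == i]| = #|[set f in family F]|.
  rewrite -(card_in_imset (f := h)); last first.
    move=> b b'; rewrite !inE => /eqP ib /eqP ib' /ffunP hb; apply: basis_ext.
      by rewrite ib ib'.
    by move=> v _; have := congr1 (@nat_of_ord _) (hb v); rewrite !ffunE !inordK.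
  apply: eq_card => f; rewrite !inE; apply/imsetP/familyP => [[b]|fF].
    rewrite inE => /eqP ib -> v; rewrite ffunE inE inordK // -ib.
    case: ifPn => [/excess_lt //|vs].
    by have := bw_excess b v; rewrite (negbTE vs) /excess => ->; rewrite sub0n.
  have red : reduced i [multinom if v \in sg i then (v \in r i) + f v else 0 | v < n]%N.
    by apply: reduced_fill => v vs; have := fF v; rewrite inE vs.
  have [b bE] := reduced_basis red.
  have ib : cell_of b = i.
    have /andP[cb' _] := cell_ofP b; have /andP[cb _] := red.
    by apply: in_cell_inj cb' _; rewrite bE.
  exists b; first by rewrite inE ib.
  apply/ffunP => v; apply: ord_inj; rewrite ffunE inordK // /excess bE mnmE ib.
  case: ifPn => [_|vs]; first by lia.
  by have := fF v; rewrite inE (negbTE vs) sub0n => /eqP.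
rewrite cardsE card_family foldrE big_map big_enum /=.
rewrite [RHS]big_mkcond /=; apply: eq_bigr => v _.
case: ifP => vs.
  rewrite -sum1_card (eq_bigl (fun y : 'I_basis_bound => y < d v)%N); last first.
    by [].
  by rewrite -(big_ord_widen _ (fun=> 1%N) (ltnW (d_bound v))) sum1_card card_ord.
transitivity #|pred1 (ord0 : 'I_basis_bound)|; last by rewrite card1.
by apply: eq_card => y; rewrite inE -val_eqE.
Qed.

(** After mirroring, the average weight is a sum over cells in which cell [i] counts in proportion
    to the product of the weights off it; the hypothesis is that balance. The top word has maximal
    excess [d v - 1] everywhere on the cell [top]. *)
Lemma basis_sym_exists (top : 'I_M) :
  (\sum_i (\prod_(v | v \notin sg i) om v) * (2 * wsum (r i) + wsum (sg top)) =
   \sum_i (\prod_(v | v \notin sg i) om v) * (wsum (sg i) + wsum (r top)))%N ->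
  exists btop, ((\sum_b wt (bw b)).*2 = #|B| * wt (bw btop))%N.
Proof.
move=> sym.
have red : reduced top [multinom if v \in sg top then (v \in r top) + (d v).-1 else 0 | v < n]%N.
  by apply: reduced_fill => v _; have := d_gt0 v; lia.
have [btop bE] := reduced_basis red; exists btop.
have wtop : (wt (bw btop) + wsum (sg top) = wsum (r top) + D * C)%N.
  rewrite bE (@wt_cell top _ (fun v => (d v).-1)); last by move=> v; rewrite mnmE.
  rewrite -addnA -big_split -(sum_d top) /=; congr (_ + _)%N; apply: eq_bigr => v _.
  by have := d_gt0 v; case: (d v) => // m _ /=; rewrite mulSn addnC.
have Sum (f : 'I_M -> nat) :
    (\sum_b f (cell_of b) * \prod_v om v = C ^ D * \sum_i (\prod_(v | v \notin sg i) om v) * f i)%N.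
  rewrite (partition_big cell_of xpredT) //= big_distrr /=; apply: eq_bigr => i _.
  transitivity (#|[set b : B | cell_of b == i]| * (f i * \prod_v om v))%N.
    by rewrite -sum_nat_const; apply: eq_big => b; [rewrite inE | move/eqP ->].
  rewrite -(cell_basis_card i) [in LHS](bigID (mem (sg i))) /= -!mulnA; congr (_ * _)%N.
  by rewrite [LHS]mulnC -mulnA.
have om_pos : (0 < \prod_v om v)%N by rewrite prodn_gt0.
have e1 : ((\sum_b (2 * wsum (r (cell_of b)) + wsum (sg top))) * \prod_v om v =
    (\sum_b (wsum (sg (cell_of b)) + wsum (r top))) * \prod_v om v)%N.
  rewrite !big_distrl /= (Sum (fun i => 2 * wsum (r i) + wsum (sg top))%N).
  by rewrite (Sum (fun i => wsum (sg i) + wsum (r top))%N) sym.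
have {}e1 := eqP (etrans (esym (eqn_pmul2r om_pos)) (introT eqP e1)).
have e2 : ((\sum_b wt (bw b)).*2 = \sum_b (wt (bw b) + wt (bw (mirror b))))%N.
  rewrite big_split /= -addnn; congr (_ + _)%N.
  by rewrite [LHS](reindex_inj (inv_inj mirrorK)).
have e3 : (\sum_b (wt (bw b) + wt (bw (mirror b))) + \sum_b wsum (sg (cell_of b)) =
    \sum_b (2 * wsum (r (cell_of b)) + D * C))%N.
  by rewrite -big_split; apply: eq_bigr => b _; apply: wt_mirror.
move: e1 e3; rewrite -e2 !big_split /= !sum_nat_const -!/wsum.
have -> : (#|{: B}| = #|B|) by [].
have := congr1 (muln #|B|) wtop; rewrite !mulnDr; lia.
Qed.

Hypothesis A_gen : forall a, exists p : {mpoly k[n]}, a = mmap (in_alg A) x p.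
Hypothesis A_dom : forall a b : A, a * b = 0 -> a = 0 \/ b = 0.
Variable btop : B.
Hypothesis basis_sym : ((\sum_b wt (bw b)).*2 = #|B| * wt (bw btop))%N.

Lemma basis_gen a : exists p : B -> P, a = \sum_b psi (p b) * mon (bw b).
Proof.
have [p ->] := A_gen a; rewrite /mmap.
elim: (msupp p) => [|m s [q IHs]].
  exists (fun=> 0); rewrite big_nil big1 // => b _; by rewrite rmorph0 mul0r.
have [q' [q'E _]] := mon_spanned m.
exists (fun b => p@_m *: q' b + q b); rewrite big_cons IHs q'E mulr_sumr -big_split.
apply: eq_bigr => b _; rewrite rmorphD /= mulrDl mulrA; congr (_ * _ + _).
by rewrite -mul_mpolyC rmorphM /= psiC.
Qed.

Definition co (b : B) (a : A) : P := sval (cid (basis_gen a)) b.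

Lemma coE a : a = \sum_b psi (co b a) * mon (bw b).
Proof. by rewrite /co; case: cid. Qed.

Lemma co_uniq (p : B -> P) b : co b (\sum_b psi (p b) * mon (bw b)) = p b.
Proof.
apply/eqP; rewrite -subr_eq0; apply/eqP; move: b.
apply: (basis_free (p := fun b => co b (\sum_b psi (p b) * mon (bw b)) - p b)).
under eq_bigr do rewrite rmorphB mulrBl; by rewrite sumrB -coE subrr.
Qed.

Lemma co_lin b p a a' : co b (psi p * a + a') = p * co b a + co b a'.
Proof.
rewrite {1}(coE a) {1}(coE a') mulr_sumr -big_split /=.
rewrite (eq_bigr (fun b => psi (p * co b a + co b a') * mon (bw b))) ?co_uniq //.
by move=> c _; rewrite rmorphD rmorphM /= mulrDl mulrA.
Qed.

Lemma coD b a a' : co b (a + a') = co b a + co b a'.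
Proof. by have := co_lin b 1 a a'; rewrite rmorph1 !mul1r. Qed.

Lemma co0 b : co b 0 = 0.
Proof. by apply: (addrI (co b 0)); rewrite -coD !addr0. Qed.

Lemma co_sum b (I : Type) (s : seq I) (f : I -> P) (y : I -> A) :
  co b (\sum_(i <- s) psi (f i) * y i) = \sum_(i <- s) f i * co b (y i).
Proof.
elim: s => [|i s IHs]; first by rewrite !big_nil co0.
by rewrite !big_cons co_lin IHs.
Qed.

Lemma spanned_co W a b m : spanned W a -> m \in msupp (co b a) ->
  (C * mdeg m + wt (bw b) <= W)%N.
Proof. by move=> [p [-> pW]]; rewrite co_uniq; apply: pW. Qed.

(** A degree bound by [w - u] without truncated subtraction: for [w < u] it forces [p = 0]. *)
Definition deg_between (u w : nat) (p : P) : Prop :=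
  forall m, m \in msupp p -> (C * mdeg m + u <= w)%N.

Lemma deg_betweenM u w u' w' p q :
  deg_between u w p -> deg_between u' w' q -> deg_between (u + u') (w + w') (p * q).
Proof.
move=> pd qd m /msuppM_le /allpairsP[[m1 m2] /= [/pd m1d /qd m2d ->]].
by rewrite mdegD mulnDr; lia.
Qed.

Lemma deg_between_prod (I : Type) (s : seq I) (u w : I -> nat) (F : I -> P) :
  (forall i, deg_between (u i) (w i) (F i)) ->
  deg_between (\sum_(i <- s) u i) (\sum_(i <- s) w i) (\prod_(i <- s) F i).
Proof.
move=> Fd; elim: s => [|i s IHs]; last by rewrite !big_cons; apply: deg_betweenM.
by rewrite !big_nil => m; rewrite msupp1 inE => /eqP ->; rewrite mdeg0 muln0.
Qed.

Lemma deg_between_sum (I : Type) (s : seq I) u w (F : I -> P) :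
  (forall i, deg_between u w (F i)) -> deg_between u w (\sum_(i <- s) F i).
Proof.
move=> Fd; elim: s => [|i s IHs]; first by move=> m; rewrite big_nil msupp0.
by move=> m; rewrite big_cons => /msuppD_le; rewrite mem_cat => /orP[/Fd|/IHs].
Qed.

Local Notation lam := (co btop).
Local Notation bi i := (mon (bw (enum_val i))).

Definition pairing_mx : 'M[P]_#|B| := \matrix_(i, j) lam (bi i * bi j).

Lemma rebase (f : B -> P) :
  \sum_b psi (f b) * mon (bw b) = \sum_(i < #|B|) psi (f (enum_val i)) * bi i.
Proof. by rewrite (reindex _ (onW_bij _ (enum_val_bij B))). Qed.

(** An entry is bounded by the weights of its two basis words minus that of [btop]. In every Leibniz
    term each basis word occurs once as a row and once as a column, so by [basis_sym] the bounds add
    up to 0. *)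
Lemma pairing_det_const : exists c, \det pairing_mx = c%:MP.
Proof.
have bound (b : B) : deg_between (#|B| * wt (bw btop)) (#|B| * wt (bw btop)) (\det pairing_mx).
  rewrite /determinant; apply: deg_between_sum => s.
  rewrite -[X in deg_between X]add0n -[X in deg_between _ X]add0n.
  apply: deg_betweenM.
    move=> m; case: (odd_perm s); rewrite ?expr0 ?expr1.
      by rewrite (perm_mem (msuppN _)) msupp1 inE => /eqP ->; rewrite mdeg0 muln0.
    by rewrite msupp1 inE => /eqP ->; rewrite mdeg0 muln0.
  have e1 : (#|B| * wt (bw btop) = \sum_(i < #|B|) wt (bw btop))%N.
    by rewrite sum_nat_const card_ord.
  have e2 : (#|B| * wt (bw btop) =
      \sum_(i < #|B|) (wt (bw (enum_val i)) + wt (bw (enum_val (s i)))))%N.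
    rewrite -basis_sym big_split /= -addnn; congr (_ + _)%N.
      by rewrite (reindex _ (onW_bij _ (enum_val_bij B))).
    rewrite (reindex _ (onW_bij _ (enum_val_bij B))) /=.
    by rewrite (reindex_inj (@perm_inj _ s)).
  rewrite {1}e1 e2.
  apply: deg_between_prod => i m; rewrite mxE -mmap1D => mi.
  by rewrite -wtD; apply: (spanned_co (mon_spanned _) mi).
have : (msize (\det pairing_mx) <= 1)%N.
  apply/bigmax_leqP_seq => m mB _; have Cm := bound btop m mB.
  have : (C * mdeg m == 0)%N by lia.
  by rewrite muln_eq0 (gtn_eqF C_gt0) /= => /eqP ->.
by move=> /msize1_polyC ->; eexists.
Qed.

(** A null vector yields a nonzero [a] with [lam (a * y) = 0] for all [y]. Multiplication by [a] is
    injective, so its matrix [Ma] has nonzero determinant; a row of the adjugate provides [y] for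
    which [a * y] is that determinant times the top word, and [lam] does not vanish there. *)
Lemma pairing_det_neq0 : \det pairing_mx != 0.
Proof.
apply/det0P => -[v v0 vL].
pose a := \sum_i psi (v 0 i) * bi i.
have comb0 (w : 'rV[P]_#|B|) : \sum_i psi (w 0 i) * bi i = 0 -> w = 0.
  move=> w0; apply/rowP => i; rewrite mxE -(enum_valK i).
  apply: (basis_free (p := fun b => w 0 (enum_rank b))).
  by rewrite rebase -[RHS]w0; apply: eq_bigr => j _; rewrite enum_valK.
have lam0 y : lam (a * y) = 0.
  rewrite (coE y) rebase mulr_sumr.
  under eq_bigr do rewrite mulrCA.
  rewrite co_sum big1 // => j _.
  suff -> : lam (a * bi j) = 0 by rewrite mulr0.
  have /rowP/(_ j) := vL; rewrite [LHS]mxE [RHS]mxE => <-.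
  rewrite mulr_suml (eq_bigr (fun i => psi (v 0 i) * (bi i * bi j))).
    by rewrite co_sum; apply: eq_bigr => i _; rewrite mxE.
  by move=> i _; rewrite mulrA.
pose Ma : 'M[P]_#|B| := \matrix_(i, j) co (enum_val j) (a * bi i).
have MaE i : a * bi i = \sum_j psi (Ma i j) * bi j.
  by rewrite {1}(coE (a * bi i)) rebase; apply: eq_bigr => j _; rewrite mxE.
have comb_Ma (w : 'rV[P]_#|B|) :
    a * (\sum_i psi (w 0 i) * bi i) = \sum_j psi ((w *m Ma) 0 j) * bi j.
  rewrite mulr_sumr; transitivity (\sum_i \sum_j psi (w 0 i * Ma i j) * bi j).
    apply: eq_bigr => i _; rewrite mulrCA MaE mulr_sumr; apply: eq_bigr => j _.
    by rewrite rmorphM mulrA.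
  rewrite exchange_big; apply: eq_bigr => j _.
  by rewrite mxE rmorph_sum mulr_suml.
have dMa : \det Ma != 0.
  apply/det0P => -[w w0 wM]; case: (@A_dom a (\sum_i psi (w 0 i) * bi i)).
  - by rewrite comb_Ma wM big1 // => j _; rewrite mxE rmorph0 mul0r.
  - by move/comb0 => v0'; rewrite v0' eqxx in v0.
  - by move/comb0 => w0'; rewrite w0' eqxx in w0.
pose j0 := enum_rank btop.
have := lam0 (\sum_i psi ((row j0 (\adj Ma)) 0 i) * bi i).
rewrite comb_Ma -row_mul mul_adj_mx co_sum => /eqP; apply/negP.
rewrite (bigD1 j0) //= big1 ?addr0; last first.
  by move=> j /negbTE jj; rewrite !mxE eq_sym jj mulr0n mul0r.
rewrite !mxE eqxx mulr1n.
have -> : lam (bi j0) = 1; last by rewrite mulr1.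
rewrite enum_rankK; transitivity (lam (\sum_b psi (b == btop)%:R * mon (bw b))).
  rewrite (bigD1 btop) //= eqxx rmorph1 mul1r big1 ?addr0 // => b /negbTE ->.
  by rewrite rmorph0 mul0r.
by rewrite co_uniq eqxx.
Qed.

Lemma pairing_mx_unit : pairing_mx \in unitmx.
Proof.
rewrite unitmxE; have := pairing_det_neq0; have [c ->] := pairing_det_const.
rewrite mpolyC_eq0 => c0; apply/unitrP; exists (c^-1)%:MP.
by rewrite -!mpolyCM mulVf // divff // mpolyC1.
Qed.

Lemma lam_pairing (i : 'I_#|B|) (z : 'cV[P]_#|B|) :
  lam (bi i * \sum_j psi (z j 0) * bi j) = (pairing_mx *m z) i 0.
Proof.
rewrite mulr_sumr; under eq_bigr do rewrite mulrCA.
by rewrite co_sum mxE; apply: eq_bigr => j _; rewrite mxE mulrC.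
Qed.

Theorem cell_frobenius : frobenius psi.
Proof.
exists B, (fun b => mon (bw b)), co, lam; split.
- by move=> b p a a'; apply: co_lin.
- exact: coE.
- exact: co_lin.
- move=> h h_lin; have h0 : h 0 = 0.
    by have := h_lin (-1) 0 0; rewrite rmorphN rmorph1 mulr0 addr0 mulN1r addNr.
  pose H : 'cV[P]_#|B| := \col_i h (bi i).
  pose z := invmx pairing_mx *m H.
  exists (\sum_j psi (z j 0) * bi j) => a.
  rewrite {1 2}(coE a) rebase.
  have h_sum (s : seq 'I_#|B|) (f : 'I_#|B| -> P) (y : 'I_#|B| -> A) :
      h (\sum_(i <- s) psi (f i) * y i) = \sum_(i <- s) f i * h (y i).
    elim: s => [|i s IHs]; first by rewrite !big_nil.
    by rewrite !big_cons h_lin IHs.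
  rewrite h_sum mulr_suml; under [in RHS]eq_bigr do rewrite -mulrA.
  rewrite co_sum; apply: eq_bigr => i _; congr (_ * _).
  by rewrite lam_pairing mulmxA mulmxV ?pairing_mx_unit // mul1mx mxE.
- move=> y y0; rewrite (coE y) rebase.
  pose z : 'cV[P]_#|B| := \col_i co (enum_val i) y.
  have yE : y = \sum_j psi (z j 0) * bi j.
    by rewrite {1}(coE y) rebase; apply: eq_bigr => j _; rewrite mxE.
  have z0 : z = 0.
    rewrite -[z]mul1mx -(mulVmx pairing_mx_unit) -mulmxA.
    suff -> : pairing_mx *m z = 0 by rewrite mulmx0.
    by apply/colP => i; rewrite -lam_pairing -yE y0 mxE.
  rewrite big1 // => i _; have /colP/(_ i) := z0; rewrite !mxE => ->.
  by rewrite rmorph0 mul0r.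
Qed.

End CellBasis.

(** * The triangulated polytope *)

Local Open Scope nat_scope.

(* The vertices are [0, ..., 20].  Each of the seven triples of vertices
   [3 p, 3 p + 1, 3 p + 2] has exactly one vertex off a given facet, namely
   [3 p + F`_p]; see [facet_at]. *)
Definition facets : seq (seq nat) := [::
   [:: 0; 0; 0; 0; 0; 0; 0]; [:: 0; 0; 0; 0; 2; 1; 2];
   [:: 0; 0; 0; 2; 1; 2; 0]; [:: 0; 0; 1; 1; 2; 1; 1];
   [:: 0; 0; 2; 1; 2; 0; 0]; [:: 0; 1; 1; 2; 1; 1; 0];
   [:: 0; 2; 1; 2; 0; 0; 0]; [:: 0; 2; 1; 2; 2; 1; 2];
   [:: 1; 0; 0; 1; 1; 2; 1]; [:: 1; 1; 0; 0; 1; 1; 2];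
   [:: 1; 1; 1; 1; 1; 1; 1]; [:: 1; 1; 2; 1; 1; 0; 0];
   [:: 1; 2; 0; 0; 0; 0; 2]; [:: 1; 2; 0; 2; 1; 2; 2];
   [:: 1; 2; 1; 1; 0; 0; 1]; [:: 1; 2; 2; 1; 2; 0; 2];
   [:: 2; 0; 0; 0; 0; 2; 1]; [:: 2; 0; 2; 1; 2; 2; 1];
   [:: 2; 1; 1; 0; 0; 1; 1]; [:: 2; 1; 2; 0; 0; 0; 0];
   [:: 2; 1; 2; 0; 2; 1; 2]; [:: 2; 1; 2; 2; 1; 2; 0];
   [:: 2; 2; 1; 2; 0; 2; 1]; [:: 2; 2; 2; 2; 2; 2; 2]].

(* The indices of nine facets that form a basis of the dual lattice. *)
Definition frame : seq nat := [:: 0; 1; 2; 6; 9; 10; 14; 21; 22].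

(* Each facet as a difference of two sums of facets of the frame. *)
Definition frame_coeffs : seq (seq nat * seq nat) := [::
   ([:: 0], [::]); ([:: 1], [::]); ([:: 2], [::]); ([:: 1; 5], [:: 4]);
   ([:: 1; 6; 7], [:: 4; 8]); ([:: 3; 5], [:: 6]); ([:: 3], [::]);
   ([:: 1; 3], [:: 0]); ([:: 2; 6], [:: 3]); ([:: 4], [::]); ([:: 5], [::]);
   ([:: 6; 7], [:: 8]); ([:: 4; 6], [:: 5]); ([:: 2; 4; 6], [:: 0; 5]);
   ([:: 6], [::]); ([:: 1; 6; 6; 7], [:: 0; 5; 8]); ([:: 0; 8], [:: 3]);
   ([:: 1; 6; 7], [:: 3; 4]); ([:: 0; 5; 8], [:: 2; 6]); ([:: 0; 7], [:: 2]);
   ([:: 1; 7], [:: 2]); ([:: 7], [::]); ([:: 8], [::]);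
   ([:: 1; 6; 7], [:: 0; 5])].

(* Linear forms on [lattice] inducing 7 times the facets of the frame. *)
Definition frame_forms : seq (seq nat) := [::
   [:: 7; 0; 0; 0; 0; 0; 0; 0; 0; 0]; [:: 4; 1; 2; 3; 2; 4; 2; 3; 0; 0];
   [:: 4; 1; 2; 2; 4; 2; 3; 0; 0; 3]; [:: 4; 1; 2; 2; 3; 0; 0; 3; 2; 4];
   [:: 2; 4; 1; 2; 0; 3; 4; 3; 0; 2]; [:: 0; 7; 0; 0; 0; 0; 0; 0; 0; 0];
   [:: 2; 4; 1; 0; 2; 2; 0; 3; 4; 3]; [:: 1; 2; 4; 3; 2; 0; 4; 0; 2; 3];
   [:: 1; 2; 4; 0; 4; 0; 2; 3; 3; 2]].

(* Pairs of words whose frame coordinates differ by the [l]-th unit vector. *)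
Definition frame_units : seq (seq nat * seq nat) := [::
   ([:: 9], [:: 20]); ([:: 14], [::]); ([:: 13], [:: 4]); ([:: 0], [:: 3]);
   ([:: 6], [:: 3]); ([:: 16], [:: 20]); ([:: 1; 8], [:: 4]); ([:: 8], [::]);
   ([:: 2], [:: 8])].

Definition weights : seq nat :=
  [:: 3; 3; 1; 23; 23; 20; 27; 27; 29; 29; 29; 32; 32; 30; 30; 32; 31; 31; 29; 32; 32].

(* The minimal nonfaces of the triangulation, each with the word that replaces
   it; every rule lowers [weights]. *)
Definition rules : seq (seq nat * seq nat) := [::
   ([:: 3; 7], [:: 0; 19]); ([:: 3; 11], [:: 0; 17]);
   ([:: 4; 17], [:: 2; 13]); ([:: 5; 13], [:: 1; 11]);
   ([:: 6; 10], [:: 1; 3]); ([:: 6; 14], [:: 3; 20]);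
   ([:: 7; 20], [:: 5; 16]); ([:: 8; 12], [:: 2; 15]);
   ([:: 8; 16], [:: 4; 14]); ([:: 8; 19], [:: 2; 10]);
   ([:: 9; 13], [:: 4; 6]); ([:: 9; 17], [:: 2; 6]);
   ([:: 10; 20], [:: 1; 14]); ([:: 11; 15], [:: 5; 18]);
   ([:: 11; 19], [:: 7; 17]); ([:: 12; 16], [:: 7; 9]);
   ([:: 12; 20], [:: 5; 9]); ([:: 13; 15], [:: 1; 18]);
   ([:: 14; 18], [:: 0; 8]); ([:: 15; 19], [:: 10; 12]);
   ([:: 16; 18], [:: 0; 4]); ([:: 3; 4; 5], [:: 0; 1; 2]);
   ([:: 3; 5; 16], [:: 0; 19; 20]); ([:: 3; 5; 18], [:: 0; 15; 17]);
   ([:: 3; 15; 16], [:: 0; 9; 10]); ([:: 3; 18; 20], [:: 0; 6; 8]);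
   ([:: 4; 5; 6], [:: 1; 9; 11]); ([:: 4; 5; 10], [:: 1; 7; 8]);
   ([:: 4; 5; 19], [:: 1; 2; 7]); ([:: 4; 6; 15], [:: 1; 9; 18]);
   ([:: 4; 12; 14], [:: 2; 15; 16]); ([:: 4; 14; 19], [:: 2; 10; 16]);
   ([:: 4; 19; 20], [:: 1; 2; 16]); ([:: 5; 8; 9], [:: 2; 15; 20]);
   ([:: 5; 9; 10], [:: 1; 12; 14]); ([:: 5; 10; 16], [:: 1; 7; 14]);
   ([:: 6; 7; 8], [:: 0; 1; 2]); ([:: 6; 7; 15], [:: 0; 1; 12]);
   ([:: 6; 7; 18], [:: 0; 12; 13]); ([:: 6; 15; 16], [:: 0; 1; 9]);
   ([:: 6; 18; 19], [:: 3; 12; 13]); ([:: 7; 8; 9], [:: 2; 15; 16]);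
   ([:: 7; 8; 13], [:: 4; 10; 11]); ([:: 7; 8; 17], [:: 2; 10; 11]);
   ([:: 7; 9; 18], [:: 0; 4; 12]); ([:: 7; 15; 17], [:: 5; 18; 19]);
   ([:: 8; 9; 11], [:: 2; 18; 20]); ([:: 9; 10; 11], [:: 0; 1; 2]);
   ([:: 9; 10; 18], [:: 3; 4; 15]); ([:: 9; 11; 14], [:: 0; 2; 20]);
   ([:: 9; 18; 19], [:: 3; 4; 12]); ([:: 10; 11; 12], [:: 5; 18; 19]);
   ([:: 10; 11; 16], [:: 7; 13; 14]); ([:: 10; 12; 13], [:: 1; 18; 19]);
   ([:: 11; 12; 14], [:: 0; 2; 5]); ([:: 12; 13; 14], [:: 0; 1; 2]);
   ([:: 12; 14; 17], [:: 2; 3; 5]); ([:: 13; 14; 19], [:: 10; 16; 17]);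
   ([:: 13; 19; 20], [:: 1; 16; 17]); ([:: 14; 15; 17], [:: 3; 5; 8]);
   ([:: 15; 16; 17], [:: 0; 1; 2]); ([:: 15; 17; 20], [:: 5; 6; 8]);
   ([:: 17; 18; 20], [:: 6; 8; 11]); ([:: 18; 19; 20], [:: 0; 1; 2]);
   ([:: 3; 4; 14; 15], [:: 0; 8; 9; 10]);
   ([:: 3; 4; 15; 20], [:: 0; 1; 8; 9]);
   ([:: 4; 5; 9; 14], [:: 2; 15; 16; 20]);
   ([:: 4; 6; 8; 11], [:: 2; 13; 18; 20]);
   ([:: 4; 7; 9; 14], [:: 2; 15; 16; 16]);
   ([:: 7; 10; 12; 17], [:: 5; 18; 19; 19])].

(* The multiplicities with which the minors on the columns [0, 1] and [0, 2] of
   the seven matrices add up to each rule. *)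
Definition rule_certs : seq (seq nat * seq nat) := [::
   ([:: 1; 0; 1; 1; 1; 1; 1], [:: 0; 0; 0; 0; 0; 0; 0]);
   ([:: 0; 0; 0; 0; 0; 0; 0], [:: 1; 0; 1; 1; 1; 1; 1]);
   ([:: 0; 0; 0; 1; 0; 0; 0], [:: 1; 1; 1; 0; 1; 1; 1]);
   ([:: 0; 0; 0; 0; 0; 0; 1], [:: 1; 1; 1; 1; 1; 1; 0]);
   ([:: 1; 1; 0; 1; 1; 1; 1], [:: 0; 0; 0; 0; 0; 0; 0]);
   ([:: 0; 0; 0; 0; 0; 0; 0], [:: 1; 1; 0; 1; 1; 1; 1]);
   ([:: 0; 0; 0; 0; 1; 0; 0], [:: 1; 1; 1; 1; 0; 1; 1]);
   ([:: 0; 0; 0; 0; 0; 0; 0], [:: 0; 0; 0; 0; 0; 1; 0]);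
   ([:: 1; 0; 0; 0; 0; 0; 0], [:: 0; 1; 1; 1; 1; 1; 1]);
   ([:: 1; 1; 1; 1; 1; 0; 1], [:: 0; 0; 0; 0; 0; 1; 0]);
   ([:: 1; 1; 1; 0; 1; 1; 1], [:: 0; 0; 0; 0; 0; 0; 0]);
   ([:: 0; 0; 0; 0; 0; 0; 0], [:: 1; 1; 1; 0; 1; 1; 1]);
   ([:: 1; 1; 0; 1; 1; 1; 1], [:: 0; 0; 1; 0; 0; 0; 0]);
   ([:: 0; 0; 0; 0; 0; 0; 0], [:: 0; 0; 0; 0; 0; 0; 1]);
   ([:: 0; 1; 0; 0; 0; 0; 0], [:: 1; 0; 1; 1; 1; 1; 1]);
   ([:: 1; 1; 1; 1; 0; 1; 1], [:: 0; 0; 0; 0; 0; 0; 0]);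
   ([:: 0; 0; 0; 0; 0; 0; 0], [:: 1; 1; 1; 1; 0; 1; 1]);
   ([:: 0; 0; 0; 0; 0; 0; 1], [:: 0; 0; 0; 0; 0; 0; 0]);
   ([:: 0; 0; 0; 0; 0; 0; 0], [:: 1; 0; 0; 0; 0; 0; 0]);
   ([:: 1; 1; 1; 1; 1; 0; 1], [:: 0; 0; 0; 0; 0; 0; 0]);
   ([:: 1; 0; 0; 0; 0; 0; 0], [:: 0; 0; 0; 0; 0; 0; 0]);
   ([:: 0; 0; 0; 1; 0; 0; 1], [:: 1; 0; 1; 0; 1; 1; 0]);
   ([:: 1; 0; 1; 1; 0; 1; 1], [:: 0; 0; 0; 0; 1; 0; 0]);
   ([:: 0; 0; 0; 0; 0; 0; 0], [:: 1; 0; 1; 1; 1; 1; 0]);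
   ([:: 1; 0; 1; 1; 0; 0; 1], [:: 0; 0; 0; 0; 0; 0; 0]);
   ([:: 0; 0; 0; 0; 0; 0; 0], [:: 1; 0; 1; 0; 0; 0; 0]);
   ([:: 0; 0; 0; 1; 0; 0; 1], [:: 1; 1; 1; 1; 1; 1; 0]);
   ([:: 0; 1; 0; 1; 0; 1; 1], [:: 1; 0; 1; 0; 1; 0; 0]);
   ([:: 0; 1; 0; 1; 0; 0; 1], [:: 1; 0; 1; 0; 1; 1; 0]);
   ([:: 0; 0; 0; 1; 0; 0; 1], [:: 0; 0; 0; 0; 0; 0; 0]);
   ([:: 0; 1; 1; 1; 1; 1; 1], [:: 1; 0; 0; 0; 0; 1; 0]);
   ([:: 0; 1; 1; 1; 1; 0; 1], [:: 1; 0; 0; 0; 0; 1; 0]);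
   ([:: 0; 1; 0; 1; 1; 0; 1], [:: 1; 0; 1; 0; 0; 1; 0]);
   ([:: 0; 0; 0; 0; 0; 0; 0], [:: 0; 0; 0; 0; 1; 1; 0]);
   ([:: 1; 1; 0; 1; 1; 1; 1], [:: 0; 0; 1; 0; 1; 0; 0]);
   ([:: 1; 1; 0; 1; 0; 1; 1], [:: 0; 0; 1; 0; 1; 0; 0]);
   ([:: 1; 0; 0; 1; 1; 0; 1], [:: 0; 0; 0; 0; 0; 1; 0]);
   ([:: 1; 0; 0; 1; 1; 0; 1], [:: 0; 0; 0; 0; 0; 0; 0]);
   ([:: 1; 0; 0; 1; 1; 0; 0], [:: 0; 0; 0; 0; 0; 0; 0]);
   ([:: 1; 0; 0; 1; 0; 0; 1], [:: 0; 0; 0; 0; 0; 0; 0]);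
   ([:: 1; 1; 0; 1; 1; 0; 0], [:: 0; 0; 0; 0; 0; 0; 0]);
   ([:: 0; 0; 0; 0; 1; 0; 0], [:: 0; 0; 0; 0; 0; 1; 0]);
   ([:: 1; 0; 1; 0; 1; 0; 1], [:: 0; 1; 0; 1; 0; 1; 0]);
   ([:: 1; 0; 1; 1; 1; 0; 1], [:: 0; 1; 0; 0; 0; 1; 0]);
   ([:: 1; 0; 0; 0; 1; 0; 0], [:: 0; 0; 0; 0; 0; 0; 0]);
   ([:: 1; 0; 1; 1; 1; 1; 1], [:: 0; 1; 0; 0; 0; 0; 1]);
   ([:: 0; 0; 0; 0; 0; 0; 0], [:: 0; 0; 0; 0; 1; 1; 1]);
   ([:: 1; 1; 0; 1; 1; 1; 1], [:: 1; 0; 1; 0; 1; 1; 1]);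
   ([:: 1; 1; 0; 0; 1; 1; 0], [:: 0; 0; 0; 0; 0; 0; 0]);
   ([:: 0; 0; 0; 0; 0; 0; 0], [:: 1; 0; 0; 0; 1; 1; 1]);
   ([:: 1; 1; 0; 0; 1; 0; 0], [:: 0; 0; 0; 0; 0; 0; 0]);
   ([:: 0; 0; 0; 0; 0; 1; 0], [:: 0; 0; 0; 0; 0; 0; 1]);
   ([:: 1; 1; 0; 1; 0; 1; 0], [:: 0; 0; 1; 0; 1; 0; 1]);
   ([:: 0; 0; 0; 0; 0; 1; 1], [:: 0; 0; 0; 0; 0; 0; 0]);
   ([:: 0; 0; 0; 0; 0; 0; 0], [:: 1; 0; 0; 0; 0; 1; 1]);
   ([:: 0; 0; 0; 0; 0; 0; 1], [:: 1; 0; 0; 0; 0; 1; 0]);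
   ([:: 0; 0; 0; 0; 0; 0; 0], [:: 1; 1; 0; 0; 0; 1; 1]);
   ([:: 0; 1; 1; 0; 1; 0; 1], [:: 1; 0; 0; 1; 0; 1; 0]);
   ([:: 0; 1; 0; 0; 1; 0; 1], [:: 1; 0; 1; 1; 0; 1; 0]);
   ([:: 0; 0; 0; 0; 0; 0; 0], [:: 1; 1; 0; 0; 0; 0; 1]);
   ([:: 1; 0; 0; 1; 0; 0; 1], [:: 1; 1; 1; 0; 1; 1; 1]);
   ([:: 0; 0; 0; 0; 0; 0; 0], [:: 1; 1; 1; 0; 0; 0; 1]);
   ([:: 0; 0; 0; 0; 0; 0; 0], [:: 1; 1; 1; 0; 0; 0; 0]);
   ([:: 1; 1; 0; 1; 1; 0; 1], [:: 1; 0; 1; 0; 0; 1; 0]);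
   ([:: 0; 0; 1; 1; 0; 0; 1], [:: 1; 0; 0; 0; 0; 0; 0]);
   ([:: 0; 0; 0; 1; 0; 0; 1], [:: 1; 0; 1; 0; 0; 0; 0]);
   ([:: 0; 1; 1; 1; 1; 1; 1], [:: 1; 0; 0; 0; 1; 1; 0]);
   ([:: 0; 0; 0; 1; 0; 0; 0], [:: 0; 0; 0; 0; 1; 1; 1]);
   ([:: 0; 1; 1; 1; 2; 1; 1], [:: 1; 0; 0; 0; 0; 1; 0]);
   ([:: 1; 0; 1; 1; 1; 2; 1], [:: 0; 1; 0; 0; 0; 0; 1])].

(* The cells in the order of a shelling, without the vertices [0], [1] and [2]
   common to all of them; the first list is the restriction set, that is the
   smallest face that lies in no earlier cell. *)
Definition cells : seq (seq nat * seq nat) := [::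
   ([::], [:: 3; 4; 6; 13; 16; 20]); ([:: 9], [:: 3; 4; 6; 16; 20]);
   ([:: 14], [:: 3; 4; 13; 16; 20]); ([:: 9; 14], [:: 3; 4; 16; 20]);
   ([:: 8], [:: 3; 4; 13; 14; 20]); ([:: 8; 9], [:: 3; 4; 14; 20]);
   ([:: 6; 8], [:: 3; 4; 13; 20]); ([:: 6; 8; 9], [:: 3; 4; 20]);
   ([:: 11], [:: 4; 6; 13; 16; 20]); ([:: 9; 11], [:: 4; 6; 16; 20]);
   ([:: 17], [:: 3; 6; 13; 16; 20]); ([:: 14; 17], [:: 3; 13; 16; 20]);
   ([:: 5], [:: 4; 9; 11; 16; 20]); ([:: 11; 14], [:: 4; 13; 16; 20]);
   ([:: 5; 6], [:: 9; 11; 16; 20]); ([:: 11; 17], [:: 6; 13; 16; 20]);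
   ([:: 8; 11], [:: 4; 13; 14; 20]); ([:: 15], [:: 4; 9; 14; 16; 20]);
   ([:: 18], [:: 4; 6; 8; 13; 20]); ([:: 9; 18], [:: 4; 6; 8; 20]);
   ([:: 7], [:: 4; 5; 9; 11; 16]); ([:: 8; 15], [:: 4; 9; 14; 20]);
   ([:: 10], [:: 3; 4; 13; 14; 16]); ([:: 9; 10], [:: 3; 4; 14; 16]);
   ([:: 5; 15], [:: 4; 9; 16; 20]); ([:: 6; 7], [:: 4; 9; 11; 16]);
   ([:: 5; 6; 7], [:: 9; 11; 16]); ([:: 11; 14; 17], [:: 13; 16; 20]);
   ([:: 5; 14], [:: 4; 11; 16; 20]); ([:: 5; 14; 15], [:: 4; 16; 20]);
   ([:: 8; 10], [:: 3; 4; 13; 14]); ([:: 8; 9; 10], [:: 3; 4; 14]);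
   ([:: 5; 9; 14], [:: 15; 16; 20]); ([:: 7; 13], [:: 4; 6; 11; 16]);
   ([:: 11; 18], [:: 4; 6; 13; 20]); ([:: 5; 8], [:: 4; 11; 14; 20]);
   ([:: 5; 8; 15], [:: 4; 14; 20]); ([:: 8; 17], [:: 3; 13; 14; 20]);
   ([:: 7; 15], [:: 4; 5; 9; 16]); ([:: 6; 8; 17], [:: 3; 13; 20]);
   ([:: 9; 11; 18], [:: 4; 6; 20]); ([:: 8; 11; 18], [:: 4; 13; 20]);
   ([:: 12], [:: 4; 5; 7; 9; 11]); ([:: 7; 14], [:: 4; 5; 11; 16]);
   ([:: 15; 18], [:: 4; 8; 9; 20]); ([:: 5; 17], [:: 6; 11; 16; 20]);
   ([:: 7; 14; 15], [:: 4; 5; 16]); ([:: 6; 12], [:: 4; 7; 9; 11]);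
   ([:: 5; 6; 12], [:: 7; 9; 11]); ([:: 3; 18], [:: 4; 6; 8; 13]);
   ([:: 3; 9; 18], [:: 4; 6; 8]); ([:: 5; 18], [:: 4; 9; 11; 20]);
   ([:: 10; 15], [:: 4; 9; 14; 16]); ([:: 8; 10; 15], [:: 4; 9; 14]);
   ([:: 5; 14; 17], [:: 11; 16; 20]); ([:: 19], [:: 3; 4; 6; 13; 16]);
   ([:: 17; 19], [:: 3; 6; 13; 16]); ([:: 9; 19], [:: 3; 4; 6; 16]);
   ([:: 5; 15; 18], [:: 4; 9; 20]); ([:: 19; 20], [:: 3; 6; 16; 17]);
   ([:: 7; 9; 14], [:: 5; 15; 16]); ([:: 9; 19; 20], [:: 3; 6; 16]);
   ([:: 14; 19], [:: 3; 16; 17; 20]); ([:: 9; 14; 19], [:: 3; 16; 20]);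
   ([:: 12; 15], [:: 4; 5; 7; 9]); ([:: 7; 17], [:: 6; 11; 13; 16]);
   ([:: 5; 8; 18], [:: 4; 11; 20]); ([:: 5; 8; 15; 18], [:: 4; 20]);
   ([:: 5; 7; 17], [:: 6; 11; 16]); ([:: 5; 19], [:: 6; 16; 17; 20]);
   ([:: 7; 13; 14], [:: 4; 11; 16]); ([:: 5; 9; 19], [:: 6; 16; 20]);
   ([:: 5; 6; 18], [:: 9; 11; 20]); ([:: 8; 11; 17], [:: 13; 14; 20]);
   ([:: 5; 14; 19], [:: 16; 17; 20]); ([:: 10; 17], [:: 3; 13; 14; 16]);
   ([:: 5; 9; 14; 19], [:: 16; 20]); ([:: 10; 19], [:: 3; 4; 13; 16]);
   ([:: 10; 17; 19], [:: 3; 13; 16]); ([:: 10; 14; 19], [:: 3; 16; 17]);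
   ([:: 7; 10], [:: 4; 13; 14; 16]); ([:: 7; 19], [:: 4; 6; 13; 16]);
   ([:: 7; 17; 19], [:: 6; 13; 16]); ([:: 7; 9; 19], [:: 4; 6; 16]);
   ([:: 9; 10; 19], [:: 3; 4; 16]); ([:: 5; 7; 19], [:: 6; 16; 17]);
   ([:: 9; 10; 14; 19], [:: 3; 16]); ([:: 7; 10; 15], [:: 4; 14; 16]);
   ([:: 5; 7; 9; 19], [:: 6; 16]); ([:: 7; 8], [:: 4; 5; 11; 14]);
   ([:: 7; 8; 15], [:: 4; 5; 14]); ([:: 7; 14; 17], [:: 5; 11; 16]);
   ([:: 7; 14; 19], [:: 5; 16; 17]); ([:: 7; 9; 14; 19], [:: 5; 16]);
   ([:: 7; 9; 10], [:: 4; 15; 16]); ([:: 7; 13; 14; 17], [:: 11; 16]);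
   ([:: 7; 9; 10; 14], [:: 15; 16]); ([:: 12; 18], [:: 4; 5; 9; 11]);
   ([:: 3; 5], [:: 6; 17; 19; 20]); ([:: 3; 5; 9], [:: 6; 19; 20]);
   ([:: 3; 5; 14], [:: 17; 19; 20]); ([:: 10; 11], [:: 4; 7; 13; 14]);
   ([:: 3; 5; 9; 14], [:: 19; 20]); ([:: 6; 8; 11], [:: 13; 18; 20]);
   ([:: 8; 10; 11], [:: 4; 13; 14]); ([:: 6; 12; 18], [:: 4; 9; 11]);
   ([:: 7; 10; 17], [:: 13; 14; 16]); ([:: 12; 15; 18], [:: 4; 5; 9]);
   ([:: 7; 8; 10], [:: 4; 11; 14]); ([:: 7; 10; 19], [:: 4; 13; 16]);
   ([:: 7; 10; 17; 19], [:: 13; 16]); ([:: 7; 10; 14; 19], [:: 16; 17]);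
   ([:: 7; 8; 10; 15], [:: 4; 14]); ([:: 7; 9; 10; 19], [:: 4; 16]);
   ([:: 7; 9; 10; 14; 19], [:: 16]); ([:: 6; 8; 11; 17], [:: 13; 20]);
   ([:: 12; 13], [:: 4; 6; 7; 11]); ([:: 6; 15], [:: 8; 9; 18; 20]);
   ([:: 3; 15], [:: 4; 8; 9; 10]); ([:: 3; 14; 15], [:: 8; 9; 10]);
   ([:: 12; 19], [:: 4; 6; 7; 9]); ([:: 5; 12; 19], [:: 6; 7; 9]);
   ([:: 5; 6; 12; 18], [:: 9; 11]); ([:: 12; 14], [:: 5; 7; 9; 15]);
   ([:: 10; 11; 17], [:: 7; 13; 14]); ([:: 3; 15; 18], [:: 4; 8; 9]);
   ([:: 5; 6; 15], [:: 9; 18; 20]); ([:: 17; 18], [:: 6; 8; 11; 13]);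
   ([:: 12; 14; 19], [:: 5; 7; 9]); ([:: 8; 10; 17], [:: 3; 13; 14]);
   ([:: 10; 12], [:: 4; 7; 9; 15]); ([:: 10; 12; 14], [:: 7; 9; 15]);
   ([:: 10; 12; 19], [:: 4; 7; 9]); ([:: 10; 12; 14; 19], [:: 7; 9]);
   ([:: 12; 13; 18], [:: 4; 6; 11]); ([:: 5; 8; 17], [:: 11; 14; 20]);
   ([:: 3; 15; 20], [:: 8; 9; 14]); ([:: 3; 6; 15], [:: 8; 9; 18]);
   ([:: 3; 6; 15; 20], [:: 8; 9]); ([:: 10; 18], [:: 3; 4; 8; 13]);
   ([:: 10; 15; 18], [:: 3; 4; 8]); ([:: 12; 13; 19], [:: 4; 6; 7]);
   ([:: 3; 17; 18], [:: 6; 8; 13]); ([:: 3; 12], [:: 4; 6; 9; 19]);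
   ([:: 5; 10], [:: 7; 8; 11; 14]); ([:: 5; 10; 15], [:: 7; 8; 14]);
   ([:: 3; 5; 12], [:: 6; 9; 19]); ([:: 6; 12; 15], [:: 5; 9; 18]);
   ([:: 8; 10; 11; 17], [:: 13; 14]); ([:: 5; 6; 8], [:: 11; 18; 20]);
   ([:: 5; 6; 8; 15], [:: 18; 20]); ([:: 3; 12; 14], [:: 5; 9; 19]);
   ([:: 5; 6; 8; 17], [:: 11; 20]); ([:: 3; 10; 12], [:: 4; 9; 19]);
   ([:: 3; 10; 12; 14], [:: 9; 19]); ([:: 3; 5; 15], [:: 9; 14; 20]);
   ([:: 7; 18], [:: 4; 5; 11; 12]); ([:: 3; 5; 6; 15], [:: 9; 20]);
   ([:: 3; 12; 18], [:: 4; 6; 9]); ([:: 3; 12; 15], [:: 4; 9; 10]);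
   ([:: 3; 12; 14; 15], [:: 9; 10]); ([:: 5; 10; 17], [:: 7; 11; 14]);
   ([:: 7; 15; 18], [:: 4; 5; 12]); ([:: 5; 17; 18], [:: 6; 8; 11]);
   ([:: 5; 10; 12], [:: 7; 14; 15]); ([:: 5; 10; 19], [:: 7; 14; 17]);
   ([:: 5; 10; 12; 19], [:: 7; 14]); ([:: 3; 12; 15; 18], [:: 4; 9]);
   ([:: 7; 13; 18], [:: 4; 11; 12]); ([:: 3; 5; 12; 15], [:: 9; 14]);
   ([:: 3; 12; 13], [:: 4; 6; 19]); ([:: 3; 5; 8], [:: 14; 17; 20]);
   ([:: 3; 5; 8; 15], [:: 14; 20]); ([:: 7; 8; 18], [:: 4; 5; 11]);
   ([:: 7; 8; 15; 18], [:: 4; 5]); ([:: 3; 5; 6; 8], [:: 17; 20]);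
   ([:: 3; 5; 6; 8; 15], [:: 20]); ([:: 3; 12; 13; 18], [:: 4; 6]);
   ([:: 18; 19], [:: 3; 4; 12; 13]); ([:: 10; 11; 18], [:: 4; 8; 13]);
   ([:: 3; 6; 12; 15], [:: 9; 18]); ([:: 3; 5; 6; 12; 15], [:: 9]);
   ([:: 10; 12; 18], [:: 3; 4; 15]); ([:: 7; 10; 18], [:: 4; 8; 11]);
   ([:: 7; 10; 15; 18], [:: 4; 8]); ([:: 7; 10; 13; 18], [:: 4; 11]);
   ([:: 10; 18; 19], [:: 3; 4; 13]); ([:: 10; 12; 18; 19], [:: 3; 4]);
   ([:: 5; 8; 10; 17], [:: 11; 14]); ([:: 3; 5; 10], [:: 14; 17; 19]);
   ([:: 3; 5; 10; 12], [:: 14; 19]); ([:: 7; 18; 19], [:: 4; 12; 13]);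
   ([:: 3; 5; 10; 15], [:: 12; 14]); ([:: 12; 17], [:: 6; 7; 11; 13]);
   ([:: 5; 12; 17], [:: 6; 7; 11]); ([:: 10; 17; 18], [:: 3; 8; 13]);
   ([:: 7; 10; 12; 18], [:: 4; 15]); ([:: 12; 17; 19], [:: 6; 7; 13]);
   ([:: 5; 12; 17; 19], [:: 6; 7]); ([:: 7; 10; 18; 19], [:: 4; 13]);
   ([:: 7; 10; 12; 18; 19], [:: 4]); ([:: 12; 17; 18], [:: 6; 11; 13]);
   ([:: 15; 17], [:: 5; 6; 8; 18]); ([:: 5; 10; 18], [:: 7; 8; 11]);
   ([:: 5; 10; 15; 18], [:: 7; 8]); ([:: 10; 11; 17; 18], [:: 8; 13]);
   ([:: 3; 15; 17], [:: 6; 8; 18]); ([:: 3; 5; 15; 17], [:: 6; 8]);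
   ([:: 3; 5; 8; 10], [:: 14; 17]); ([:: 3; 5; 8; 10; 15], [:: 14]);
   ([:: 3; 12; 17], [:: 6; 13; 19]); ([:: 5; 12; 17; 18], [:: 6; 11]);
   ([:: 3; 5; 12; 17], [:: 6; 19]); ([:: 3; 12; 17; 18], [:: 6; 13]);
   ([:: 17; 18; 19], [:: 3; 12; 13]); ([:: 10; 17; 18; 19], [:: 3; 13]);
   ([:: 7; 17; 18], [:: 11; 12; 13]); ([:: 7; 17; 18; 19], [:: 12; 13]);
   ([:: 7; 10; 17; 18], [:: 11; 13]); ([:: 5; 10; 17; 18], [:: 8; 11]);
   ([:: 12; 15; 17], [:: 5; 6; 18]); ([:: 7; 10; 17; 18; 19], [:: 13]);
   ([:: 3; 12; 15; 17], [:: 6; 18]); ([:: 3; 5; 12; 15; 17], [:: 6]);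
   ([:: 10; 15; 17], [:: 3; 8; 18]); ([:: 5; 10; 15; 17], [:: 3; 8]);
   ([:: 5; 10; 15; 17; 18], [:: 8]); ([:: 5; 7; 17; 18], [:: 11; 12]);
   ([:: 5; 7; 10; 17; 18], [:: 11]); ([:: 5; 10; 12; 18], [:: 7; 15]);
   ([:: 5; 18; 19], [:: 7; 12; 17]); ([:: 5; 10; 18; 19], [:: 7; 17]);
   ([:: 5; 10; 12; 18; 19], [:: 7]); ([:: 10; 12; 17], [:: 3; 18; 19]);
   ([:: 5; 10; 12; 17], [:: 3; 19]); ([:: 10; 12; 15; 17], [:: 3; 18]);
   ([:: 5; 10; 12; 15; 17], [:: 3]); ([:: 5; 10; 12; 17; 18], [:: 19]);
   ([:: 5; 10; 12; 15; 17; 18], [::])].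

Definition facet_at (F : seq nat) (v : nat) : bool := eqn (nth 0 F (v %/ 3)) (v %% 3).

Definition cell_mask (c : seq nat * seq nat) : seq bool :=
  [seq (v < 3) || (v \in c.1) || (v \in c.2) | v <- iota 0 21].

Definition facet_mask (F : seq nat) : seq bool := [seq facet_at F v | v <- iota 0 21].

(* [covers] branches on whether each vertex belongs to a set in order to check
   that every set of vertices contains a nonface, or lies in a cell and contains
   its restriction set. *)
Definition pop1 (v : nat) (c : seq nat * seq nat) : option (seq nat * seq nat) :=
  if c.1 is a :: r then if eqn a v then Some (r, c.2) else
    if c.2 is b :: s then if eqn b v then Some (c.1, s) else None else None
  else if c.2 is b :: s then if eqn b v then Some (c.1, s) else None else None.

Definition pop0 (v : nat) (c : seq nat * seq nat) : option (seq nat * seq nat) :=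
  if (if c.1 is a :: _ then eqn a v else false) then None else
  if c.2 is b :: s then if eqn b v then Some (c.1, s) else Some c else Some c.

Definition drop1 (v : nat) (g : seq nat) : seq nat :=
  if g is a :: h then if eqn a v then h else g else g.

Definition keep0 (v : nat) (g : seq nat) : bool :=
  if g is a :: _ then ~~ eqn a v else true.

Fixpoint covers (n v : nat) (cs : seq (seq nat * seq nat)) (gs : seq (seq nat)) : bool :=
  if has (fun g => nilp g) gs then true else
  if n is m.+1 then
    covers m v.+1 (pmap (pop1 v) cs) (map (drop1 v) gs) &&
    covers m v.+1 (pmap (pop0 v) cs) (filter (keep0 v) gs)
  else has (fun c => nilp c.1) cs.

Fixpoint mask_le (f : seq bool) (m : seq bool) : bool :=
  match f, m with
  | a :: f', b :: m' => (a ==> b) && mask_le f' m'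
  | _, _ => true
  end.

Fixpoint shelled (ms rs : seq (seq bool)) : bool :=
  match ms, rs with
  | m :: ms', r :: rs' => all (fun r' => ~~ mask_le r' m) rs' && shelled ms' rs'
  | _, _ => true
  end.

Fixpoint disjoint_mask (f m : seq bool) : bool :=
  match f, m with
  | a :: f', b :: m' => ~~ (a && b) && disjoint_mask f' m'
  | _, _ => true
  end.

(** Unimodularity of a cell in triangular form: each vertex has a facet functional equal to 1 on it
    and 0 on the later vertices of the cell, so exponents are solved for one after another without
    division. *)
Fixpoint separated (fs : seq (seq bool)) (m : seq bool) : bool :=
  if m is _ :: m' then
    has (fun f => head false f && disjoint_mask (behead f) m') fs &&
    separated (map behead fs) m'
  else true.

(** The search starts at vertex 3: the vertices 0, 1, 2 lie in every cell and in no minimal nonface,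
    which leaves 18 vertices. *)
Lemma covers_ok : covers 18 3 cells (map fst rules).
Proof. by vm_cast_no_check (erefl true). Qed.

Lemma shelled_ok : shelled (map cell_mask cells)
  (map (fun c => map (fun v => v \in c.1) (iota 0 21)) cells).
Proof. by vm_cast_no_check (erefl true). Qed.

Lemma separated_ok : all (fun c => separated (map facet_mask facets) (cell_mask c)) cells.
Proof. by vm_cast_no_check (erefl true). Qed.


Lemma covers_sound (b : nat -> bool) n v cs gs : covers n v cs gs ->
  (exists2 g, g \in gs & all b g) \/
  (exists2 c, c \in cs & all b c.1 /\
    forall u, v <= u < v + n -> b u -> (u \in c.1) || (u \in c.2)).
Proof.
elim: n v cs gs => [|n IHn] v cs gs /=.
  case: ifP => [/hasP[g gs_g /nilP g0] _|_ /hasP[c cs_c /nilP c0]].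
    by left; exists g => //; rewrite g0.
  right; exists c => //; rewrite c0; split=> // u.
  by rewrite addn0; lia.
case: ifP => [/hasP[g gs_g /nilP g0] _|_]; first by left; exists g => //; rewrite g0.
case/andP=> cov1 cov0; case bv: (b v).
  case: (IHn _ _ _ cov1) => [[_ /mapP[g gs_g ->] gb]|[c']].
    left; exists g => //; case: g gb gs_g => //= a h.
    by case: eqnP => // -> hb _; rewrite bv.
  rewrite mem_pmap => /mapP[[r s] cs_c] /esym pc [rb cb].
  right; exists (r, s) => //.
  have [rb' cb'] : all b r /\ ((v \in r) || (v \in s)) /\
      forall u, (u \in c'.1) || (u \in c'.2) -> (u \in r) || (u \in s).
    move: pc rb; rewrite /pop1 /=; case: r {cs_c} => [|a r].
      case: s => // a s; case: eqnP => // -> [<-] /= _; split=> //; split.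
        by rewrite inE eqxx.
      by move=> u us; rewrite inE us orbT.
    case: eqnP => [->|_].
      move=> [<-] /= rb; rewrite bv; split=> //; split; first by rewrite inE eqxx.
      by move=> u; rewrite inE -orbA => ->; rewrite orbT.
    case: s => // a' s; case: eqnP => // -> [<-] /= rb; split=> //; split.
      by rewrite !inE eqxx orbT.
    by move=> u; rewrite !inE => /orP[->//|->]; rewrite !orbT.
  split=> // u uv bu; case: (eqVneq u v) => [->|uv']; first by case: cb'.
  by case: cb' => _; apply; apply: cb => //; lia.
case: (IHn _ _ _ cov0) => [[g]|[c']].
  by rewrite mem_filter => /andP[_ gs_g] gb; left; exists g.
rewrite mem_pmap => /mapP[[r s] cs_c] /esym pc [rb cb].
right; exists (r, s) => //.
have [er es] : c'.1 = r /\ forall u, u \in c'.2 -> u \in s.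
  move: pc; rewrite /pop0 /=; case: ifP => // _.
  case: s {cs_c} => [[<-]//|a s]; case: eqnP => _ [<-] //=; split=> // u us.
  by rewrite inE us orbT.
rewrite -er; split=> // u uv bu; rewrite er.
have {}uv : v.+1 <= u < v.+1 + n.
  by have := bu; case: (eqVneq u v) => [->|]; rewrite ?bv //; lia.
by have := cb u uv bu; rewrite er => /orP[->//|/es ->]; rewrite orbT.
Qed.

Lemma mask_le_nth f m : size f = size m ->
  (forall v, nth false f v -> nth false m v) -> mask_le f m.
Proof.
elim: f m => [|a f IHf] [|b m] //= [fm] h; apply/andP; split.
  by apply/implyP; apply: (h 0).
by apply: IHf => // v; apply: (h v.+1).
Qed.

Lemma shelled_nth ms rs i j : shelled ms rs -> size ms = size rs ->
  j < i < size rs -> ~~ mask_le (nth [::] rs i) (nth [::] ms j).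
Proof.
elim: ms rs i j => [|m ms IHm] [|r rs] i j //= => [_ _|/andP[/allP h sh] [sz]].
  by rewrite ltn0 andbF.
case: i j => [|i] [|j] //= ij; first by apply: h; apply: mem_nth.
by apply: IHm.
Qed.

Lemma disjoint_mask_nth f m v : disjoint_mask f m -> nth false m v -> ~~ nth false f v.
Proof.
elim: f m v => [|a f IHf] [|b m] [|v] //=; rewrite ?nth_nil //.
  by case: a b => [] [].
by case/andP=> _ /IHf h /h.
Qed.

Lemma separated_nth fs m v : separated fs m -> v < size m ->
  exists2 f, f \in fs & nth false f v /\
    forall u, v < u -> nth false m u -> ~~ nth false f u.
Proof.
elim: m fs v => // a m IHm fs [|v] /= /andP[/hasP[f fs_f /andP[f0 fm]] sep].
  move=> _; exists f => //; split; first by case: f f0 {fm fs_f}.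
  by case=> // u _ mu; rewrite -nth_behead; apply: disjoint_mask_nth fm mu.
rewrite ltnS => vm; have [_ /mapP[h fs_h ->] [hv hu]] := IHm _ _ sep vm.
exists h => //; rewrite -nth_behead; split=> // -[//|u] uv mu.
by rewrite -nth_behead; apply: hu.
Qed.

Local Notation word := 'X_{1..21}.

Definition list_word (s : seq nat) : word := [multinom count_mem (val v) s | v < 21].

Lemma weight_list_word (a : nat -> nat) s : all (fun v => v < 21) s ->
  weight (fun v : 'I_21 => a v) (list_word s) = sumn (map a s).
Proof.
elim: s => [|v s IHs] /=.
  by rewrite /weight big1 // => u _; rewrite mnmE.
case/andP=> v21 /IHs <-.
have -> : list_word (v :: s) = (U_(Ordinal v21) + list_word s)%MM.
  by apply/mnmP => u; rewrite mnmDE !mnmE -val_eqE.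
by rewrite wtD wtU.
Qed.

Definition cell_at (i : nat) := nth ([::], [::]) cells i.

Definition cell_r (i : 'I_239) : {set 'I_21} := [set v : 'I_21 | val v \in (cell_at i).1].
Definition cell_sg (i : 'I_239) : {set 'I_21} :=
  [set v : 'I_21 | nth false (cell_mask (cell_at i)) v].

Lemma cells_size : size cells = 239. Proof. by []. Qed.

Lemma nth_mask (p : pred nat) v : v < 21 -> nth false (map p (iota 0 21)) v = p v.
Proof. by move=> v21; rewrite (nth_map 0) ?size_iota // nth_iota. Qed.

Lemma cell_sgE i (v : 'I_21) : (v \in cell_sg i) =
  [|| v < 3, val v \in (cell_at i).1 | val v \in (cell_at i).2].
Proof. by rewrite inE nth_mask // orbA. Qed.

Lemma cells_shape : all (fun c => [&& all (fun v => 3 <= v < 21) (c.1 ++ c.2),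
  uniq (c.1 ++ c.2) & size (c.1 ++ c.2) == 6]) cells.
Proof. by vm_cast_no_check (erefl true). Qed.

Lemma cell_at_in (i : 'I_239) : cell_at i \in cells.
Proof. by apply: mem_nth; rewrite cells_size. Qed.

Lemma cell_r_sg i : cell_r i \subset cell_sg i.
Proof. by apply/fintype.subsetP => v; rewrite cell_sgE inE => ->; rewrite orbT. Qed.

Lemma cell_sg_card i : #|cell_sg i| = 9.
Proof.
have /allP/(_ _ (cell_at_in i))/and3P[/allP lim uq /eqP sz] := cells_shape.
pose s := iota 0 3 ++ (cell_at i).1 ++ (cell_at i).2.
have s_uniq : uniq s.
  rewrite cat_uniq iota_uniq uq andbT /=; apply/hasPn => v /lim /andP[v3 _].
  by rewrite !inE; lia.
have s21 v : v \in s -> v < 21.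
  by rewrite mem_cat mem_iota => /orP[|/lim]; lia.
rewrite cardE -(size_map val) -[RHS](_ : size s = 9); last by rewrite size_cat sz.
apply/perm_size/uniq_perm => //; first by rewrite map_inj_uniq ?enum_uniq //; apply: val_inj.
move=> v; apply/mapP/idP => [[u]|vs].
  by rewrite mem_enum cell_sgE => us ->; rewrite !mem_cat mem_iota.
exists (Ordinal (s21 v vs)) => //; rewrite mem_enum cell_sgE.
by have := vs; rewrite /s !mem_cat mem_iota.
Qed.

Lemma cell_or_rule (c : word) : (exists i, in_cell cell_r cell_sg i c) \/
  exists2 g, g \in rules & forall v : 'I_21, val v \in g.1 -> 0 < c v.
Proof.
pose b v := if insub v is Some u then 0 < c u else false.
have bE (v : 'I_21) : b v = (0 < c v) by rewrite /b valK.
case: (covers_sound b covers_ok) => [[_ /mapP[g gr ->] /allP gb]|[cl cl_in [/allP rb sb]]].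
  by right; exists g => // v /gb; rewrite bE.
have il : index cl cells < 239 by rewrite -cells_size index_mem.
have clE : cell_at (Ordinal il) = cl by rewrite /cell_at nth_index.
left; exists (Ordinal il); apply/in_cellP; split=> v; rewrite ?cell_sgE ?inE clE.
  by move/rb; rewrite bE.
rewrite -bE; case: (ltnP v 3) => //= v3 bv; apply: sb => //.
by rewrite v3 /=; have := ltn_ord v; lia.
Qed.

Lemma cell_order_holds i j (c : word) : (forall v, v \in cell_r i -> 0 < c v) ->
  in_cell cell_r cell_sg j c -> i <= j.
Proof.
move=> ri /in_cellP[_ sj]; rewrite leqNgt; apply/negP => ji.
have := shelled_nth shelled_ok; rewrite !size_map => /(_ i j erefl).
rewrite ji cells_size ltn_ord => /(_ isT)/negP; apply.
rewrite !(nth_map ([::], [::])) ?cells_size ?ltn_ord //.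
apply: mask_le_nth; first by rewrite !size_map.
move=> v; have [v21|v21] := ltnP v 21; last first.
  by rewrite nth_default // size_map size_iota.
rewrite nth_mask // => vr.
have := sj (Ordinal v21); rewrite !inE; apply; apply: ri.
by rewrite inE.
Qed.

Lemma cell_facet i (v : 'I_21) : exists2 F, F \in facets & facet_at F v /\
  forall u : 'I_21, v < u -> u \in cell_sg i -> ~~ facet_at F u.
Proof.
have /allP/(_ _ (cell_at_in i))/separated_nth := separated_ok.
move=> /(_ v); rewrite size_map size_iota ltn_ord => /(_ isT)[_ /mapP[F Fin ->]].
rewrite nth_mask // => -[Fv Fu]; exists F => //; split=> // u vu.
by rewrite inE => /(Fu _ vu); rewrite nth_mask.
Qed.

Definition facet_value (F : seq nat) : word -> nat :=
  weight (fun v : 'I_21 => facet_at F v).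

(* Reading off the exponents of a standard word in the pulling order: the
   facet of [cell_facet] sees [v] but none of the later vertices of the cell. *)
Lemma facet_values_inj i j (c c' : word) :
  in_cell cell_r cell_sg i c -> in_cell cell_r cell_sg j c' ->
  (forall F, F \in facets -> facet_value F c = facet_value F c') -> c = c'.
Proof.
move=> /in_cellP[_ ci] /in_cellP[_ cj] e; apply/mnmP => v.
have [N] := ubnP v; elim: N v => // N IHN v; rewrite ltnS => vN.
have IH (u : 'I_21) : u < v -> c u = c' u by move=> uv; apply: IHN; lia.
(* The vertices after [v] add nothing to the value of [a] and something nonnegative to that of [a'];
   exchanging the words gives the other inequality. *)
have half (a a' : word) k : (forall v, 0 < a v -> v \in cell_sg k) ->
    (forall F, F \in facets -> facet_value F a = facet_value F a') ->
    (forall u : 'I_21, u < v -> a u = a' u) -> a' v <= a v.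
  move=> ak ea IHa; have [F Fin [Fv Fu]] := cell_facet k v.
  have := ea F Fin; rewrite /facet_value /weight.
  rewrite (bigD1 v) //= [in RHS](bigD1 v) //= Fv !muln1.
  rewrite (bigID (fun u : 'I_21 => u < v)) /=.
  rewrite [in X in _ = _ + X](bigID (fun u : 'I_21 => u < v)) /=.
  rewrite [X in (_ + (_ + X))%N = _]big1 => [|u /andP[uv]]; last first.
    rewrite -leqNgt leq_eqVlt val_eqE eq_sym (negbTE uv) /= => vu.
    case: (posnP (a u)) => [->//|/ak us]; by rewrite (negbTE (Fu u vu us)) muln0.
  under eq_bigr => u /andP[_ uv] do rewrite IHa //.
  by lia.
apply/eqP; rewrite eqn_leq; apply/andP; split.
  by apply: (half c' c j cj) => [F Fin|u uv]; rewrite ?e ?IH.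
by apply: (half c c' i ci) => [F Fin|u uv]; rewrite ?e ?IH.
Qed.

Local Open Scope ring_scope.

(** * Words and lattice points *)

Definition ntau (k : nat) : nat := nth 0%N [:: 1; 4; 2]%N k.
(** Positive and negative parts of the coordinates are kept apart as natural numbers, so that
    identities between lattice points can be checked by computation in [nat]. *)
Definition apos (p k i : nat) : nat :=
  ((i == k) + (i == 3 + p) + (i == 3 + (p + ntau k) %% 7))%N.
Definition aneg (p k i : nat) : nat :=
  sumn [seq (i == 3 + (p + (7 - ntau l) %% 7) %% 7 : nat)%N | l <- [:: 0; 1; 2]%N & l != k].

Lemma tau_val (k : 'I_3) : tau k = ntau k :> nat.
Proof. by case: k => [[|[|[|]]]]. Qed.

Lemma Avec_coord (p : 'Z_7) (k : 'I_3) (i : 'I_(3 + 7)) :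
  Avec (p, k) 0 i = (apos p k i)%:Z - (aneg p k i)%:Z.
Proof.
have e_E (q : 'Z_7) : e_ q 0 i = (i == 3 + q :> nat)%N%:Z.
  by rewrite /e_ mxE eqxx /= -val_eqE /=; case: eqP.
have epsE : eps k 0 i = (i == k :> nat)%N%:Z.
  by rewrite /eps mxE eqxx /= -val_eqE /=; case: eqP.
have mE (x y z w : 'rV[int]_(3 + 7)) :
    (x + y + z - w) 0 i = x 0 i + y 0 i + z 0 i - w 0 i by rewrite !mxE.
rewrite /Avec mE summxE epsE !e_E big_mkcond /= !big_ord_recl big_ord0 !e_E.
rewrite /apos !PoszD /=; congr (_ + _ + _ - _).
  by rewrite -tau_val.
have tE (l : 'I_3) : nat_of_ord (p - tau l) = ((p + (7 - ntau l) %% 7) %% 7)%N.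
  by rewrite -tau_val.
by case: k {epsE} => [[|[|[|]]]] //= _; rewrite !tE /aneg /= !PoszD ?addr0 ?add0r.
Qed.

(** The numbering groups the edges [(q, 0)], [(q + 2, 1)], [(q + 3, 2)] into a triple: in the sum of
    their generators all [e_] terms cancel, leaving the sum of the three [eps] for every [q]. *)
Definition shift (k : nat) : nat := nth 0%N [:: 0; 2; 3]%N k.
Definition vertex_base (v : nat) : nat := ((v %/ 3 + shift (v %% 3)) %% 7)%N.

Definition edge_of (v : 'I_21) : edge :=
  (inZp (v %/ 3 + shift (v %% 3))%N : 'Z_7, inZp v : 'I_3).

Lemma edge_of_inj : injective edge_of.
Proof.
move=> u v [e1 e2]; apply: val_inj => /=.
have [hu hv] := (ltn_ord u, ltn_ord v).
have {}e1 : ((u %/ 3 + shift (u %% 3)) %% 7 = (v %/ 3 + shift (v %% 3)) %% 7)%N := e1.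
have {}e2 : (u %% 3 = v %% 3)%N := e2.
move: e1; rewrite e2 => e1.
have : (u %/ 3 = v %/ 3)%N; last by lia.
by move: e1; rewrite /shift; case: (v %% 3)%N => [|[|[|[]]]] /=; lia.
Qed.

Lemma edge_of_bij : bijective edge_of.
Proof.
apply: inj_card_bij edge_of_inj _.
by rewrite card_prod !card_ord.
Qed.

Definition vpos (v i : nat) : nat := apos (vertex_base v) (v %% 3)%N i.
Definition vneg (v i : nat) : nat := aneg (vertex_base v) (v %% 3)%N i.

Lemma Avec_edge_of (v : 'I_21) (i : 'I_(3 + 7)) :
  Avec (edge_of v) 0 i = (vpos v i)%:Z - (vneg v i)%:Z.
Proof. exact: Avec_coord. Qed.

Definition lattice_word (c : word) : lattice := \sum_v Avec (edge_of v) *+ c v.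

Lemma lattice_wordE (c : word) (i : 'I_(3 + 7)) : lattice_word c 0 i =
  (weight (fun v : 'I_21 => vpos v i) c)%:Z - (weight (fun v : 'I_21 => vneg v i) c)%:Z.
Proof.
rewrite summxE /weight !(big_morph _ PoszD (erefl : 0%N%:Z = 0)) -sumrB.
apply: eq_bigr => v _; rewrite mulmxnE Avec_edge_of -mulr_natr natz mulrBl.
by rewrite !PoszM ![_ * (c v)%:Z]mulrC.
Qed.

Lemma lattice_word_eq (c c' : word) : lattice_word c = lattice_word c' <->
  forall i, (i < 10)%N ->
    (weight (fun v : 'I_21 => vpos v i) c + weight (fun v : 'I_21 => vneg v i) c' =
     weight (fun v : 'I_21 => vpos v i) c' + weight (fun v : 'I_21 => vneg v i) c)%N.
Proof.
split=> [e i i10 | e].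
  have := congr1 (fun u : lattice => u 0 (Ordinal i10 : 'I_(3 + 7))) e.
  rewrite !lattice_wordE /=; lia.
apply/rowP => i; rewrite !lattice_wordE; have := e i (ltn_ord i); lia.
Qed.

Lemma lattice_wordD c c' : lattice_word (c + c')%MM = lattice_word c + lattice_word c'.
Proof. by rewrite -big_split; apply: eq_bigr => v _; rewrite mnmDE mulrnDr. Qed.

Lemma rules_ok : all (fun g => [&& all (fun v => v < 21)%N (g.1 ++ g.2), uniq g.1,
  (sumn (map (nth 0%N weights) g.2) < sumn (map (nth 0%N weights) g.1))%N &
  all (fun i => sumn (map (vpos^~ i) g.1) + sumn (map (vneg^~ i) g.2) ==
    sumn (map (vpos^~ i) g.2) + sumn (map (vneg^~ i) g.1))%N (iota 0 10)]) rules.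
Proof. by vm_cast_no_check (erefl true). Qed.

Definition vweight (v : 'I_21) : nat := nth 0%N weights v.

Lemma rule_lattice g : g \in rules -> lattice_word (list_word g.1) = lattice_word (list_word g.2).
Proof.
move=> /(allP rules_ok)/and4P[]; rewrite all_cat => /andP[l1 l2] _ _ /allP id.
apply/lattice_word_eq => i i10.
rewrite (weight_list_word (vpos^~ i) l1) (weight_list_word (vpos^~ i) l2).
rewrite (weight_list_word (vneg^~ i) l1) (weight_list_word (vneg^~ i) l2).
by apply/eqP/id; rewrite mem_iota.
Qed.

Lemma rule_weight g : g \in rules ->
  (weight vweight (list_word g.2) < weight vweight (list_word g.1))%N.
Proof.
move=> /(allP rules_ok)/and4P[]; rewrite all_cat => /andP[l1 l2] _ + _.
by rewrite -(weight_list_word _ l1) -(weight_list_word _ l2).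
Qed.

Lemma rule_divides g (c : word) : g \in rules ->
  (forall v : 'I_21, val v \in g.1 -> (0 < c v)%N) -> exists e, c = (e + list_word g.1)%MM.
Proof.
move=> /(allP rules_ok)/and4P[_ uq _ _] gc; exists (c - list_word g.1)%MM.
rewrite submK //; apply/mnm_lepP => v; rewrite mnmE count_uniq_mem //.
by case: (boolP (val v \in g.1)) => // /gc.
Qed.

Definition standard (c : word) : Prop := exists i, in_cell cell_r cell_sg i c.

(** Reduction is stated for any relation compatible with the rules, as it serves both equality in
    the lattice and congruence modulo a prime. *)
Lemma standard_form (Rel : word -> word -> Prop) :
  (forall c, Rel c c) -> (forall a b c, Rel a b -> Rel b c -> Rel a c) ->
  (forall g e, g \in rules -> Rel (e + list_word g.1)%MM (e + list_word g.2)%MM) ->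
  forall c, exists2 c', standard c' & Rel c c'.
Proof.
move=> rr rt rg c; have [N] := ubnP (weight vweight c); elim: N c => // N IHN c cN.
have [[i ci]|[g gr gc]] := cell_or_rule c; first by exists c => //; exists i.
have [e cE] := rule_divides gr gc.
have [|c' c's rc'] := IHN (e + list_word g.2)%MM.
  by move: cN; rewrite cE !wtD; have := rule_weight gr; lia.
by exists c' => //; rewrite cE; apply: rt (rg g e gr) rc'.
Qed.

Definition frame_facet (l : nat) : seq nat := nth [::] facets (nth 0%N frame l).

(** The facets are integral on the subgroup spanned by the generators, but some of them extend to
    the ambient lattice only with denominator 7. *)
Lemma forms_ok : all (fun l => all (fun v =>
  sumn [seq nth 0%N (nth [::] frame_forms l) i * vpos v i | i <- iota 0 10] ==
  7 * facet_at (frame_facet l) v +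
  sumn [seq nth 0%N (nth [::] frame_forms l) i * vneg v i | i <- iota 0 10])%N
  (iota 0 21)) (iota 0 9).
Proof. by vm_cast_no_check (erefl true). Qed.

Lemma frame_coeffs_ok : all (fun f => all (fun v =>
  facet_at (nth [::] facets f) v +
    sumn [seq (facet_at (frame_facet l) v : nat) | l <- (nth ([::], [::]) frame_coeffs f).2] ==
  sumn [seq (facet_at (frame_facet l) v : nat) | l <- (nth ([::], [::]) frame_coeffs f).1])%N
  (iota 0 21)) (iota 0 24).
Proof. by vm_cast_no_check (erefl true). Qed.

Lemma sumn_weight (T : Type) (s : seq T) (a : T -> 'I_21 -> nat) c :
  weight (fun v => sumn [seq a l v | l <- s]) c = sumn [seq weight (a l) c | l <- s].
Proof.
elim: s => [|l s IHs] /=; first by rewrite /weight big1 // => v _; rewrite muln0.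
by rewrite -IHs /weight -big_split; apply: eq_bigr => v _; rewrite mulnDr.
Qed.

Lemma eq_weight (a b : 'I_21 -> nat) c : a =1 b -> weight a c = weight b c.
Proof. by move=> ab; apply: eq_bigr => v _; rewrite ab. Qed.

Lemma weightDl (a b : 'I_21 -> nat) c :
  weight (fun v => a v + b v)%N c = (weight a c + weight b c)%N.
Proof. by rewrite /weight -big_split; apply: eq_bigr => v _; rewrite mulnDr. Qed.

Lemma weightMl k (a : 'I_21 -> nat) c : weight (fun v => k * a v)%N c = (k * weight a c)%N.
Proof. by rewrite /weight big_distrr; apply: eq_bigr => v _; rewrite mulnCA. Qed.

Lemma frame_lattice (c c' : word) l : (l < 9)%N -> lattice_word c = lattice_word c' ->
  facet_value (frame_facet l) c = facet_value (frame_facet l) c'.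
Proof.
move=> l9 /lattice_word_eq e.
pose form (q : nat -> nat -> nat) (a : word) (i : nat) : nat :=
  (nth 0%N (nth [::] frame_forms l) i * weight (fun v : 'I_21 => q v i) a)%N.
have h (a : word) : sumn [seq form vpos a i | i <- iota 0 10] =
    (7 * facet_value (frame_facet l) a + sumn [seq form vneg a i | i <- iota 0 10])%N.
  under eq_map do rewrite /form -weightMl; rewrite -sumn_weight.
  under [in RHS]eq_map do rewrite /form -weightMl; rewrite -sumn_weight -weightMl -weightDl.
  apply: eq_weight => v; apply/eqP.
  have /allP/(_ l) := forms_ok; rewrite mem_iota => /(_ l9)/allP/(_ v).
  by rewrite mem_iota ltn_ord; apply.
have := h c; have := h c'.
have es : (sumn [seq form vpos c i | i <- iota 0 10] + sumn [seq form vneg c' i | i <- iota 0 10] =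
   sumn [seq form vpos c' i | i <- iota 0 10] + sumn [seq form vneg c i | i <- iota 0 10])%N.
  have : {in iota 0 10, forall i, (i < 10)%N} by move=> i; rewrite mem_iota.
  elim: (iota 0 10) => // i s IHs si /=.
  have := e i (si i (mem_head _ _)).
  have := IHs (fun j js => si j (mem_behead (s := i :: s) js)).
  rewrite /form; nia.
by lia.
Qed.

Lemma facet_frame f (c : word) : (f < 24)%N ->
  (facet_value (nth [::] facets f) c +
    sumn [seq facet_value (frame_facet l) c | l <- (nth ([::], [::]) frame_coeffs f).2] =
  sumn [seq facet_value (frame_facet l) c | l <- (nth ([::], [::]) frame_coeffs f).1])%N.
Proof.
move=> f24; rewrite /facet_value -!sumn_weight -weightDl; apply: eq_weight => v; apply/eqP.
have /allP/(_ f) := frame_coeffs_ok; rewrite mem_iota => /(_ f24)/allP/(_ v).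
by rewrite mem_iota ltn_ord; apply.
Qed.

Lemma frame_coeffs_lt : all (fun f => all (fun l => l < 9)%N (f.1 ++ f.2)) frame_coeffs.
Proof. by []. Qed.

Lemma frame_facet_values (c c' : word) :
  (forall l, (l < 9)%N -> facet_value (frame_facet l) c = facet_value (frame_facet l) c') ->
  forall F, F \in facets -> facet_value F c = facet_value F c'.
Proof.
move=> e F Fin; have f24 : (index F facets < 24)%N by rewrite index_mem.
have := facet_frame c f24; have := facet_frame c' f24; rewrite nth_index //.
have /allP : all (fun l => l < 9)%N ((nth ([::], [::]) frame_coeffs (index F facets)).1
    ++ (nth ([::], [::]) frame_coeffs (index F facets)).2).
  by apply: (allP frame_coeffs_lt); apply: mem_nth.
move=> lt9; have eq_l (s : seq nat) :
    {subset s <= (nth ([::], [::]) frame_coeffs (index F facets)).1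
      ++ (nth ([::], [::]) frame_coeffs (index F facets)).2} ->
    sumn [seq facet_value (frame_facet l) c | l <- s] =
    sumn [seq facet_value (frame_facet l) c' | l <- s].
  by move=> ss; congr sumn; apply/eq_in_map => l /ss /lt9 /e.
rewrite (eq_l _.1); last by move=> l ls; rewrite mem_cat ls.
rewrite (eq_l _.2); last by move=> l ls; rewrite mem_cat ls orbT.
by lia.
Qed.

Lemma standard_frame_inj (c c' : word) : standard c -> standard c' ->
  (forall l, (l < 9)%N -> facet_value (frame_facet l) c = facet_value (frame_facet l) c') ->
  c = c'.
Proof.
by move=> [i ci] [j cj] /frame_facet_values; apply: facet_values_inj ci cj.
Qed.

Lemma standard_lattice_inj (c c' : word) : standard c -> standard c' ->
  lattice_word c = lattice_word c' -> c = c'.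
Proof.
by move=> cs c's e; apply: standard_frame_inj => // l l9; apply: frame_lattice.
Qed.

Lemma lattice_word_in (c : word) : in_SS (lattice_word c).
Proof.
rewrite /lattice_word; elim/big_ind: _ => [|u v|v _]; first exact: in_SS0.
  exact: in_SSD.
elim: (c v) => [|e IHe]; first by rewrite mulr0n; apply: in_SS0.
by rewrite mulrS; apply: in_SSD => //; apply: in_SS_Avec.
Qed.

Definition SS_word (c : word) : SS := SSub (lattice_word_in c).

Lemma SS_word_surj (u : SS) : exists c, u = SS_word c.
Proof.
have [g gK Kg] := edge_of_bij.
have : in_SS u := SSvalP u; rewrite /in_SS => /asboolP[c cE].
exists [multinom c (edge_of v) | v < 21]; apply: val_inj.
rewrite /= cE /lattice_word (reindex edge_of) /=; last first.
  by exists g => x _; [apply: gK | apply: Kg].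
by apply: eq_bigr => v _; rewrite mnmE.
Qed.

Lemma SS_wordD c c' : SS_word (c + c')%MM = SSmul (SS_word c) (SS_word c').
Proof. by apply: val_inj; rewrite /= lattice_wordD. Qed.

Lemma SS_word0 : SS_word 0%MM = SSone.
Proof.
by apply: val_inj; rewrite /= /lattice_word big1 // => v _; rewrite mnm0E mulr0n.
Qed.

Lemma SS_wordU v : SS_word U_(v)%MM = Agen (edge_of v).
Proof.
have e : lattice_word U_(v)%MM = Avec (edge_of v).
  have z : \sum_(u | u != v) Avec (edge_of u) *+ U_(v)%MM u = 0.
    by apply: big1 => u uv; rewrite mnm1E eq_sym (negbTE uv) mulr0n.
  by rewrite /lattice_word (bigD1 v isT) z mnm1E eqxx mulr1n; apply: addr0.
exact/val_inj/e.
Qed.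

Definition frame_word (c : word) : 'X_{1..9} :=
  [multinom facet_value (frame_facet l) c | l < 9].

Lemma frame_wordD c c' : frame_word (c + c')%MM = (frame_word c + frame_word c')%MM.
Proof. by apply/mnmP => l; rewrite mnmDE !mnmE /facet_value wtD. Qed.

Lemma frame_lattice_word c c' : lattice_word c = lattice_word c' ->
  frame_word c = frame_word c'.
Proof. by move=> e; apply/mnmP => l; rewrite !mnmE; apply: frame_lattice. Qed.

Lemma standard_form_lattice c : exists2 c', standard c' & lattice_word c = lattice_word c'.
Proof.
apply: (standard_form (Rel := fun a b => lattice_word a = lattice_word b)) => //.
  by move=> a b d -> ->.
by move=> g e gr; rewrite !lattice_wordD rule_lattice.
Qed.

(** Reduce both words to standard form: a standard word is determined by its frame values, so the
    nine facets separate lattice points. *)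
Lemma frame_word_lattice c c' : frame_word c = frame_word c' ->
  lattice_word c = lattice_word c'.
Proof.
have [d d_std e] := standard_form_lattice c.
have [d' d'_std e'] := standard_form_lattice c'.
rewrite e e' (frame_lattice_word e) (frame_lattice_word e') => /mnmP f.
congr lattice_word; apply: standard_frame_inj => // l l9.
by have := f (Ordinal l9); rewrite !mnmE.
Qed.

Definition SS_frame (u : SS) : 'X_{1..9} := frame_word (sval (cid (SS_word_surj u))).

Lemma SS_frame_word c : SS_frame (SS_word c) = frame_word c.
Proof.
rewrite /SS_frame; case: cid => c' /= /(congr1 SSval) /= e.
exact/esym/frame_lattice_word.
Qed.

Lemma SS_frame_inj : injective SS_frame.
Proof.
move=> u v; have [c ->] := SS_word_surj u; have [d ->] := SS_word_surj v.
by rewrite !SS_frame_word => /frame_word_lattice e; apply: val_inj.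
Qed.

Lemma SS_frameM u v : SS_frame (SSmul u v) = (SS_frame u + SS_frame v)%MM.
Proof.
have [c ->] := SS_word_surj u; have [d ->] := SS_word_surj v.
by rewrite -SS_wordD !SS_frame_word frame_wordD.
Qed.

Lemma SS_frame1 : SS_frame SSone = 0%MM.
Proof.
by have := SS_frameM SSone SSone; rewrite SSmul1 -[X in X = _]addm0 => /addmI.
Qed.

Definition frame_sum (l : nat) (s : seq nat) : nat :=
  sumn [seq (facet_at (frame_facet l) v : nat) | v <- s].

Lemma frame_units_ok : all (fun l =>
  let ab := nth ([::], [::]) frame_units l in
  all (fun v => v < 21)%N (ab.1 ++ ab.2) &&
  all (fun l' => frame_sum l' ab.1 == (l' == l) + frame_sum l' ab.2)%N (iota 0 9))
  (iota 0 9).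
Proof. by vm_cast_no_check (erefl true). Qed.

(** Each variable of the polynomial ring becomes a quotient of two monomials from the semigroup,
    whence both rings have the same fraction field. *)
Lemma frame_unit (l : 'I_9) : exists a b : word, (U_(l) + frame_word b)%MM = frame_word a.
Proof.
exists (list_word (nth ([::], [::]) frame_units l).1).
exists (list_word (nth ([::], [::]) frame_units l).2).
have /allP/(_ l) := frame_units_ok; rewrite mem_iota ltn_ord => /(_ isT)/andP[].
rewrite all_cat => /andP[l1 l2] /allP h; apply/mnmP => l'.
have := h l'; rewrite mem_iota ltn_ord => /(_ isT)/eqP.
rewrite /frame_sum mnmDE mnm1E !mnmE /facet_value -val_eqE /= eq_sym.
rewrite (weight_list_word (fun v => facet_at (frame_facet l') v : nat) l1).
by rewrite (weight_list_word (fun v => facet_at (frame_facet l') v : nat) l2) => ->.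
Qed.

(** * Dickson's lemma and Noetherian rings *)

Lemma increasing_lt (g : nat -> nat) :
  (forall i, (g i < g i.+1)%N) -> forall i j, (i < j)%N -> (g i < g j)%N.
Proof.
move=> gS i; elim=> // j IHj; rewrite ltnS leq_eqVlt => /orP[/eqP ->//|/IHj h].
exact: ltn_trans (gS j).
Qed.

(** Choose repeatedly an index at which [h] attains its minimum over the remaining tail. *)
Lemma monotone_subsequence (h : nat -> nat) : exists g : nat -> nat,
  (forall i, (g i < g i.+1)%N) /\ forall i, (h (g i) <= h (g i.+1))%N.
Proof.
have argmin N : exists i, (N <= i)%N /\ forall j, (N <= j)%N -> (h i <= h j)%N.
  have ex : exists v, `[< exists2 i, (N <= i)%N & h i = v >].
    by exists (h N); apply/asboolP; exists N.
  have [v /asboolP[i Ni <-] mv] := ex_minnP ex; exists i; split=> // j Nj.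
  by apply: mv; apply/asboolP; exists j.
pose next N := sval (cid (argmin N)).
have nextP N : (N <= next N)%N /\ forall j, (N <= j)%N -> (h (next N) <= h j)%N.
  by rewrite /next; case: cid.
exists (fun i => iter i (fun m => next m.+1) (next 0%N)); split=> i.
  by rewrite iterS; have [] := nextP (iter i (fun m => next m.+1) (next 0%N)).+1.
have mono j : (iter i (fun m => next m.+1) (next 0%N) <= j)%N ->
    (h (iter i (fun m => next m.+1) (next 0%N)) <= h j)%N.
  case: i => [|i] /=; first by have [_ m] := nextP 0%N => _; apply: m.
  have [ni m] := nextP (iter i (fun m => next m.+1) (next 0%N)).+1.
  by move=> nj; apply: m; apply: leq_trans nj.
apply: mono; rewrite iterS.
by have [/ltnW] := nextP (iter i (fun m => next m.+1) (next 0%N)).+1.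
Qed.

Lemma dickson n (f : nat -> 'X_{1..n}) :
  exists i j, (i < j)%N /\ (f i <= f j)%MM.
Proof.
suff [g [gS gf]] : exists g : nat -> nat, (forall i, (g i < g i.+1)%N) /\
    forall v, v \in enum 'I_n -> forall i, (f (g i) v <= f (g i.+1) v)%N.
  exists (g 0%N), (g 1%N); split; first exact: gS.
  by apply/mnm_lepP => v; apply: gf; rewrite mem_enum.
elim: (enum 'I_n) => [|v s [g [gS gf]]]; first by exists id; split.
have [h [hS hf]] := monotone_subsequence (fun i => f (g i) v).
exists (fun i => g (h i)); split=> [i|u].
  exact: increasing_lt.
rewrite inE => /orP[/eqP -> i|us i]; first exact: hf.
have := hS i; elim: (h i.+1) => // j IHj; rewrite ltnS leq_eqVlt.
by case/orP=> [/eqP ->|/IHj /leq_trans]; [apply: gf | apply; apply: gf].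
Qed.

(** Otherwise every finite part of [L] could be extended by an element above none of its members,
    and the resulting sequence would contradict [dickson]. *)
Lemma dickson_finite n (L : 'X_{1..n} -> Prop) : exists s : seq 'X_{1..n},
  (forall m, m \in s -> L m) /\ forall m, L m -> exists2 m', m' \in s & (m' <= m)%MM.
Proof.
apply: contrapT => no.
have next (s : seq 'X_{1..n}) : exists m, (forall m', m' \in s -> L m') ->
    L m /\ forall m', m' \in s -> ~~ (m' <= m)%MM.
  have [sL|nsL] := pselect (forall m, m \in s -> L m); last by exists 0%MM.
  apply: contrapT => nm; apply: no; exists s; split=> // m Lm.
  apply: contrapT => sm; apply: nm; exists m => _; split=> // m' m's.
  by apply/negP => m'm; apply: sm; exists m'.
pose nx s := sval (cid (next s)).
have nxP s : (forall m', m' \in s -> L m') ->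
    L (nx s) /\ forall m', m' \in s -> ~~ (m' <= nx s)%MM.
  by rewrite /nx; case: cid.
pose st i := iter i (fun s => rcons s (nx s)) [::].
have stL i m : m \in st i -> L m.
  elim: i m => // i IHi m; rewrite /st iterS -/(st i) mem_rcons inE.
  by case/orP=> [/eqP ->|/IHi //]; have [] := nxP _ IHi.
have [i [j [ij]]] := dickson (fun i => nx (st i)); apply/negP.
have [_] := nxP _ (stL j); apply.
elim: j ij => // j IHj; rewrite ltnS leq_eqVlt /st iterS -/(st j) mem_rcons inE.
by case/orP=> [/eqP ->|/IHj ->]; rewrite ?eqxx ?orbT.
Qed.

Lemma mlead_subr_lt n (k : nzRingType) (p q : {mpoly k[n]}) : mlead p = mlead q ->
  p@_(mlead p) = q@_(mlead q) -> p - q != 0 -> (mlead (p - q) < mlead p)%O.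
Proof.
move=> lpq cpq pq0; rewrite lt_neqAle; apply/andP; split.
  apply: contraNneq pq0 => e.
  by rewrite -mleadc_eq0 e mcoeffB cpq lpq subrr.
by have := mleadB_le p q; rewrite -lpq joinxx.
Qed.

Section Noetherian.

Variables (k : fieldType) (n : nat).

Lemma ideal_gen_sum (R : comNzRingType) (I : finType) (g : I -> R) (x y : R) :
  in_ideal_gen g x -> in_ideal_gen g y -> in_ideal_gen g (x + y).
Proof.
move=> [c ->] [d ->]; exists (fun i => c i + d i); rewrite -big_split.
by apply: eq_bigr => i _; rewrite mulrDl.
Qed.

(** Gordan's argument: finitely many leading monomials divide all others, and division by the
    corresponding elements lowers the leading monomial in a well-founded order. *)
Lemma mpoly_noetherian : noetherian (mpoly n k).
Proof.
move=> I [I0 _ IM]; have I0' : 0 \in I by [].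
have ID x y : x \in I -> y \in I -> x + y \in I by move=> xI yI; rewrite -[x]mul1r IM.
have [s [sL s_min]] := dickson_finite (fun m => exists p : mpoly n k,
  [/\ p \in I, p != 0 & mlead p = m]).
have gex (j : 'I_(size s)) : exists p : mpoly n k,
    [/\ p \in I, p != 0 & mlead p = nth 0%MM s j] by apply/sL/mem_nth.
pose g j := sval (cid (gex j)).
have gP j : [/\ g j \in I, g j != 0 & mlead (g j) = nth 0%MM s j] by rewrite /g; case: cid.
exists (size s), g => x; split; last first.
  move=> [c ->]; elim/big_ind: _ => // j _.
  by have [gI _ _] := gP j; rewrite -[_ * _]addr0 IM.
have [m] : {m | mlead x = m} by exists (mlead x).
elim/(well_founded_ind (@ltom_wf n)): m x => m IHm x xm xI.
have [->|x0] := eqVneq x 0; first by exists (fun=> 0); rewrite big1 // => i _; rewrite mul0r.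
have [|m' /(nthP 0%MM)[j js <-] le_m] := s_min m; first by exists x.
have [gI g0 gm] := gP (Ordinal js); set gj := g _ in gI g0 gm.
have gjc : gj@_(mlead gj) != 0 by rewrite mleadc_eq0.
pose c : k := x@_(mlead x) / gj@_(mlead gj); pose w := (m - mlead gj)%MM.
have c0 : c != 0 by rewrite mulf_neq0 ?invr_eq0 ?mleadc_eq0.
pose y : mpoly n k := c *: 'X_[w] * gj.
have cX0 : c *: 'X_[w] != 0 :> mpoly n k.
  rewrite -(mleadc_eq0 _) mleadZ // mcoeffZ mleadXm mcoeffX eqxx mulr1.
  exact: c0.
have ym : mlead y = m.
  by rewrite /y mleadM // mleadZ // mleadXm /w gm submK.
have yc : y@_(mlead y) = x@_(mlead x).
  rewrite /y mleadM // mleadcM.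
  by rewrite mleadZ // mleadXm mcoeffZ mcoeffX eqxx mulr1 divfK.
have ygen : in_ideal_gen g y.
  exists (fun i => if i == Ordinal js then c *: 'X_[w] else 0).
  rewrite (bigD1 (Ordinal js)) //= eqxx big1 ?addr0 // => i /negbTE ->.
  by rewrite mul0r.
have yI : y \in I by rewrite -[y]addr0 IM.
rewrite -(subrK y x); apply: ideal_gen_sum => //.
have [->|xy0] := eqVneq (x - y) 0.
  by exists (fun=> 0); rewrite big1 // => i _; rewrite mul0r.
apply: (IHm (mlead (x - y))) => //.
  by rewrite -xm; apply: mlead_subr_lt => //; rewrite ym.
by rewrite addrC -mulN1r IM.
Qed.

End Noetherian.

Lemma noetherian_surj (P A : comNzRingType) (f : {rmorphism P -> A}) :
  (forall a, exists p, f p = a) -> noetherian P -> noetherian A.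
Proof.
move=> f_surj P_noeth I [I0 I1 IM].
pose J : {pred P} := [pred p | f p \in I].
have [|n [g gE]] := P_noeth J.
  split; first by rewrite inE rmorph0.
    by rewrite inE rmorph1.
  by move=> a x y; rewrite !inE => xI yI; rewrite rmorphD rmorphM IM.
exists n, (fun i => f (g i)) => x; split.
  have [p <-] := f_surj x; move=> pI; have [/(_ pI)[c ->] _] := gE p.
  exists (fun i => f (c i)); rewrite rmorph_sum; apply: eq_bigr => i _.
  by rewrite rmorphM.
move=> [c ->].
have gI i : f (g i) \in I.
  have [_] := gE (g i); apply; exists (fun j => (j == i)%:R).
  by rewrite (bigD1 i) //= eqxx mul1r big1 ?addr0 // => j /negbTE ->; rewrite mul0r.
elim/big_ind: _ => // [a b aI bI|i _]; first by rewrite -[a]mul1r IM.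
by rewrite -[_ * _]addr0 IM.
Qed.

Lemma fraction_ratio (R : idomainType) (u : {fraction R}) :
  exists n d : R, d != 0 /\ u * FracField.tofrac d = FracField.tofrac n.
Proof.
elim/quotW: u => x; exists (frac x).1, (frac x).2; split; first exact: denom_ratioP.
unlock FracField.tofrac; rewrite -[LHS]FracField.pi_mul; apply/eqmodP => /=.
rewrite FracField.equivfE /FracField.mulf !numden_Ratio ?mulf_neq0 ?oner_eq0 ?denom_ratioP //.
by rewrite !mulr1 mulrC.
Qed.

(** Reducing X^m modulo the monic equation expresses every power of [u] through boundedly many
    powers, so one power of [g] is a common denominator for all of them. *)
Lemma integral_denominator (A : comNzRingType) (K : fieldType) (phi : {rmorphism A -> K})
    (f g : A) (u : K) : integralOver phi u -> u * phi g = phi f ->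
  exists N, forall m, exists r, phi (g ^+ N * f ^+ m) = phi (r * g ^+ m).
Proof.
move=> [p p_monic /rootP pu] ug; exists (size p) => m.
pose q := Pdiv.Ring.rmodp 'X^m p.
have um : u ^+ m = (map_poly phi q).[u].
  have := Pdiv.RingMonic.rdivp_eq p_monic 'X^m => /(congr1 (fun s => (map_poly phi s).[u])).
  by rewrite map_polyXn hornerXn rmorphD rmorphM hornerD hornerM pu mulr0 add0r.
have q_size : (size (map_poly phi q) <= size p)%N.
  apply: leq_trans (size_poly _ _) _; apply: ltnW.
  by rewrite Pdiv.Ring.ltn_rmodp; apply: monic_neq0.
exists (\sum_(i < size p) q`_i * (g ^+ (size p - i) * f ^+ i)).
rewrite !rmorphM !rmorphXn -ug exprMn mulrA um; congr (_ * _).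
rewrite (horner_coef_wide _ q_size) mulr_sumr rmorph_sum; apply: eq_bigr => i _.
rewrite coef_map !rmorphM !rmorphXn -ug exprMn /=.
rewrite -{1}(subnK (ltnW (ltn_ord i))) exprD; ring.
Qed.

(* Among the standard words [f m] two are comparable, and their difference, which
   is supported on one cell, is divisible by the difference of their indices
   because the cell is unimodular. *)
Lemma normal_words (a b e : word) :
  (forall m, exists s, frame_word (e + a *+ m)%MM = frame_word (s + b *+ m)%MM) ->
  exists s, frame_word a = frame_word (b + s)%MM.
Proof.
move=> sat.
have std m : exists s, standard s /\ frame_word (e + a *+ m)%MM = frame_word (s + b *+ m)%MM.
  have [s es] := sat m; have [c c_std sc] := standard_form_lattice s.
  exists c; split=> //; rewrite es !frame_wordD; congr (_ + _)%MM.
  exact: frame_lattice_word.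
pose f m := sval (cid (std m)).
have fP m : standard (f m) /\ frame_word (e + a *+ m)%MM = frame_word (f m + b *+ m)%MM.
  by rewrite /f; case: cid.
have fF m F : F \in facets ->
    (facet_value F e + facet_value F a * m = facet_value F (f m) + facet_value F b * m)%N.
  move=> Fin; rewrite -!wtMn -!wtD; apply: frame_facet_values => // l l9.
  by have [_ /mnmP/(_ (Ordinal l9))] := fP m; rewrite !mnmE.
have [i [j [ij fij]]] := dickson f.
pose ga := (f j - f i)%MM; pose M := (j - i)%N.
have gaE : (ga + f i = f j)%MM by apply: submK.
have M0 : (0 < M)%N by rewrite subn_gt0.
have gaF F : F \in facets ->
    (facet_value F a * M = facet_value F ga + facet_value F b * M)%N.
  move=> Fin; have := fF i F Fin; have := fF j F Fin.
  have : facet_value F (f j) = (facet_value F ga + facet_value F (f i))%N.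
    by rewrite -gaE /facet_value wtD.
  by rewrite /M; nia.
have [[cl /in_cellP[_ fj_cl]] _] := fP j.
have ga_dvd (v : 'I_21) : (M %| ga v)%N.
  have [N] := ubnP v; elim: N v => // N IHN v; rewrite ltnS => vN.
  have [F Fin [Fv Fu]] := cell_facet cl v.
  have : (M %| facet_value F ga)%N.
    by rewrite -(dvdn_addl _ (dvdn_mull (facet_value F b) (dvdnn M))) -gaF // dvdn_mull.
  rewrite /facet_value /weight (bigD1 v) //= Fv muln1 dvdn_addl //.
  apply: dvdn_sum => u uv; have [uv'|vu] := ltnP u v.
    by apply: dvdn_mulr; apply: IHN; apply: leq_trans vN.
  have {}vu : (v < u)%N by rewrite ltn_neqAle vu andbT eq_sym.
  have [->|ga0] := posnP (ga u); first by rewrite mul0n.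
  have ucl : u \in cell_sg cl by apply: fj_cl; rewrite -gaE mnmDE; lia.
  by rewrite (negbTE (Fu u vu ucl)) muln0.
pose s : word := [multinom ga v %/ M | v < 21]%N.
have sE : (s *+ M)%MM = ga by apply/mnmP => v; rewrite mulmnE mnmE divnK.
exists s; apply/mnmP => l; rewrite frame_wordD mnmDE !mnmE.
have Fin : frame_facet l \in facets.
  apply: mem_nth.
  by case: l => [[|[|[|[|[|[|[|[|[|]]]]]]]]]].
have := gaF _ Fin; rewrite -sE {2}/facet_value wtMn -mulnDl => /eqP.
by rewrite eqn_pmul2r // addnC => /eqP.
Qed.

(** * Symmetry of the degrees of the cell basis *)

(* The volumes are products of weights, too large for unary numbers. *)
Definition sumN (T : Type) (f : T -> BinNums.N) (s : seq T) : BinNums.N :=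
  foldr (fun x a => BinNat.N.add (f x) a) BinNums.N0 s.
Definition prodN (T : Type) (f : T -> BinNums.N) (s : seq T) : BinNums.N :=
  foldr (fun x a => BinNat.N.mul (f x) a) (BinNums.Npos BinNums.xH) s.

Lemma sumNE (T : Type) (f : T -> BinNums.N) s :
  nat_of_bin (sumN f s) = (\sum_(x <- s) nat_of_bin (f x))%N.
Proof. by elim: s => [|x s IHs]; rewrite ?big_nil // big_cons -IHs /=; lia. Qed.

Lemma prodNE (T : Type) (f : T -> BinNums.N) s :
  nat_of_bin (prodN f s) = (\prod_(x <- s) nat_of_bin (f x))%N.
Proof.
elim: s => [|x s IHs]; rewrite ?big_nil // big_cons -IHs /=.
by case: (f x) (prodN f s) => [|p] [|q] /=; rewrite ?muln0 // nat_of_mul_pos.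
Qed.

Definition weightN (v : nat) : BinNums.N := bin_of_nat (nth 0%N weights v).

Definition maskN (p : pred nat) : BinNums.N :=
  sumN (fun v => if p v then weightN v else BinNums.N0) (iota 0 21).

Definition coverN (c : seq nat * seq nat) (v : nat) : bool :=
  [|| (v < 3)%N, v \in c.1 | v \in c.2].

Definition volumeN (c : seq nat * seq nat) : BinNums.N :=
  prodN (fun v => if coverN c v then BinNums.Npos BinNums.xH else weightN v) (iota 0 21).

(** The last cell of the shelling; its restriction set is the whole cell apart from the common
    vertices 0, 1, 2. *)
Definition top_cell : 'I_239 := Ordinal (isT : 238 < 239)%N.

Definition lowerN (c : seq nat * seq nat) : BinNums.N :=
  BinNat.N.mul (volumeN c) (BinNat.N.add (BinNat.N.add (maskN (mem c.1)) (maskN (mem c.1)))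
    (maskN (coverN (cell_at top_cell)))).
Definition upperN (c : seq nat * seq nat) : BinNums.N :=
  BinNat.N.mul (volumeN c) (BinNat.N.add (maskN (coverN c))
    (maskN (mem (cell_at top_cell).1))).

Lemma symmetryN_ok : sumN lowerN cells = sumN upperN cells.
Proof. by apply/eqP; vm_cast_no_check (erefl true). Qed.

Lemma maskNE (p : pred nat) : nat_of_bin (maskN p) = (\sum_(v < 21 | p v) vweight v)%N.
Proof.
rewrite sumNE [RHS]big_mkcond -(big_mkord xpredT (fun v => if p v then nth 0 weights v else 0)%N).
by rewrite /index_iota subn0; apply: eq_bigr => v _; case: (p v); rewrite ?bin_of_natK.
Qed.

Lemma volumeNE (i : 'I_239) : nat_of_bin (volumeN (cell_at i)) =
  (\prod_(v | v \notin cell_sg i) vweight v)%N.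
Proof.
rewrite prodNE [RHS]big_mkcond.
under [RHS]eq_bigr do rewrite cell_sgE if_neg -/(coverN (cell_at i) _).
rewrite -(big_mkord xpredT (fun v => if coverN (cell_at i) v then 1 else nth 0 weights v)%N).
by rewrite /index_iota subn0; apply: eq_bigr => v _; case: ifP; rewrite ?bin_of_natK.
Qed.

Lemma sum_cellsN (f : seq nat * seq nat -> BinNums.N) :
  nat_of_bin (sumN f cells) = (\sum_(i < 239) nat_of_bin (f (cell_at i)))%N.
Proof. by rewrite sumNE (big_nth ([::], [::])) cells_size big_mkord. Qed.

Lemma wsum_r i : (\sum_(v in cell_r i) vweight v)%N = nat_of_bin (maskN (mem (cell_at i).1)).
Proof. by rewrite maskNE; apply: eq_bigl => v; rewrite inE. Qed.

Lemma wsum_sg i : (\sum_(v in cell_sg i) vweight v)%N = nat_of_bin (maskN (coverN (cell_at i))).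
Proof. by rewrite maskNE; apply: eq_bigl => v; rewrite cell_sgE. Qed.

(** After cancelling the common vertices 0, 1, 2 it says that the restriction sets carry on average
    half of the remaining weight of their cells: a weighted form of the symmetry of an h-vector. *)
Lemma cells_symmetry :
  (\sum_i (\prod_(v | v \notin cell_sg i) vweight v) *
     (2 * (\sum_(v in cell_r i) vweight v) + \sum_(v in cell_sg top_cell) vweight v) =
   \sum_i (\prod_(v | v \notin cell_sg i) vweight v) *
     (\sum_(v in cell_sg i) vweight v + \sum_(v in cell_r top_cell) vweight v))%N.
Proof.
have addNE a b : nat_of_bin (BinNat.N.add a b) = (nat_of_bin a + nat_of_bin b)%N by lia.
have mulNE a b : nat_of_bin (BinNat.N.mul a b) = (nat_of_bin a * nat_of_bin b)%N.
  by case: a b => [|p] [|q] /=; rewrite ?muln0 // nat_of_mul_pos.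
transitivity (\sum_(i < 239) nat_of_bin (lowerN (cell_at i)))%N.
  apply: eq_bigr => i _.
  by rewrite wsum_r wsum_sg /lowerN mulNE addNE addNE volumeNE addnn -mul2n.
transitivity (\sum_(i < 239) nat_of_bin (upperN (cell_at i)))%N; last first.
  by apply: eq_bigr => i _; rewrite wsum_r wsum_sg /upperN mulNE addNE volumeNE.
have eL := sum_cellsN lowerN; have eU := sum_cellsN upperN.
have e : nat_of_bin (sumN lowerN cells) = nat_of_bin (sumN upperN cells).
  exact (congr1 nat_of_bin symmetryN_ok).
exact (etrans (esym eL) (etrans e eU)).
Qed.

Lemma vweight_gt0 v : (0 < vweight v)%N.
Proof.
have /allP : all (fun w => 0 < w)%N weights by [].
by apply; apply: mem_nth; apply: ltn_ord.
Qed.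

(** * Minors and rewriting rules *)

Definition vtx (p k : nat) : nat := (3 * ((p + 7 - shift k) %% 7) + k)%N.

Lemma vtx_lt p k : (k < 3)%N -> (vtx p k < 21)%N.
Proof. by rewrite /vtx; have := ltn_pmod (p + 7 - shift k) (isT : 0 < 7)%N; lia. Qed.

Lemma edge_of_vtx (v : 'I_21) (p : 'Z_7) (k : 'I_3) : val v = vtx p k -> edge_of v = (p, k).
Proof.
move=> e; have p7 : (p < 7)%N := ltn_ord p; have k3 := ltn_ord k.
have em : (vtx p k %% 3 = k)%N.
  by rewrite /vtx mulnC modnMDl modn_small.
have ed : (vtx p k %/ 3 = (p + 7 - shift k) %% 7)%N.
  by rewrite /vtx mulnC divnMDl // divn_small // addn0.
rewrite /edge_of e; congr (_, _); apply: val_inj; rewrite /= em //.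
rewrite ed modnDml; move: k3; case: (val k : nat) => [|[|[|]]] //= _; rewrite /shift /=; lia.
Qed.

Lemma list_word_cons (v : 'I_21) s : list_word (val v :: s) = (U_(v) + list_word s)%MM.
Proof. by apply/mnmP => u; rewrite mnmDE !mnmE /= -val_eqE eq_sym. Qed.

Lemma list_word_cat s t : list_word (s ++ t) = (list_word s + list_word t)%MM.
Proof. by apply/mnmP => u; rewrite mnmDE !mnmE count_cat. Qed.

Lemma list_word_perm s t : perm_eq s t -> list_word s = list_word t.
Proof. by move=> /seq.permP e; apply/mnmP => u; rewrite !mnmE e. Qed.

(* The monomials of the minor of [def_mx p] on the columns [0] and [j]. *)
Definition upper (p j : nat) : seq nat := [:: vtx p j; vtx ((p + 6) %% 7) 0].
Definition lower (p j : nat) : seq nat := [:: vtx ((p + (7 - ntau j)) %% 7) j; vtx p 0].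

Definition cert_word (f : nat -> nat -> seq nat) (ab : seq nat * seq nat) : seq nat :=
  flatten [seq flatten (nseq (nth 0%N ab.1 p) (f p 1%N)) ++
    flatten (nseq (nth 0%N ab.2 p) (f p 2)) | p <- iota 0 7].

Lemma certs_ok : (size rule_certs == size rules) && all (fun gc =>
  perm_eq (gc.1.1 ++ cert_word lower gc.2) (gc.1.2 ++ cert_word upper gc.2))
  (zip rules rule_certs).
Proof. by vm_cast_no_check (erefl true). Qed.

(** Multiplicities can be made nonnegative because, for fixed columns, the seven minors taken once
    each have the same total word on both sides: adding 1 to all seven multiplicities changes
    nothing after cancellation. *)
Lemma rule_cert g : g \in rules -> exists ab,
  (list_word g.1 + list_word (cert_word lower ab) =
   list_word g.2 + list_word (cert_word upper ab))%MM.
Proof.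
move=> /(nthP ([::], [::]))[i ilt <-]; have /andP[/eqP sz /allP ok] := certs_ok.
exists (nth ([::], [::]) rule_certs i); rewrite -!list_word_cat; apply: list_word_perm.
have := ok (nth (([::], [::]), ([::], [::])) (zip rules rule_certs) i).
rewrite nth_zip //; apply; rewrite -nth_zip //; apply: mem_nth.
by rewrite size_zip sz minnn.
Qed.

Lemma quadrics_ok : all (fun p => all (fun i => all (fun j => all (fun l =>
  apos p i l + apos ((p + (7 - ntau j) %% 7) %% 7) j l +
    aneg p j l + aneg ((p + (7 - ntau i) %% 7) %% 7) i l ==
  apos p j l + apos ((p + (7 - ntau i) %% 7) %% 7) i l +
    aneg p i l + aneg ((p + (7 - ntau j) %% 7) %% 7) j l)%N
  (iota 0 10)) (iota 0 3)) (iota 0 3)) (iota 0 7).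
Proof. by vm_cast_no_check (erefl true). Qed.

Lemma quadric_lattice p (i j : 'I_3) :
  Avec (p, i) + Avec (p - tau j, j) = Avec (p, j) + Avec (p - tau i, i).
Proof.
have tE (l : 'I_3) : val (p - tau l) = ((p + (7 - ntau l) %% 7) %% 7)%N.
  by rewrite -tau_val.
have mE (x y : 'rV[int]_(3 + 7)) l : (x + y) 0 l = x 0 l + y 0 l by rewrite mxE.
have aE q (h : 'I_3) q' (h' : 'I_3) l : (Avec (q, h) + Avec (q', h') : 'rV[int]_(3 + 7)) 0 l =
    (apos q h l)%:Z - (aneg q h l)%:Z + ((apos q' h' l)%:Z - (aneg q' h' l)%:Z).
  by rewrite mE; congr (_ + _); apply: Avec_coord.
apply/rowP => l; apply: etrans (aE _ _ _ _ l) (etrans _ (esym (aE _ _ _ _ l))).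
rewrite !tE.
have /allP/(_ p) := quadrics_ok; rewrite mem_iota ltn_ord => /(_ isT).
move=> /allP/(_ i); rewrite mem_iota ltn_ord => /(_ isT).
move=> /allP/(_ j); rewrite mem_iota ltn_ord => /(_ isT).
move=> /allP/(_ l); rewrite mem_iota ltn_ord => /(_ isT)/eqP.
lia.
Qed.

Section Quadrics.

Variable k : fieldType.

Definition vvar (v : 'I_21) : edge_poly k := tvar k (edge_of v).1 (edge_of v).2.

Lemma minorE p (f : {ffun 'I_2 -> 'I_3}) : \det (colsub f (def_mx k p)) =
  tvar k p (f 0) * tvar k (p - tau (f 1)) (f 1) -
  tvar k p (f 1) * tvar k (p - tau (f 0)) (f 0).
Proof.
rewrite (expand_det_row _ 0) !big_ord_recl big_ord0 /cofactor !det_mx11 !mxE /=.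
rewrite !addr0 /bump /= expr0 mul1r expr1 mulN1r mulrN.
have -> : lift ord0 ord0 = 1 :> 'I_2 by apply: val_inj.
by have -> : lift 1 0 = 0 :> 'I_2 by apply: val_inj.
Qed.

Lemma minor_in p (i j : 'I_3) : base_ideal k
  (tvar k p i * tvar k (p - tau j) j - tvar k p j * tvar k (p - tau i) i).
Proof.
pose pf : 'Z_7 * {ffun 'I_2 -> 'I_3} := (p, [ffun l => if l == 0 then i else j]).
exists (fun pf' => (pf' == pf)%:R).
rewrite (bigD1 pf) //= eqxx mul1r big1 ?addr0; last first.
  by move=> pf' /negbTE ->; rewrite mul0r.
by rewrite minorE !ffunE.
Qed.

Variable Q : {pred edge_poly k}.
Hypothesis Q_prime : prime_ideal Q.
Hypothesis Q_base : forall x, base_ideal k x -> x \in Q.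
Hypothesis Q_mon : forall c : word, mmap1 vvar c \notin Q.

Definition congruent (c d : word) : Prop := mmap1 vvar c - mmap1 vvar d \in Q.

Let Q0 : 0 \in Q. Proof. by have [[]] := Q_prime. Qed.
Let QM a x : x \in Q -> a * x \in Q.
Proof. by have [[_ _ h] _] := Q_prime => xQ; rewrite -[_ * _]addr0 h. Qed.
Let QD x y : x \in Q -> y \in Q -> x + y \in Q.
Proof. by have [[_ _ h] _] := Q_prime => xQ yQ; rewrite -[x]mul1r h. Qed.

Lemma congruent_refl c : congruent c c.
Proof. by rewrite /congruent subrr. Qed.

Lemma congruent_trans c d e : congruent c d -> congruent d e -> congruent c e.
Proof. by move=> cd de; have := QD cd de; rewrite /congruent addrA subrK. Qed.

Lemma congruentD c d c' d' : congruent c d -> congruent c' d' ->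
  congruent (c + c')%MM (d + d')%MM.
Proof.
move=> cd cd'; rewrite /congruent !mmap1D.
have -> : mmap1 vvar c * mmap1 vvar c' - mmap1 vvar d * mmap1 vvar d' =
  mmap1 vvar c' * (mmap1 vvar c - mmap1 vvar d) +
  mmap1 vvar d * (mmap1 vvar c' - mmap1 vvar d') by ring.
by apply: QD; apply: QM.
Qed.

Lemma congruent_cancel c d e : congruent (c + e)%MM (d + e)%MM -> congruent c d.
Proof.
rewrite /congruent !mmap1D -mulrBl; have [_ pr] := Q_prime => /pr.
by rewrite (negbTE (Q_mon e)) orbF.
Qed.

Lemma congruent_quadric p j : (p < 7)%N -> (0 < j < 3)%N ->
  congruent (list_word (upper p j)) (list_word (lower p j)).
Proof.
move=> p7 /andP[j0 j3].
pose P : 'Z_7 := Ordinal (p7 : p < (Zp_trunc 7).+2)%N; pose J := Ordinal j3.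
have vE q i (q7 : (q < 7)%N) (i3 : (i < 3)%N) s : mmap1 vvar (list_word (vtx q i :: s)) =
    tvar k (Ordinal (q7 : q < (Zp_trunc 7).+2)%N) (Ordinal i3) * mmap1 vvar (list_word s).
  have v21 := vtx_lt q i3; rewrite (list_word_cons (Ordinal v21)) mmap1D mmap1U.
  by rewrite /vvar (@edge_of_vtx _ (Ordinal (q7 : q < (Zp_trunc 7).+2)%N) (Ordinal i3)).
have n1 : mmap1 vvar (list_word [::]) = 1.
  have -> : list_word [::] = 0%MM by apply/mnmP => v; rewrite !mnmE.
  exact: mmap11.
have m7 a : (a %% 7 < 7)%N by apply: ltn_pmod.
rewrite /congruent /upper /lower (vE _ _ p7 j3) (vE _ _ (m7 _) (isT : 0 < 3)%N) n1.
rewrite (vE _ _ (m7 _) j3) (vE _ _ p7 (isT : 0 < 3)%N) n1 !mulr1.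
have -> : Ordinal (m7 (p + 6)%N : _ < (Zp_trunc 7).+2)%N = P - tau 0.
  exact: val_inj.
have -> : Ordinal (m7 (p + (7 - ntau j))%N : _ < (Zp_trunc 7).+2)%N = P - tau J.
  apply: val_inj; have -> : val (P - tau J) = ((p + (7 - ntau J) %% 7) %% 7)%N.
    by rewrite -tau_val.
  by rewrite /= modnDmr.
have -> : Ordinal (isT : 0 < 3)%N = 0 :> 'I_3 by apply: val_inj.
have := minor_in P J 0; rewrite [tvar k P 0 * _]mulrC; exact: Q_base.
Qed.

Lemma congruent_cert ab :
  congruent (list_word (cert_word upper ab)) (list_word (cert_word lower ab)).
Proof.
rewrite /cert_word; have : {in iota 0 7, forall p, (p < 7)%N} by move=> p; rewrite mem_iota.
elim: (iota 0 7) => [_|p s IHs ps] /=; first exact: congruent_refl.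
rewrite !list_word_cat; have p7 := ps p (mem_head _ _).
have rep j e : (0 < j < 3)%N -> congruent (list_word (flatten (nseq e (upper p j))))
    (list_word (flatten (nseq e (lower p j)))).
  move=> j3; elim: e => [|e IHe]; first exact: congruent_refl.
  have fl s' : list_word (flatten (nseq e.+1 s')) =
    (list_word s' + list_word (flatten (nseq e s')))%MM by rewrite -list_word_cat.
  by rewrite !fl; apply: congruentD => //; apply: congruent_quadric.
apply: congruentD; first by apply: congruentD; apply: rep.
by apply: IHs => q qs; apply: ps; rewrite inE qs orbT.
Qed.

Lemma congruent_rule g e : g \in rules ->
  congruent (e + list_word g.1)%MM (e + list_word g.2)%MM.
Proof.
move=> /rule_cert[ab eq]; apply: congruentD; first exact: congruent_refl.
apply: (@congruent_cancel _ _ (list_word (cert_word upper ab))).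
apply: (@congruent_trans _ (list_word g.1 + list_word (cert_word lower ab))%MM).
  by apply: congruentD; [apply: congruent_refl | apply: congruent_cert].
by rewrite eq; apply: congruent_refl.
Qed.

End Quadrics.

(** * The semigroup algebra *)

Section SmoothingRing.

(* [chi] is a basis of [A] indexed by the semigroup; keeping [A] abstract
   prevents unification from unfolding the monoid algebra. *)
Variables (k : fieldType) (A : comAlgType k).
Variables (chi : SS -> A) (coef : SS -> A -> k) (support : A -> seq SS).
Hypothesis chi1 : chi SSone = 1.
Hypothesis chiM : forall u v, chi (SSmul u v) = chi u * chi v.
Hypothesis coefD : forall u, {morph coef u : a b / a + b}.
Hypothesis coefZ : forall u (c : k) a, coef u (c *: a) = c * coef u a.
Hypothesis coef_chi : forall u v, coef u (chi v) = (v == u)%:R.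
Hypothesis coef_ext : forall a b, (forall u, coef u a = coef u b) -> a = b.
Hypothesis support_uniq : forall a, uniq (support a).
Hypothesis coef_out : forall u a, u \notin support a -> coef u a = 0.

Lemma coef0 u : coef u 0 = 0.
Proof. by rewrite -(scale0r (0 : A)) coefZ mul0r. Qed.

Lemma coef_sum (I : Type) (s : seq I) (P : pred I) (F : I -> A) u :
  coef u (\sum_(i <- s | P i) F i) = \sum_(i <- s | P i) coef u (F i).
Proof. exact: (big_morph _ (coefD u) (coef0 u)). Qed.

Lemma chi_expand (a : A) : a = \sum_(u <- support a) coef u a *: chi u.
Proof.
apply: coef_ext => u; rewrite coef_sum.
under eq_bigr do rewrite coefZ coef_chi.
have [us|us] := boolP (u \in support a).
  rewrite (bigD1_seq u) ?support_uniq //= eqxx mulr1 big1 ?addr0 // => v /negbTE ->.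
  by rewrite mulr0.
rewrite coef_out // big_seq big1 // => v vs; case: eqP => [vu|_]; last by rewrite mulr0.
by rewrite -vu vs in us.
Qed.

Lemma chi_free (J : finType) (u : J -> SS) (a : J -> k) :
  injective u -> \sum_j a j *: chi (u j) = 0 -> forall j, a j = 0.
Proof.
move=> u_inj s0 j; have := congr1 (coef (u j)) s0; rewrite coef_sum coef0 => <-.
rewrite (bigD1 j) //= coefZ coef_chi eqxx mulr1 big1 ?addr0 // => i ij.
by rewrite coefZ coef_chi (inj_eq u_inj) (negbTE ij) mulr0.
Qed.

Definition gen (v : 'I_21) : A := chi (Agen (edge_of v)).

Lemma mon_gen (c : word) : mmap1 gen c = chi (SS_word c).
Proof.
have morD : {morph (fun m => chi (SS_word m)) : a b / (a + b)%MM >-> a * b}.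
  by move=> a b; rewrite SS_wordD chiM.
have mor0 : chi (SS_word 0%MM) = 1 by rewrite SS_word0.
rewrite {2}(multinomUE_id c) (big_morph _ morD mor0); apply: eq_bigr => v _.
elim: (c v) => [|e IHe]; first by rewrite mulm0n mor0 expr0.
by rewrite mulmS morD exprS IHe SS_wordU.
Qed.

Lemma gen_span (a : A) : exists p : mpoly 21 k, a = mmap (in_alg A) gen p.
Proof.
rewrite (chi_expand a); elim: (support a) => [|u s [p IHp]].
  by exists 0; rewrite big_nil mmap0.
have [c uE] := SS_word_surj u.
exists (coef u a *: 'X_[c] + p).
by rewrite big_cons IHp mmapD mmapZ mmapX mon_gen -uE mulr_algl.
Qed.

Lemma gen_rel (c c' : word) : lattice_word c = lattice_word c' ->
  mmap1 gen c = mmap1 gen c'.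
Proof. by move=> e; rewrite !mon_gen; congr chi; apply: val_inj. Qed.

Lemma standard_free (J : finType) (c : J -> word) (a : J -> k) :
  injective c -> (forall j, exists i, in_cell cell_r cell_sg i (c j)) ->
  \sum_j a j *: mmap1 gen (c j) = 0 -> forall j, a j = 0.
Proof.
move=> c_inj c_std; under eq_bigr do rewrite mon_gen; apply: chi_free => i j.
move=> /(congr1 (fun u : SS => SSval u)) /= e; apply: c_inj.
exact: standard_lattice_inj (c_std i) (c_std j) e.
Qed.

Definition chi_ext (V : lmodType k) (G : SS -> V) (a : A) : V :=
  \sum_(u <- support a) coef u a *: G u.

Lemma chi_ext_sub (V : lmodType k) (G : SS -> V) s a : uniq s ->
  {subset support a <= s} -> chi_ext G a = \sum_(u <- s) coef u a *: G u.
Proof.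
move=> s_uniq as_; rewrite [RHS](bigID (mem (support a))) /= [X in _ + X]big1 ?addr0.
  rewrite -big_filter; apply: perm_big; apply: uniq_perm; rewrite ?filter_uniq //.
  by move=> u; rewrite mem_filter /=; case: (boolP (u \in support a)) => // /as_ ->.
by move=> u /coef_out ->; rewrite scale0r.
Qed.

Lemma chi_ext_linear (V : lmodType k) (G : SS -> V) : linear (chi_ext G).
Proof.
move=> c a b; pose s := undup (support (c *: a + b) ++ support a ++ support b).
have s_uniq : uniq s by apply: undup_uniq.
rewrite !(@chi_ext_sub V G s) //; try by
  move=> u us; rewrite mem_undup !mem_cat us ?orbT.
rewrite scaler_sumr -big_split; apply: eq_bigr => u _.
by rewrite coefD coefZ scalerDl scalerA.
Qed.
HB.instance Definition _ (V : lmodType k) (G : SS -> V) :=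
  GRing.isLinear.Build k A V *:%R (chi_ext G) (chi_ext_linear G).

Lemma chi_ext_chi (V : lmodType k) (G : SS -> V) u : chi_ext G (chi u) = G u.
Proof.
rewrite (@chi_ext_sub V G (undup (u :: support (chi u)))) ?undup_uniq // => [|v vs].
  rewrite (bigD1_seq u) ?undup_uniq ?mem_undup ?mem_head //= coef_chi eqxx scale1r.
  by rewrite big1 ?addr0 // => v vu; rewrite coef_chi eq_sym (negbTE vu) scale0r.
by rewrite mem_undup inE vs orbT.
Qed.

(** Through this embedding [A] inherits from the polynomial ring the absence of zero divisors and a
    monomial order. *)
Definition frame_map : A -> mpoly 9 k := chi_ext (fun u => 'X_[SS_frame u]).
HB.instance Definition _ := GRing.Linear.copy frame_map
  (chi_ext (fun u => 'X_[SS_frame u] : mpoly 9 k)).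

Lemma frame_map_coef u a : (frame_map a)@_(SS_frame u) = coef u a.
Proof.
rewrite /frame_map /chi_ext raddf_sum /=; under eq_bigr do
  rewrite mcoeffZ mcoeffX (inj_eq SS_frame_inj).
have [us|us] := boolP (u \in support a).
  rewrite (bigD1_seq u) ?support_uniq //= eqxx mulr1 big1 ?addr0 // => v /negbTE ->.
  by rewrite mulr0.
rewrite coef_out // big_seq big1 // => v vs; case: eqP => [vu|_]; last by rewrite mulr0.
by rewrite -vu vs in us.
Qed.

Lemma frame_map_out m a : (forall u, SS_frame u != m) -> (frame_map a)@_m = 0.
Proof.
move=> um; rewrite /frame_map /chi_ext raddf_sum big1 //= => u _.
by rewrite mcoeffZ mcoeffX (negbTE (um u)) mulr0.
Qed.

Lemma frame_map_chi u : frame_map (chi u) = 'X_[SS_frame u].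
Proof. exact: chi_ext_chi. Qed.

Lemma frame_map_multiplicative : monoid_morphism frame_map.
Proof.
split; first by rewrite -chi1 frame_map_chi SS_frame1 mpolyX0.
move=> a b; rewrite (chi_expand a) (chi_expand b) mulr_suml !linear_sum mulr_suml.
apply: eq_bigr => u _; rewrite !mulr_sumr linear_sum; apply: eq_bigr => v _.
rewrite -scalerAl -scalerAr -chiM !linearZ /= !frame_map_chi SS_frameM mpolyXD.
by rewrite -scalerAl -scalerAr.
Qed.
HB.instance Definition _ :=
  GRing.isMonoidMorphism.Build A (mpoly 9 k) frame_map frame_map_multiplicative.

Lemma frame_map_inj : injective frame_map.
Proof. by move=> a b e; apply: coef_ext => u; rewrite -!frame_map_coef e. Qed.

Lemma smoothing_dom (a b : A) : a * b = 0 -> a = 0 \/ b = 0.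
Proof.
move=> /(congr1 frame_map); rewrite rmorphM rmorph0 => /eqP.
by rewrite mulf_eq0 -!(rmorph0 frame_map) !(inj_eq frame_map_inj) => /orP[]/eqP; auto.
Qed.

Lemma frame_map_fraction (p : mpoly 9 k) :
  exists r s : A, s != 0 /\ p * frame_map s = frame_map r.
Proof.
have neq0 (a b : A) : a != 0 -> b != 0 -> a * b != 0.
  by move=> /eqP a0 /eqP b0; apply/eqP => /smoothing_dom[].
have n1 : (1 : A) != 0.
  by apply/eqP => /(congr1 frame_map)/eqP; rewrite rmorph1 rmorph0 oner_eq0.
have constP c : exists r s : A, s != 0 /\ c%:MP_[9] * frame_map s = frame_map r.
  exists c%:A, 1; split=> //; rewrite rmorph1 mulr1 linearZ /= rmorph1.
  by rewrite -mul_mpolyC mulr1.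
have mulP f g : (exists r s : A, s != 0 /\ f * frame_map s = frame_map r) ->
    (exists r s : A, s != 0 /\ g * frame_map s = frame_map r) ->
    exists r s : A, s != 0 /\ f * g * frame_map s = frame_map r.
  move=> [r [s [s0 e]]] [r' [s' [s'0 e']]]; exists (r * r'), (s * s').
  by split; [exact: neq0 | rewrite !rmorphM /= -e -e' mulrACA].
have XP m : exists r s : A, s != 0 /\ 'X_[m] * frame_map s = frame_map r.
  rewrite mpolyXE_id; elim/big_ind: _ => //; first by rewrite -mpolyC1; apply: constP.
  move=> l _; elim: (m l) => [|e IHe]; first by rewrite expr0 -mpolyC1; apply: constP.
  rewrite exprS; apply: mulP => //; have [a [b ab]] := frame_unit l.
  exists (chi (SS_word a)), (chi (SS_word b)); split.
    by apply/eqP => /(congr1 (coef (SS_word b)))/eqP; rewrite coef_chi coef0 eqxx oner_eq0.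
  by rewrite !frame_map_chi !SS_frame_word -ab mpolyXD.
elim/mpolyind: p; first by rewrite -mpolyC0; apply: constP.
move=> c m q _ _ [r [s [s0 e]]].
rewrite -mul_mpolyC; have [r' [s' [s'0 e']]] := mulP _ _ (constP c) (XP m).
exists (r' * s + r * s'), (s' * s); split; first exact: neq0.
by rewrite rmorphD !rmorphM /= -e -e'; ring.
Qed.

Definition smoothing_fraction : {rmorphism A -> {fraction {mpoly k[9]}}} :=
  @FracField.tofrac {mpoly k[9]} \o frame_map.

Lemma smoothing_fractionE a : smoothing_fraction a = FracField.tofrac (frame_map a).
Proof. by []. Qed.

Lemma smoothing_fraction_inj : injective smoothing_fraction.
Proof.
by move=> a b /eqP; rewrite !smoothing_fractionE tofrac_eq => /eqP /frame_map_inj.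
Qed.

Lemma smoothing_fraction_field : is_fraction_field smoothing_fraction.
Proof.
split=> [|u]; first exact: smoothing_fraction_inj.
have [n [d [d0 ud]]] := fraction_ratio u.
have [r [s [s0 e]]] := frame_map_fraction n.
have [r' [s' [s'0 e']]] := frame_map_fraction d.
have nz a : a != 0 -> smoothing_fraction a != 0.
  by rewrite -(rmorph0 smoothing_fraction) (inj_eq smoothing_fraction_inj).
have tofrac0 p : p != 0 -> FracField.tofrac p != 0 :> {fraction {mpoly k[9]}}.
  by rewrite tofrac_eq0.
have r'0 : r' != 0.
  rewrite -(inj_eq frame_map_inj) rmorph0 -e' mulf_neq0 //.
  by rewrite -(rmorph0 frame_map) (inj_eq frame_map_inj).
exists (r * s'), (s * r'); split.
  by apply/eqP => /smoothing_dom[/eqP|/eqP]; apply/negP.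
have e1 : u * smoothing_fraction (s * r') = smoothing_fraction (r * s').
  by rewrite !rmorphM !smoothing_fractionE -e -e' !tofracM -ud; ring.
rewrite -e1 mulfK //.
by apply: nz; apply/eqP => /smoothing_dom[/eqP|/eqP]; apply/negP.
Qed.

Lemma mlead_frame_map a : a != 0 -> exists c, mlead (frame_map a) = frame_word c.
Proof.
move=> a0; have fa0 : frame_map a != 0 by rewrite -(rmorph0 frame_map) (inj_eq frame_map_inj).
have [[u <-]|nu] := pselect (exists u, SS_frame u = mlead (frame_map a)).
  by have [c ->] := SS_word_surj u; exists c; rewrite SS_frame_word.
move: fa0; rewrite -mleadc_eq0 frame_map_out ?eqxx // => u.
by apply/eqP => um; apply: nu; exists u.
Qed.

Theorem smoothing_normal : normal_domain A.
Proof.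
exists {fraction {mpoly k[9]}}, smoothing_fraction.
split=> [|u u_int]; first exact: smoothing_fraction_field.
have fm0 a : (frame_map a == 0) = (a == 0).
  by rewrite -(rmorph0 frame_map) (inj_eq frame_map_inj).
have [_ /(_ u)[f [g [g0 ufg]]]] := smoothing_fraction_field.
have phig0 : smoothing_fraction g != 0.
  by rewrite -(rmorph0 smoothing_fraction) (inj_eq smoothing_fraction_inj).
have {ufg} ufg : u * smoothing_fraction g = smoothing_fraction f by rewrite ufg divfK.
have [m] : {m | mlead (frame_map f) = m} by exists (mlead (frame_map f)).
elim/(well_founded_ind (@ltom_wf 9)): m f u ufg u_int => m IHm f u ufg u_int fm.
have [f0|f0] := eqVneq f 0.
  exists 0; apply/eqP; move/eqP: ufg; rewrite f0 !rmorph0 mulf_eq0.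
  by rewrite (negbTE phig0) orbF.
have [N den] := integral_denominator u_int ufg.
have [a fa] := mlead_frame_map f0; have [b gb] := mlead_frame_map g0.
have [e ge] : exists e, mlead (frame_map (g ^+ N)) = frame_word e.
  by apply: mlead_frame_map; rewrite -fm0 rmorphXn expf_neq0 // fm0.
(* Compare leading exponents in the identities g^N f^i = r g^i, one for each [i]. *)
have [|s as_] := @normal_words a b e.
  move=> i; have [r /smoothing_fraction_inj/(congr1 frame_map) re] := den i.
  have r0 : r != 0.
    apply/eqP => r0; move/eqP: re; rewrite r0 mul0r rmorph0 rmorphM mulf_eq0.
    by rewrite !rmorphXn !expf_eq0 !fm0 (negbTE f0) (negbTE g0) !andbF.
  have [c rc] := mlead_frame_map r0; exists c.
  have Mn w : frame_word (w *+ i)%MM = (frame_word w *+ i)%MM.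
    by apply/mnmP => l; rewrite mulmnE !mnmE /facet_value wtMn.
  have X0 x n : x != 0 -> frame_map x ^+ n != 0 by move=> x0; rewrite expf_neq0 // fm0.
  have mX x n : x != 0 -> mlead (frame_map x ^+ n) = (mlead (frame_map x) *+ n)%MM.
    by move=> x0; rewrite mleadX // fm0.
  move: ge re; rewrite !rmorphM !rmorphXn /= => ge /(congr1 (@mlead _ _)).
  by rewrite !mleadM ?X0 ?fm0 // ge !mX // fa gb rc !frame_wordD !Mn.
pose c : k := (frame_map f)@_(mlead (frame_map f)) / (frame_map g)@_(mlead (frame_map g)).
have c0 : c != 0 by rewrite mulf_neq0 ?invr_eq0 ?mleadc_eq0 ?fm0.
have [t tE] : exists t, frame_map t = c *: 'X_[frame_word s].
  by exists (c *: chi (SS_word s)); rewrite linearZ /= frame_map_chi SS_frame_word.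
have t0 : frame_map t != 0.
  by rewrite -mleadc_eq0 tE mleadZ // mcoeffZ mleadXm mcoeffX eqxx mulr1.
have tm : mlead (frame_map t) = frame_word s by rewrite tE mleadZ // mleadXm.
have tgE : frame_map (t * g) = frame_map t * frame_map g by rewrite rmorphM.
have lead_tg : mlead (frame_map f) = mlead (frame_map (t * g)).
  by rewrite tgE mleadM ?t0 ?fm0 // tm gb -frame_wordD addmC -as_.
have coef_tg : (frame_map f)@_(mlead (frame_map f)) =
    (frame_map (t * g))@_(mlead (frame_map (t * g))).
  rewrite tgE mleadM ?t0 ?fm0 // mleadcM tm tE mcoeffZ mcoeffX eqxx mulr1.
  by rewrite divfK // mleadc_eq0 fm0.
have [fg0|fg0] := eqVneq (f - t * g) 0.
  exists t; apply: (mulIf phig0); rewrite ufg -rmorphM; congr (smoothing_fraction _).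
  by apply/eqP; rewrite -subr_eq0 fg0.
have [|||//|r ur] := IHm (mlead (frame_map (f - t * g))) _ (f - t * g) (u - smoothing_fraction t).
- rewrite -fm rmorphB; apply: mlead_subr_lt => //.
  by rewrite -rmorphB fm0.
- by rewrite mulrBl ufg -rmorphM -rmorphB.
- exact: integral_sub u_int (integral_id _ _).
by exists (r + t); rewrite rmorphD -ur subrK.
Qed.

Lemma gen_cell_or_rewrite c : (exists i, in_cell cell_r cell_sg i c) \/
  exists c', (weight vweight c' < weight vweight c)%N /\ mmap1 gen c' = mmap1 gen c.
Proof.
have [std|[g gr gc]] := cell_or_rule c; first by left.
right; have [e cE] := rule_divides gr gc; exists (e + list_word g.2)%MM; split.
  by rewrite cE !wtD ltn_add2l rule_weight.
by apply: gen_rel; rewrite cE !lattice_wordD rule_lattice.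
Qed.

Lemma smoothing_noetherian : noetherian A.
Proof.
pose f : {rmorphism mpoly 21 k -> A} := mmap (in_alg A) gen.
have f_surj (a : A) : exists p, f p = a by have [p ->] := gen_span a; exists p.
by have := @noetherian_surj (mpoly 21 k) A f f_surj; apply; apply: mpoly_noetherian.
Qed.

Definition embedding : edge_poly k -> A :=
  mmap (in_alg A) (fun i => chi (Agen (enum_val i))).
HB.instance Definition _ := GRing.RMorphism.copy embedding
  (mmap (in_alg A) (fun i => chi (Agen (enum_val i)))).

Lemma embeddingZ c f : embedding (c *: f) = c *: embedding f.
Proof. by rewrite /embedding mmapZ mulr_algl. Qed.

Lemma embedding_tvar p j : embedding (tvar k p j) = chi (Agen (p, j)).
Proof. by rewrite /embedding /tvar mmapX mmap1U enum_rankK. Qed.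

Lemma embedding_mon (c : word) : embedding (mmap1 (vvar k) c) = chi (SS_word c).
Proof.
rewrite -mon_gen /mmap1 rmorph_prod; apply: eq_bigr => v _.
by rewrite rmorphXn /= embedding_tvar -surjective_pairing.
Qed.

Lemma embedding_surj a : exists f, embedding f = a.
Proof.
rewrite (chi_expand a); elim: (support a) => [|u s [f fE]].
  by exists 0; rewrite big_nil rmorph0.
have [c uE] := SS_word_surj u; exists (coef u a *: mmap1 (vvar k) c + f).
by rewrite big_cons -fE rmorphD /= embeddingZ embedding_mon -uE.
Qed.

Definition edge_word (m : 'X_{1..#|edge|}) : word :=
  [multinom m (enum_rank (edge_of v)) | v < 21].

Lemma edge_wordE m : 'X_[m] = mmap1 (vvar k) (edge_word m).
Proof.
have [g gK Kg] := edge_of_bij.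
rewrite mpolyXE_id /mmap1 (reindex (fun v => enum_rank (edge_of v))) /=; last first.
  by exists (fun i => g (enum_val i)) => i _; rewrite ?enum_rankK ?gK // Kg enum_valK.
by apply: eq_bigr => v _; rewrite mnmE /vvar /tvar -surjective_pairing.
Qed.

Lemma embedding_sum f : embedding f = \sum_(m <- msupp f) f@_m *: chi (SS_word (edge_word m)).
Proof.
rewrite {1}(mpolyE f) rmorph_sum; apply: eq_bigr => m _.
by rewrite /= embeddingZ edge_wordE embedding_mon.
Qed.

Lemma Agen_neq1 e : Agen e <> SSone.
Proof.
move=> /(congr1 (fun u : SS => eps_deg u)); rewrite /= eps_deg_Avec => e1.
by have := eps_degD 0 0; rewrite addr0 -e1.
Qed.

(** The semigroup is pointed, so only the empty word maps to its unit; the coefficient there is the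
    constant term of [f]. *)
Lemma embedding_at0 f : embedding f = 0 -> f.@[fun _ => 0] = 0.
Proof.
move=> /(congr1 (coef SSone)); rewrite coef0 embedding_sum coef_sum; apply: etrans.
rewrite mevalE; apply: eq_bigr => m _; rewrite coefZ coef_chi; congr (_ * _).
have [->|m0] := eqVneq m 0%MM.
  have -> : edge_word 0%MM = 0%MM by apply/mnmP => v; rewrite !mnmE.
  by rewrite SS_word0 eqxx big1 // => i _; rewrite mnm0E expr0.
have [i mi] : exists i, m i != 0%N.
  apply/existsP; rewrite -negb_forall; apply: contraNN m0 => /forallP m0.
  by apply/eqP/mnmP => i; rewrite mnm0E; apply/eqP.
rewrite (bigD1 i) //= expr0n (negbTE mi) mul0r; case: eqP => // u1.
have [g gK Kg] := edge_of_bij.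
pose v := g (enum_val i).
have wE : edge_word m = (U_(v) + (edge_word m - U_(v)))%MM.
  rewrite addmC submK //; apply/mnm_lepP => u; rewrite mnm1E; case: eqP => // <-.
  by rewrite mnmE /v Kg enum_valK lt0n.
move: u1; rewrite wE SS_wordD SS_wordU => /SSmul_unit[/Agen_neq1[]].
Qed.

Definition kernel : {pred edge_poly k} := [pred f | embedding f == 0].

Lemma kernelE f : (f \in kernel) = (embedding f == 0). Proof. by []. Qed.

Lemma kernel_prime : prime_ideal kernel.
Proof.
split; first split=> [||a x y].
- by rewrite kernelE rmorph0.
- rewrite kernelE rmorph1; apply/eqP => /(congr1 frame_map)/eqP.
  by rewrite rmorph1 rmorph0 oner_eq0.
- rewrite !kernelE => /eqP x0 /eqP y0.
  by rewrite rmorphD rmorphM /= x0 y0 mulr0 addr0.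
move=> x y; rewrite !kernelE rmorphM => /eqP /smoothing_dom[->|->];
by rewrite eqxx ?orbT.
Qed.

Lemma kernel_base f : base_ideal k f -> f \in kernel.
Proof.
move=> [c ->]; rewrite kernelE rmorph_sum big1 // => -[p s] _.
rewrite rmorphM minorE rmorphB !rmorphM /= !embedding_tvar -!chiM.
have -> : SSmul (Agen (p, s 0)) (Agen (p - tau (s 1), s 1)) =
    SSmul (Agen (p, s 1)) (Agen (p - tau (s 0), s 0)).
  exact/val_inj/quadric_lattice.
by rewrite subrr mulr0.
Qed.

Lemma chi_neq0 u : chi u != 0.
Proof. by apply/eqP => /(congr1 (coef u))/eqP; rewrite coef_chi coef0 eqxx oner_eq0. Qed.

Theorem kernel_minimal : minimal_prime_over (base_ideal k) kernel.
Proof.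
split=> [||Q Q_prime Q_base Q_sub f]; [exact: kernel_prime | exact: kernel_base |].
have Q_mon (c : word) : mmap1 (vvar k) c \notin Q.
  by apply/negP => /Q_sub; rewrite kernelE embedding_mon (negbTE (chi_neq0 _)).
have [[Q0 _ QM] _] := Q_prime.
have st (u : SS) : exists c, standard c /\ u = SS_word c.
  have [c ->] := SS_word_surj u; have [c' c's e] := standard_form_lattice c.
  by exists c'; split=> //; apply: val_inj.
pose w u := sval (cid (st u)).
have wP u : standard (w u) /\ u = SS_word (w u) by rewrite /w; case: cid.
have cw (c : word) : congruent Q c (w (SS_word c)).
  have [||g e gr|c' c's [cc' e]] := @standard_form
    (fun a b => congruent Q a b /\ lattice_word a = lattice_word b) _ _ _ c.
  - by move=> a; split=> //; apply: congruent_refl.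
  - move=> a b d [ab ->] [bd ->]; split=> //.
    exact: congruent_trans ab bd.
  - split; first exact: congruent_rule.
    by rewrite !lattice_wordD rule_lattice.
  have [ws /(congr1 SSval) /= we] := wP (SS_word c).
  suff -> : w (SS_word c) = c' by [].
  by apply: standard_lattice_inj => //; rewrite -we.
rewrite kernelE => /eqP f0.
(* Sending each basis element to its standard monomial gives a linear section of [embedding]. The
   image of [f] under both maps agrees with [f] modulo [Q], and it is 0 because
   [embedding f = 0]. *)
pose G u : {mpoly k[#|edge|]} := mmap1 (vvar k) (w u).
have h0 : \sum_(m <- msupp f) f@_m *: G (SS_word (edge_word m)) = 0.
  have : chi_ext G (embedding f) = 0 by rewrite f0 linear0.
  rewrite embedding_sum linear_sum; apply: etrans; apply: eq_bigr => m _.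
  by rewrite linearZ /= chi_ext_chi.
rewrite -[f]subr0 -h0 {1}(mpolyE f) -sumrB big_seq.
elim/big_ind: _ => // [x y xQ yQ|m _]; first by rewrite -[x]mul1r QM.
by rewrite -scalerBr -mul_mpolyC -[_ * _]addr0 QM // edge_wordE; apply: cw.
Qed.

Theorem smoothing_toric : affine_toric A.
Proof.
pose g (v : 'I_21) : 'rV[int]_10 := Avec (edge_of v).
pose chi' (u : 'rV[int]_10) : A := if (insub (u : lattice) : option SS) is Some s then chi s else 0.
have inM (u : lattice) : in_submonoid_gen g u <-> in_SS u.
  split=> [[c ->]|].
    have := lattice_word_in [multinom c v | v < 21].
    by rewrite /lattice_word; under eq_bigr do rewrite mnmE.
  move=> uS; have [c /(congr1 SSval) /= uE] := SS_word_surj (SSub uS).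
  by exists c; rewrite uE.
have chi'E (s : SS) : chi' (SSval s) = chi s by rewrite /chi' valK.
exists 10%N, 21%N, g, chi'; split.
- by rewrite (chi'E SSone) chi1.
- move=> u v /inM uS /inM vS.
  rewrite (chi'E (SSub uS)) (chi'E (SSub vS)) -chiM.
  exact: (chi'E (SSmul (SSub uS) (SSub vS))).
- move=> s c s_uniq sM s0 u us.
  have /inM uS := sM u us.
  have := congr1 (coef (SSub uS)) s0; rewrite coef0 coef_sum.
  rewrite (bigD1_seq u) //= coefZ (chi'E (SSub uS)) coef_chi eqxx mulr1.
  rewrite big_seq_cond big1 ?addr0 // => v /andP[vs vu].
  have /inM vS := sM v vs.
  rewrite coefZ (chi'E (SSub vS)) coef_chi.
  case: eqP => [/(congr1 SSval) /= e|_]; last by rewrite mulr0.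
  by rewrite e eqxx in vu.
move=> a; exists (map SSval (support a)).
exists (fun u => if (insub (u : lattice) : option SS) is Some s then coef s a else 0); split.
  by move=> u /mapP[s _ ->]; apply/inM/SSvalP.
rewrite big_map {1}(chi_expand a); apply: eq_bigr => s _.
by rewrite chi'E valK.
Qed.

(** The interpolation nodes are the numbers 0, ..., 20, which must stay distinct in [k]. *)
Hypothesis natr_inj : injective (fun v : 'I_21 => (val v)%:R : k).

Theorem smoothing_gorenstein : gorenstein A.
Proof.
(* A common multiple of all weights, so that every [d v] is an exact quotient. *)
pose C := (\prod_v vweight v)%N; pose d v := (C %/ vweight v)%N.
have C_gt0 : (0 < C)%N by apply: prodn_gt0 => v; apply: vweight_gt0.
have dC v : (d v * vweight v = C)%N.
  by rewrite /d divnK // /C (bigD1 v) //= dvdn_mulr.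
have [btop sym] := basis_sym_exists C_gt0 dC (@cell_order_holds) cell_r_sg cell_sg_card
  cells_symmetry.
have frob := cell_frobenius natr_inj C_gt0 dC gen_cell_or_rewrite (@cell_order_holds)
  cell_r_sg cell_sg_card (@standard_free) gen_span (@smoothing_dom) sym.
have h := @frobenius_gorenstein k A _ _ (in_alg A) _ smoothing_fraction 9
  smoothing_fraction_inj smoothing_noetherian (@mpoly_ext_bound _ _ _) frob.
exact: h.
Qed.

End SmoothingRing.

(** * The monoid algebra of the semigroup with its monomial basis *)

Section Instance.

Variable k : fieldType.
Local Notation A := (smoothing_ring k).

Definition monom (u : SS) : A := monalg.mkmalgU u 1.
Definition coeff (u : SS) (a : A) : k := monalg.mcoeff u a.
Definition terms (a : A) : seq SS := finmap.enum_fset (monalg.msupp a).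

Lemma monom1 : monom SSone = 1. Proof. by []. Qed.

Lemma monomM u v : monom (SSmul u v) = monom u * monom v.
Proof. by rewrite monalg.malgM_def [RHS]monalg.fgmulUU mul1r. Qed.

Lemma coeffD u : {morph coeff u : a b / a + b}. Proof. exact: monalg.mcoeffD. Qed.

Lemma coeffZ u (c : k) (a : A) : coeff u (c *: a) = c * coeff u a.
Proof. exact: monalg.mcoeffZ. Qed.

Lemma coeff_monom u v : coeff u (monom v) = (v == u)%:R.
Proof. exact: monalg.mcoeffU1. Qed.

Lemma coeff_ext a b : (forall u, coeff u a = coeff u b) -> a = b.
Proof. by move=> e; apply/monalg.malgP. Qed.

Lemma terms_uniq a : uniq (terms a). Proof. exact: finmap.fset_uniq. Qed.

Lemma coeff_out u a : u \notin terms a -> coeff u a = 0.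
Proof. exact: monalg.mcoeff_outdom. Qed.

End Instance.

(** The first block ties the algebra to the base space: a minimal prime is an irreducible component,
    vanishing at the origin makes it visible in the germ, and surjectivity makes the embedding
    closed. The second block then concerns this component. *)
Theorem corollary7p2 (R : realType) :
  [/\ minimal_prime_over (base_ideal R[i]) (smoothing_ideal R[i]),
      forall f, f \in smoothing_ideal R[i] -> (f.@[fun _ => 0] = 0)%R &
      forall a : smoothing_ring R[i], exists f, smoothing_embedding f = a]
  /\
  [/\ affine_toric (smoothing_ring R[i]),
      normal_domain (smoothing_ring R[i]) &
      gorenstein (smoothing_ring R[i])].
Proof.
have nat_inj : injective (fun v : 'I_21 => (val v)%:R : R[i]).
  by move=> u v /eqP; rewrite eqr_nat => /eqP /val_inj.
have c1 := monom1 R[i]; have cM := @monomM R[i].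
have cD := @coeffD R[i]; have cZ := @coeffZ R[i]; have cc := @coeff_monom R[i].
have ce := @coeff_ext R[i]; have su := @terms_uniq R[i]; have co := @coeff_out R[i].
split; split.
- have h := kernel_minimal c1 cM cD cZ cc ce su co; exact: h.
- move=> f /eqP f0; exact: (embedding_at0 c1 cM cD cZ cc f0).
- have h := embedding_surj c1 cM cD cZ cc ce su co; exact: h.
- have h := smoothing_toric c1 cM cD cZ cc ce su co; exact: h.
- have h := smoothing_normal c1 cM cD cZ cc ce su co; exact: h.
- have h := smoothing_gorenstein c1 cM cD cZ cc ce su co nat_inj; exact: h.
Qed.
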